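(* Let $\Omega$ be a convex, bounded domain in $\mathbb{R}^2$, symmetric with respect to the $y$-axis. Let $a>0$ and let $p,-q:(-a,a)\to\mathbb{R}$ be concave, even functions such that $$\Omega=\{(x,y)\in\mathbb{R}^2:\ -a<x<a,\ q(x)<y<p(x)\}.$$ Then $$\mu_1^{odd}(\Omega)\ \ge\ \mu_1(-a,a).$$ Moreover, equality holds for every rectangle: if $\Omega=(-a,a)\times(-b,b)$ with $b>0$, then $\mu_1^{odd}(\Omega)=\mu_1(-a,a)$.
   Context: Gaussian measure: $d\gamma_x=\frac{1}{\sqrt{2\pi}}e^{-x^2/2}\,dx$ on $\mathbb{R}$, and $d\gamma_2=d\gamma_x\otimes d\gamma_y=\frac{1}{2\pi}e^{-(x^2+y^2)/2}\,dx\,dy$ on $\mathbb{R}^2$. Neumann eigenvalue problem: for a domain $\Omega\subset\mathbb{R}^2$ with outward normal $\nu$, consider $$-\mathrm{div}\left(e^{-\frac{x^2+y^2}{2}}\nabla u\right)=\mu\, e^{-\frac{x^2+y^2}{2}}u\ \text{ in }\Omega,\qquad \frac{\partial u}{\partial\nu}=0\ \text{ on }\partial\Omega,$$ understood in the weak sense: $u\in H^1(\Omega,d\gamma_2)$, $u\neq 0$, and $\int_\Omega \nabla u\cdot\nabla\varphi\,d\gamma_2=\mu\int_\Omega u\varphi\,d\gamma_2$ for all $\varphi\in H^1(\Omega,d\gamma_2)$. Here $H^1(\Omega,d\gamma_2)$ is the weighted Sobolev space of functions which, together with their weak first derivatives, belong to $L^2(\Omega,d\gamma_2)$. For $\Omega$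 symmetric with respect to the $y$-axis, $\mu_1^{odd}(\Omega)$ is the lowest eigenvalue $\mu$ of this problem having a corresponding eigenfunction $u$ that is odd with respect to the $y$-axis, i.e. $u(-x,y)=-u(x,y)$. For $-\infty\le \alpha<\beta\le\infty$, $\mu_1(\alpha,\beta)$ is the first nontrivial eigenvalue of the one-dimensional problem $-v''+xv'=\mu v$ in $(\alpha,\beta)$, $v'(\alpha)=v'(\beta)=0$; equivalently $$\mu_1(\alpha,\beta)=\min\left\{\frac{\int_\alpha^\beta (z')^2\,d\gamma_x}{\int_\alpha^\beta z^2\,d\gamma_x}:\ z\in H^1((\alpha,\beta),d\gamma_x),\ z\ne0,\ \int_\alpha^\beta z\,d\gamma_x=0\right\}.$$ *)

(* Defs.v *)
From HB Require Import structures.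
From mathcomp Require Import all_boot all_order all_algebra.
From mathcomp Require Import all_classical all_reals all_analysis.
Import numFieldNormedType.Exports.

Set Implicit Arguments.
Unset Strict Implicit.
Unset Printing Implicit Defensive.

Import Order.TTheory GRing.Theory Num.Theory.
Local Open Scope classical_set_scope.
Local Open Scope ring_scope.

Definition leb1 (R : realType) : {measure set (measurableTypeR R) -> \bar R} :=
  lebesgue_measure.

Definition leb2 (R : realType) :
    {measure set (measurableTypeR R * measurableTypeR R) -> \bar R} :=
  (@leb1 R \x @leb1 R)%E.

Definition gauss1 (R : realType) : {measure set (measurableTypeR R) -> \bar R} :=
  normal_prob 0 1.

Definition gauss2 (R : realType) :
    {measure set (measurableTypeR R * measurableTypeR R) -> \bar R} :=
  (@gauss1 R \x @gauss1 R)%E.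

Arguments leb1 R : clear implicits.
Arguments leb2 R : clear implicits.
Arguments gauss1 R : clear implicits.
Arguments gauss2 R : clear implicits.

Definition supported_in (R : realType) (T : topologicalType) (D : set T)
    (phi : T -> R) : Prop :=
  exists K : set T,
    [/\ compact K, K `<=` D & forall z, ~ K z -> phi z = 0].

Definition smooth1 (R : realType) (phi : R -> R) : Prop :=
  forall (n : nat) (x : R), derivable (derive1n n phi) x 1.

Definition partial_x (R : realType) (phi : R * R -> R) : R * R -> R :=
  fun z => derive1 (fun s : R => phi (s, z.2)) z.1.

Definition partial_y (R : realType) (phi : R * R -> R) : R * R -> R :=
  fun z => derive1 (fun s : R => phi (z.1, s)) z.2.

(** [Ck n phi]: all iterated partial derivatives of [phi] of order at most [n]
    exist and are continuous on the whole plane. *)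
Fixpoint Ck (R : realType) (n : nat) (phi : R * R -> R) : Prop :=
  continuous phi /\
  if n is m.+1 then
    [/\ forall z : R * R, derivable (fun s : R => phi (s, z.2)) z.1 1,
        forall z : R * R, derivable (fun s : R => phi (z.1, s)) z.2 1,
        Ck m (partial_x phi) & Ck m (partial_y phi)]
  else True.

Definition smooth2 (R : realType) (phi : R * R -> R) : Prop :=
  forall n : nat, Ck n phi.

Definition weak_deriv (R : realType) (D : set R) (u g : R -> R) : Prop :=
  forall phi : R -> R, smooth1 phi -> supported_in D phi ->
    \int[leb1 R]_(x in D) (u x * derive1 phi x) =
    - \int[leb1 R]_(x in D) (g x * phi x).

Definition weak_partial_x (R : realType) (D : set (R * R))
    (u g : R * R -> R) : Prop :=
  forall phi : R * R -> R, smooth2 phi -> supported_in D phi ->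
    \int[leb2 R]_(z in D) (u z * partial_x phi z) =
    - \int[leb2 R]_(z in D) (g z * phi z).

Definition weak_partial_y (R : realType) (D : set (R * R))
    (u g : R * R -> R) : Prop :=
  forall phi : R * R -> R, smooth2 phi -> supported_in D phi ->
    \int[leb2 R]_(z in D) (u z * partial_y phi z) =
    - \int[leb2 R]_(z in D) (g z * phi z).

Definition L2_on (d : measure_display) (T : measurableType d) (R : realType)
    (m : {measure set T -> \bar R}) (D : set T) (f : T -> R) : Prop :=
  measurable_fun D f /\ m.-integrable D (fun z => (f z ^+ 2)%:E).

(** [H1_1 D u u']: [u] is in H^1(D, gauss1), with weak derivative [u']. *)
Definition H1_1 (R : realType) (D : set R) (u u' : R -> R) : Prop :=
  [/\ L2_on (gauss1 R) D u, L2_on (gauss1 R) D u' & weak_deriv D u u'].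

(** [H1_2 D u ux uy]: [u] is in H^1(D, gauss2), with weak gradient
    [(ux, uy)]. *)
Definition H1_2 (R : realType) (D : set (R * R))
    (u ux uy : R * R -> R) : Prop :=
  [/\ L2_on (gauss2 R) D u, L2_on (gauss2 R) D ux, L2_on (gauss2 R) D uy,
      weak_partial_x D u ux & weak_partial_y D u uy].

(** Elements of L^2 are represented by functions, so that "nonzero" and "odd"
    are understood up to null sets. *)

Definition neumann_eigenfunction1 (R : realType) (D : set R) (mu : R)
    (v v' : R -> R) : Prop :=
  [/\ H1_1 D v v',
      ~ {ae gauss1 R, forall x, D x -> v x = 0} &
      forall phi phi' : R -> R, H1_1 D phi phi' ->
        \int[gauss1 R]_(x in D) (v' x * phi' x) =
        mu * \int[gauss1 R]_(x in D) (v x * phi x)].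

Definition neumann_eigenvalue1 (R : realType) (D : set R) (mu : R) : Prop :=
  exists v v' : R -> R, neumann_eigenfunction1 D mu v v'.

Definition neumann_eigenfunction2 (R : realType) (D : set (R * R)) (mu : R)
    (u ux uy : R * R -> R) : Prop :=
  [/\ H1_2 D u ux uy,
      ~ {ae gauss2 R, forall z, D z -> u z = 0} &
      forall phi phix phiy : R * R -> R, H1_2 D phi phix phiy ->
        \int[gauss2 R]_(z in D) (ux z * phix z + uy z * phiy z) =
        mu * \int[gauss2 R]_(z in D) (u z * phi z)].

Definition odd_on (R : realType) (D : set (R * R)) (u : R * R -> R) : Prop :=
  {ae gauss2 R, forall z, D z -> u (- z.1, z.2) = - u z}.

Definition odd_neumann_eigenvalue2 (R : realType) (D : set (R * R)) (mu : R) :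
    Prop :=
  exists u ux uy : R * R -> R,
    neumann_eigenfunction2 D mu u ux uy /\ odd_on D u.

(** Equal to the minimum of [A] whenever it is attained; +oo on the empty set,
    rather than the junk value 0 of the real-valued [inf]. *)
Definition lowest (R : realType) (A : set R) : \bar R :=
  ereal_inf [set mu%:E | mu in A].

(** First nontrivial eigenvalue of -v'' + x v' = mu v on ]alpha, beta[ with
    v'(alpha) = v'(beta) = 0.  Multiplying by the density of [gauss1] puts the
    equation in the form -(e^(-x^2/2) v')' = mu e^(-x^2/2) v, whose weak form
    is [neumann_eigenfunction1]; the trivial eigenvalue is 0 (constants). *)
Definition mu1 (R : realType) (alpha beta : \bar R) : \bar R :=
  lowest [set mu : R |
    neumann_eigenvalue1 [set x : R | (alpha < x%:E < beta)%E] mu /\ mu <> 0].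

Definition mu1_odd (R : realType) (Omega : set (R * R)) : \bar R :=
  lowest [set mu : R | odd_neumann_eigenvalue2 Omega mu].

Definition bounded_convex_domain (R : realType) (Omega : set (R * R)) : Prop :=
  [/\ open Omega, connected Omega, Omega !=set0, bounded_set Omega &
      convex_set Omega].

Definition y_axis_symmetric (R : realType) (Omega : set (R * R)) : Prop :=
  forall x y : R, Omega (x, y) -> Omega (- x, y).

Definition concave_on (R : realType) (D : set R) (f : R -> R) : Prop :=
  @convex_function R R^o D (fun x => - f x).

Definition even_on (R : realType) (D : set R) (f : R -> R) : Prop :=
  forall x, D x -> f (- x) = f x.

(* Main.v *)
Require Import Defs.
From mathcomp Require Import all_boot all_order all_algebra.
From mathcomp Require Import all_classical all_reals all_analysis.
From mathcomp Require Import measurable_realfun measurable_fun_approximation.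
From mathcomp Require Import ring lra.
Import numFieldNormedType.Exports.
Import Order.TTheory GRing.Theory Num.Theory.
Local Open Scope classical_set_scope.
Local Open Scope ring_scope.

Set Implicit Arguments.
Unset Strict Implicit.
Unset Printing Implicit Defensive.

(** Let v be the odd solution of v'' = x v' - l v with v'(0) = 1, where l > 0 is
    chosen so that s = v' is positive inside ]-a, a[ and vanishes at both ends
    ([exists_ground_state]).  Everything rests on two facts: v is a Neumann
    eigenfunction for l, both on the interval and (as a function of x alone) on
    the rectangle, and l bounds from below every nonzero eigenvalue on the
    interval and every odd eigenvalue on Omega.
    Hence mu_1(-a, a) <= l <= mu_1^odd(Omega) in general, and for a rectangle
    also mu_1^odd(Omega) <= l <= mu_1(-a, a).

    Lower bounds.  Write r for the Gaussian density.  Since s > 0, the function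
    k = - l v / s is a solution of the Riccati equation
    k' = - x k - k^2 - l, so that, for phi vanishing near -a and a,
      int phi'^2 / r - l int phi^2 / r = int (phi' - k phi)^2 / r >= 0
    ([hardy]).  Put F = phi / r and W = - phi' / r: this reads
    l int F^2 <= int W^2 for the Gaussian measure, while the definition of the
    weak derivative g of u reads int u W = int g F.  If u can be approximated
    in L2 by such W, then by duality l int u^2 <= int g^2 ([poincare_dense]).
    Only the definition of weak derivatives and density in L2 are involved:
    neither traces, nor regularity, nor approximation in H^1.

    It remains to see which u can be approximated.  On the interval, r W must
    have a compactly supported primitive, that is, W must have mean zero; these
    W are dense among the L2 functions of mean zero ([mean_zero_poincare]), and
    eigenfunctions of nonzero eigenvalues have mean zero.  On Omega it suffices
    that W be odd in x: then r W has, on each horizontal line, an even compactly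
    supported primitive, and as the slices of Omega by such lines are
    symmetric intervals its support stays in Omega.  Hence
    l int u^2 <= int u_x^2 <= int |grad u|^2 for odd u ([odd_poincare]).
    Density in L2 is obtained from bumps approximating indicators of small
    intervals or rectangles and a Dynkin argument ([L2_approximable]).

    The eigenfunction.  The equation reads (s r)' = - l v r, so the weak equation
    for v against an arbitrary H^1 function would be the definition of its weak
    derivative for the test function s r, if s r were supported in ]-a, a[.
    Multiplied by a cut-off it is; the extra term, s times the derivative of the
    cut-off, is bounded and tends to 0 pointwise because s vanishes linearly at
    the ends ([herm_weak_equation], [rectangle_weak_equation]). *)

(** * Derivatives and smooth functions of one variable *)

Section smooth.
Variable R : realType.
Implicit Types f g h : R -> R.

(** The calculus rules with the function displayed pointwise: the derivative of
    an explicit expression is then found by composing terms. *)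
Lemma is_derive_mul f g x (df dg : R) : is_derive x (1 : R) f df ->
  is_derive x (1 : R) g dg ->
  is_derive x (1 : R) (fun y => f y * g y) (df * g x + f x * dg).
Proof.
move=> fx gx; have h : is_derive x (1 : R) (f * g) _ := is_deriveM fx gx.
by apply: (is_derive_eq h); rewrite addrC; congr (_ + _); rewrite [LHS]mulrC.
Qed.

Lemma is_derive_add f g x (df dg : R) : is_derive x (1 : R) f df ->
  is_derive x (1 : R) g dg ->
  is_derive x (1 : R) (fun y => f y + g y) (df + dg).
Proof. by move=> fx gx; exact: is_deriveD. Qed.

Lemma is_derive_scale f x (c df : R) : is_derive x (1 : R) f df ->
  is_derive x (1 : R) (fun y => c * f y) (c * df).
Proof. by move=> fx; exact: is_deriveZ. Qed.

Lemma is_derive_opp f x (df : R) : is_derive x (1 : R) f df ->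
  is_derive x (1 : R) (fun y => - f y) (- df).
Proof. by move=> fx; exact: is_deriveN. Qed.

Lemma is_derive_affine (a b x : R) :
  is_derive x (1 : R) (fun y => a * y + b) a.
Proof.
have h := is_derive_add (is_derive_scale a (is_derive_id x (1 : R)))
  (is_derive_cst b x (1 : R)).
by apply: (is_derive_eq h); rewrite addr0 mulr1.
Qed.

Lemma is_derive_compose f g x (df dg : R) : is_derive (g x) (1 : R) f df ->
  is_derive x (1 : R) g dg ->
  is_derive x (1 : R) (fun y => f (g y)) (dg * df).
Proof.
move=> fx gx; have h : is_derive x (1 : R) (f \o g) _ := is_derive1_comp fx gx.
by apply: (is_derive_eq h); rewrite mulrC.
Qed.

(** Unlike iterated [derive1], a derivative given up to a pointwise proof is
    stable under the induction on the order. *)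
Fixpoint nsmooth (n : nat) f : Prop :=
  if n is m.+1 then
    exists f', (forall x, is_derive x (1 : R) f (f' x)) /\ nsmooth m f'
  else True.

Lemma is_derive_derive1 f f' : (forall x, is_derive x (1 : R) f (f' x)) ->
  (derive1 f) = f'.
Proof. by move=> ff'; apply/funext => x; rewrite derive1E derive_val. Qed.

Lemma smooth1P f : smooth1 f <-> forall n, nsmooth n f.
Proof.
split=> [sf n|sf n].
  elim: n f sf => //= n IH f sf; exists (derive1 f); split.
    by move=> x; split; [exact: (sf 0%N)|rewrite derive1E].
  by apply: IH => m x; have := sf m.+1 x; rewrite /derive1n iterSr.
elim: n f sf => [|n IH] f sf x.
  by have [f' [ff' _]] := sf 1%N; have [] := ff' x.
rewrite /derive1n iterSr; apply: IH => m.
by have [f' [/is_derive_derive1 -> ]] := sf m.+1.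
Qed.

Lemma nsmoothW n f : nsmooth n.+1 f -> nsmooth n f.
Proof.
elim: n f => //= n IH f [f' [ff' sf']]; exists f'; split => //.
exact: IH.
Qed.

Lemma nsmooth_cst n (c : R) : nsmooth n (fun=> c).
Proof.
elim: n c => //= n IH c; exists (fun=> 0); split=> // x.
exact: is_derive_cst.
Qed.

Lemma nsmoothD n f g : nsmooth n f -> nsmooth n g ->
  nsmooth n (fun x => f x + g x).
Proof.
elim: n f g => //= n IH f g [f' [ff' sf']] [g' [gg' sg']].
exists (fun x => f' x + g' x); split; last exact: IH.
by move=> x; exact: is_derive_add.
Qed.

Lemma nsmoothM n f g : nsmooth n f -> nsmooth n g ->
  nsmooth n (fun x => f x * g x).
Proof.
elim: n f g => //= n IH f g [f' [ff' sf']] [g' [gg' sg']].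
exists (fun x => f' x * g x + f x * g' x); split.
  by move=> x; apply: is_derive_mul.
by apply: nsmoothD; apply: IH => //; apply: nsmoothW; [exists g'|exists f'].
Qed.

Lemma nsmooth_affine n f (a b : R) : nsmooth n f ->
  nsmooth n (fun x => f (a * x + b)).
Proof.
elim: n f => //= n IH f [f' [ff' sf']].
exists (fun x => a * f' (a * x + b)); split.
  by move=> x; apply: is_derive_compose => //; exact: is_derive_affine.
by apply: nsmoothM; [exact: nsmooth_cst|exact: IH].
Qed.

Lemma smooth1_is_derive f x : smooth1 f -> is_derive x (1 : R) f (derive1 f x).
Proof. by move=> sf; split; [exact: (sf 0%N)|rewrite derive1E]. Qed.

Lemma is_derive_continuous f x (df : R) : is_derive x (1 : R) f df ->
  {for x, continuous f}.
Proof.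
by move=> [fx _]; apply/differentiable_continuous/derivable1_diffP.
Qed.

Lemma smooth1_continuous f : smooth1 f -> continuous f.
Proof.
move=> sf x; exact: is_derive_continuous (smooth1_is_derive x sf).
Qed.

Lemma smooth1_derive f : smooth1 f -> smooth1 (derive1 f).
Proof. by move=> sf n x; have := sf n.+1 x; rewrite /derive1n iterSr. Qed.

Lemma smooth1_cst (c : R) : smooth1 (fun=> c).
Proof. by apply/smooth1P => n; exact: nsmooth_cst. Qed.

Lemma smooth1_primitive f f' : (forall x, is_derive x (1 : R) f (f' x)) ->
  smooth1 f' -> smooth1 f.
Proof.
move=> ff' /smooth1P sf'; apply/smooth1P => -[//|n].
by exists f'; split => //; exact: sf'.
Qed.

Lemma smooth1_id : smooth1 (fun x : R => x).
Proof.
apply: (smooth1_primitive (f' := fun=> 1)); exact: smooth1_cst.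
Qed.

Lemma smooth1D f g : smooth1 f -> smooth1 g -> smooth1 (fun x => f x + g x).
Proof.
by move=> /smooth1P sf /smooth1P sg; apply/smooth1P => n; exact: nsmoothD.
Qed.

Lemma smooth1M f g : smooth1 f -> smooth1 g -> smooth1 (fun x => f x * g x).
Proof.
by move=> /smooth1P sf /smooth1P sg; apply/smooth1P => n; exact: nsmoothM.
Qed.

Lemma smooth1_affine f a b : smooth1 f -> smooth1 (fun x => f (a * x + b)).
Proof. by move=> /smooth1P sf; apply/smooth1P => n; exact: nsmooth_affine. Qed.

End smooth.

(** * Smooth bumps exhausting the indicator of an interval *)

Section bump.
Variable R : realType.

Lemma exprn_le_expR n (t : R) : 0 <= t -> t ^+ n <= n`!%:R * expR t.
Proof.
move=> t0; case: n => [|n].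
  by rewrite expr0 fact0 mul1r -expR0 ler_expR.
rewrite mulrC -ler_pdivrMr ?ltr0n ?fact_gt0//.
by apply: le_trans (expR_ge1Dxn n t0); rewrite lerDr.
Qed.

Lemma poly_le_expR (P : {poly R}) :
  exists2 C : R, 0 <= C & forall t, 0 <= t -> `|P.[t]| <= C * expR t.
Proof.
exists (\sum_(i < size P) `|P`_i| * (i : nat)`!%:R).
  by apply: sumr_ge0 => i _; rewrite mulr_ge0.
move=> t t0; rewrite horner_coef (le_trans (ler_norm_sum _ _ _))//.
rewrite mulr_suml; apply: ler_sum => i _.
rewrite normrM -mulrA ler_wpM2l// ger0_norm ?exprn_ge0//.
exact: exprn_le_expR.
Qed.

(** The functions P(1/x) exp(-1/x), extended by 0, are a class closed under
    derivation that contains the standard flat function exp(-1/x). *)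
Definition flat (P : {poly R}) (x : R) : R :=
  if 0 < x then P.[x^-1] * expR (- x^-1) else 0.

Lemma flat_le0 P x : x <= 0 -> flat P x = 0.
Proof. by rewrite /flat ltNge => ->. Qed.

(** These functions vanish to infinite order at 0, because exp(1/x) dominates
    every polynomial in 1/x. *)
Lemma flat_bound P n : exists2 C : R, 0 <= C &
  forall x, `|flat P x| <= C * `|x| ^+ n.
Proof.
have [C C0 PC] := poly_le_expR (P * 'X^n).
exists C => // x; rewrite /flat; case: ifPn => x0; last first.
  by rewrite normr0 mulr_ge0// exprn_ge0.
have xi0 : 0 <= x^-1 by rewrite invr_ge0 ltW.
have := PC _ xi0; rewrite hornerM hornerXn normrM.
rewrite (ger0_norm (exprn_ge0 _ xi0)) -ler_pdivlMr ?exprn_gt0 ?invr_gt0//.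
rewrite normrM (ger0_norm (expR_ge0 _)) expRN ler_pdivrMr ?expR_gt0//.
by rewrite exprVn invrK mulrAC (gtr0_norm x0).
Qed.

Lemma is_derive_flat P x :
  is_derive x (1 : R) (flat P) (flat ('X^2 * (P - P^`())) x).
Proof.
have [x0|x0|->] := ltgtP x 0.
- rewrite (@flat_le0 ('X^2 * (P - P^`())) x) ?(ltW x0)//.
  apply: (@near_eq_is_derive _ _ _ (cst 0)).
    near=> y; rewrite flat_le0// ltW//; near: y; exact: lt_nbhsl.
- have h : is_derive x (1 : R) (fun y => P.[y^-1] * expR (- y^-1))
      (flat ('X^2 * (P - P^`())) x).
    have hV : is_derive x (1 : R) (fun y : R => y^-1) (- x ^- 2).
      have h := is_deriveV (lt0r_neq0 x0) (is_derive_id x (1 : R)).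
      by apply: is_derive_eq h _; rewrite [_ *: _]mulr1.
    have h1 := is_derive_compose (is_derive_poly P x^-1) hV.
    have h2 := is_derive_compose (g := fun y : R => - y^-1)
      (is_derive_expR (- x^-1)) (is_deriveN hV).
    apply: is_derive_eq (is_derive_mul h1 h2) _.
    rewrite /flat x0 !hornerE/=; field.
    by rewrite gt_eqF.
  apply: near_eq_is_derive h.
  near=> y; rewrite /flat ifT//; near: y; exact: lt_nbhsr.
- rewrite (@flat_le0 _ 0)//.
  have [C C0 HC] := flat_bound P 2.
  have H : h^-1 *: ((flat P \o shift 0) (h *: 1) - flat P 0) @[h --> 0^'] --> (0 : R).
    rewrite [flat P 0]flat_le0//.
    apply/cvgrPdist_lt => e e0.
    near=> h.
    rewrite /= addr0 subr0 sub0r normrN.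
    have h0 : h != 0 by near: h; exact: nbhs_dnbhs_neq.
    rewrite [_ *: 1]mulr1 normrZ normfV mulrC ltr_pdivrMr ?normr_gt0//.
    apply: le_lt_trans (HC h) _.
    rewrite expr2 mulrA ltr_pM2r ?normr_gt0//.
    apply: le_lt_trans (_ : (C + 1) * `|h| < _); first by rewrite ler_wpM2r// lerDl.
    rewrite mulrC -ltr_pdivlMr ?ltr_wpDl//.
    near: h; apply: dnbhs0_lt; rewrite divr_gt0// ltr_wpDl//.
  split; first by apply/cvg_ex; exists 0.
  exact: cvg_lim H.
Unshelve. all: by end_near. Qed.

Lemma smooth1_flat P : smooth1 (flat P).
Proof.
apply/smooth1P => n; elim: n P => //= n IH P.
by exists (flat ('X^2 * (P - P^`()))); split => [x|//]; exact: is_derive_flat.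
Qed.

Lemma flat1_itv x : 0 <= flat 1 x <= 1.
Proof.
rewrite /flat; case: ifPn => x0; last by rewrite lexx ler01.
by rewrite hornerE mul1r expR_ge0 expR_le1 oppr_le0 invr_ge0 ltW.
Qed.

Lemma flat1_cvg (x : R) : 0 < x -> flat 1 (n%:R * x - 1) @[n --> \oo] --> (1 : R).
Proof.
move=> x0; apply/cvgrPdist_le => e e0.
exists (Num.bound ((1 + e^-1) / x)) => // n /= xn.
have n1 : e^-1 <= n%:R * x - 1.
  rewrite lerBrDl -ler_pdivrMr// ltW// (lt_le_trans (archi_boundP _))//.
    by rewrite divr_ge0 ?addr_ge0 ?invr_ge0// ltW.
  by rewrite ler_nat.
have n0 : 0 < n%:R * x - 1 by apply: lt_le_trans n1; rewrite invr_gt0.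
rewrite /flat n0 hornerE mul1r ger0_norm; last first.
  by rewrite subr_ge0 expR_le1 oppr_le0 invr_ge0 ltW.
rewrite lerBlDl -lerBlDr (le_trans _ (expR_ge1Dx _))// lerD2l lerN2.
by rewrite -[leRHS]invrK lef_pV2 ?posrE ?invr_gt0.
Qed.

(** The shifts by 1 put the support in [s + 1/n, t - 1/n], compact in ]s, t[. *)
Definition bump (s t : R) (n : nat) (x : R) : R :=
  flat 1 (n%:R * (x - s) - 1) * flat 1 (n%:R * (t - x) - 1).

Lemma smooth1_bump s t n : smooth1 (bump s t n).
Proof.
apply: smooth1M.
- rewrite (_ : (fun _ => _) = fun x => flat 1 (n%:R * x + (- n%:R * s - 1))).
    exact/smooth1_affine/smooth1_flat.
  by apply/funext => x; congr flat; ring.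
- rewrite (_ : (fun _ => _) = fun x => flat 1 (- n%:R * x + (n%:R * t - 1))).
    exact/smooth1_affine/smooth1_flat.
  by apply/funext => x; congr flat; ring.
Qed.

Lemma bump_itv s t n x : 0 <= bump s t n x <= 1.
Proof.
have /andP[a0 a1] := flat1_itv (n%:R * (x - s) - 1).
have /andP[b0 b1] := flat1_itv (n%:R * (t - x) - 1).
by rewrite mulr_ge0//= mulr_ile1.
Qed.

Lemma bump_eq0 s t n x : ~~ (s + n%:R^-1 <= x <= t - n%:R^-1) ->
  bump s t n x = 0.
Proof.
case: n => [|n].
  by move=> _; rewrite /bump flat_le0 ?mul0r// mul0r sub0r oppr_le0.
rewrite negb_and -!ltNge /bump => /orP[xs|xt].
  rewrite flat_le0 ?mul0r// subr_le0 mulrC -ler_pdivlMr ?ltr0n// mul1r.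
  by rewrite lerBlDl ltW.
rewrite [X in _ * X]flat_le0 ?mulr0// subr_le0 mulrC -ler_pdivlMr ?ltr0n//.
by rewrite mul1r lerBlDl -lerBlDr ltW.
Qed.

Lemma bump_cvg s t x :
  bump s t n x @[n --> \oo] --> (\1_`]s, t[ x : R).
Proof.
rewrite indicE; have [/=|/negP] := boolP (s < x < t).
  move=> /andP[sx xt]; rewrite mem_set ?mulr1/=; last by rewrite in_itv/= sx.
  rewrite -[1%:R]mulr1; apply: cvgM; apply: flat1_cvg; by rewrite subr_gt0.
move=> sxt; rewrite memNset/=; last by rewrite in_itv.
apply: cvg_near_cst; near=> n; apply/eqP.
rewrite bump_eq0//; apply/negP => /andP[sx xt]; apply: sxt.
have n0 : 0 < (n%:R : R)^-1 by rewrite invr_gt0 ltr0n; near: n; exists 1%N.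
by apply/andP; split; [apply: lt_le_trans sx; rewrite ltrDl|
  apply: le_lt_trans xt _; rewrite gtrBl].
Unshelve. all: by end_near. Qed.

Lemma bump_cvgS s t x :
  bump s t n.+1 x @[n --> \oo] --> (\1_`]s, t[ x : R).
Proof. by rewrite (cvg_shiftS (fun n => bump s t n x)); exact: bump_cvg. Qed.

End bump.

(** * Smooth functions on the plane *)

Section plane.
Variable R : realType.
Implicit Types (f g : R -> R) (phi psi : R * R -> R).

Lemma continuous_fst : continuous (fst : R * R -> R).
Proof.
move=> [x y] A xA; exists (A, setT); first by split => //; exact: filterT.
by move=> [u v] [].
Qed.

Lemma continuous_snd : continuous (snd : R * R -> R).
Proof.
move=> [x y] A yA; exists (setT, A); first by split => //; exact: filterT.
by move=> [u v] [].
Qed.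

Definition tensor f g : R * R -> R := fun z => f z.1 * g z.2.

Lemma continuous_tensor f g : continuous f -> continuous g ->
  continuous (tensor f g).
Proof.
move=> cf cg z; apply: cvgM.
  by apply: (@continuous_comp _ _ _ fst f); [exact: continuous_fst|exact: cf].
by apply: (@continuous_comp _ _ _ snd g); [exact: continuous_snd|exact: cg].
Qed.

Lemma smooth2_tensor f g : smooth1 f -> smooth1 g -> smooth2 (tensor f g).
Proof.
move=> + + n; elim: n f g => [|n IH] f g sf sg.
  by split => //; apply: continuous_tensor; exact: smooth1_continuous.
split; first by apply: continuous_tensor; exact: smooth1_continuous.
have dx z : is_derive z.1 (1 : R) (fun s => tensor f g (s, z.2))
    (tensor (derive1 f) g z).
  rewrite /tensor/=.
  apply: is_derive_eq (is_derive_mul (smooth1_is_derive z.1 sf)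
    (is_derive_cst (g z.2) _ _)) _.
  by rewrite mulr0 addr0.
have dy z : is_derive z.2 (1 : R) (fun s => tensor f g (z.1, s))
    (tensor f (derive1 g) z).
  rewrite /tensor/=.
  exact: (is_derive_scale (f z.1) (smooth1_is_derive z.2 sg)).
split.
- by move=> z; have [] := dx z.
- by move=> z; have [] := dy z.
- rewrite (_ : partial_x _ = tensor (derive1 f) g).
    exact: (IH _ _ (smooth1_derive sf) sg).
  by apply/funext => z; rewrite /partial_x derive1E; have [_ ->] := dx z.
- rewrite (_ : partial_y _ = tensor f (derive1 g)).
    exact: (IH _ _ sf (smooth1_derive sg)).
  by apply/funext => z; rewrite /partial_y derive1E; have [_ ->] := dy z.
Qed.

Lemma partial_x_tensor f g : smooth1 f ->
  partial_x (tensor f g) = tensor (derive1 f) g.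
Proof.
move=> sf; apply/funext => z; rewrite /partial_x /tensor/= derive1E.
have := is_derive_mul (smooth1_is_derive z.1 sf) (is_derive_cst (g z.2) _ _).
by move=> [_ ->]; rewrite mulr0 addr0.
Qed.

Lemma smooth2_continuous phi : smooth2 phi -> continuous phi.
Proof. by move=> /(_ 0%N)[]. Qed.

Lemma smooth2_partial_x phi : smooth2 phi -> continuous (partial_x phi).
Proof. by move=> /(_ 1%N)[_ [_ _ []]]. Qed.

Lemma smooth2_partial_y phi : smooth2 phi -> continuous (partial_y phi).
Proof. by move=> /(_ 1%N)[_ [_ _ _ []]]. Qed.

Lemma smooth2_is_derive_x phi (x y : R) : smooth2 phi ->
  is_derive x (1 : R) (fun s => phi (s, y)) (partial_x phi (x, y)).
Proof.
move=> /(_ 1%N)[_ [dx _ _ _]]; split; first exact: (dx (x, y)).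
by rewrite /partial_x derive1E.
Qed.

Lemma smooth2_is_derive_y phi (x y : R) : smooth2 phi ->
  is_derive y (1 : R) (fun s => phi (x, s)) (partial_y phi (x, y)).
Proof.
move=> /(_ 1%N)[_ [_ dy _ _]]; split; first exact: (dy (x, y)).
by rewrite /partial_y derive1E.
Qed.

Lemma smooth2_lincomb phi psi (c : R) : smooth2 phi -> smooth2 psi ->
  smooth2 (fun z => phi z + c * psi z).
Proof.
move=> + + n; elim: n phi psi => [|n IH] phi psi.
  move=> sphi spsi; split => // z.
  by apply: cvgD; [exact: smooth2_continuous|
    apply: cvgMl_tmp; exact: smooth2_continuous].
move=> sphi spsi; split.
  move=> z; apply: cvgD; first exact: smooth2_continuous.
  by apply: cvgMl_tmp; exact: smooth2_continuous.
have dx z : is_derive z.1 (1 : R) (fun s => phi (s, z.2) + c * psi (s, z.2))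
    (partial_x phi z + c * partial_x psi z).
  case: z => x y; apply: is_derive_add; first exact: smooth2_is_derive_x.
  by apply: is_derive_scale; exact: smooth2_is_derive_x.
have dy z : is_derive z.2 (1 : R) (fun s => phi (z.1, s) + c * psi (z.1, s))
    (partial_y phi z + c * partial_y psi z).
  case: z => x y; apply: is_derive_add; first exact: smooth2_is_derive_y.
  by apply: is_derive_scale; exact: smooth2_is_derive_y.
split.
- by move=> z; have [] := dx z.
- by move=> z; have [] := dy z.
- rewrite (_ : partial_x _ = fun z => partial_x phi z + c * partial_x psi z).
    by apply: IH => m; [have [_ []] := sphi m.+1|have [_ []] := spsi m.+1].
  by apply/funext => z; rewrite {1}/partial_x derive1E; have [_ ->] := dx z.
- rewrite (_ : partial_y _ = fun z => partial_y phi z + c * partial_y psi z).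
    by apply: IH => m; [have [_ []] := sphi m.+1|have [_ []] := spsi m.+1].
  by apply/funext => z; rewrite {1}/partial_y derive1E; have [_ ->] := dy z.
Qed.

Lemma partial_x_lincomb phi psi (c : R) : smooth2 phi -> smooth2 psi ->
  partial_x (fun z => phi z + c * psi z) =
  (fun z => partial_x phi z + c * partial_x psi z).
Proof.
move=> sphi spsi; apply/funext => -[x y]; rewrite {1}/partial_x derive1E/=.
have := is_derive_add (smooth2_is_derive_x x y sphi)
  (is_derive_scale c (smooth2_is_derive_x x y spsi)).
by move=> [_ ->].
Qed.

End plane.

(** * The odd solution of v'' = x v' - l v *)

Section entire.
Variable R : realType.
Implicit Types (c : R^nat) (x K : R).

(** Decay faster than every geometric sequence, that is, an infinite radius of
    convergence. *)
Definition entire c := forall K, 0 <= K ->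
  exists A : R, forall k, `|c k| * K ^+ k <= A.

Definition psum c x : R := limn (pseries c x).

Lemma entire_cvg c x : entire c -> cvgn (pseries c x).
Proof.
move=> ec; have [A cA] := ec (2 * `|x|) ltac:(by rewrite mulr_ge0).
apply: normed_cvg; apply: (@series_le_cvg _ _ (geometric A 2^-1)).
- by move=> n; exact: normr_ge0.
- move=> n; rewrite /= mulr_ge0// ?exprn_ge0 ?invr_ge0//.
  by rewrite (le_trans _ (cA 0%N))// mulr_ge0.
- move=> n; rewrite /= normrM normrX exprVn ler_pdivlMr ?exprn_gt0//.
  by rewrite (le_trans _ (cA n))// exprMn -mulrA [_ ^+ n * _]mulrC.
- by apply: is_cvg_geometric_series; rewrite gtr0_norm ?invr_gt0// invf_lt1// ltr1n.
Qed.

Lemma entire_diffs c : entire c -> entire (pseries_diffs c).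
Proof.
move=> ec K K0; have K10 : 0 <= K + 1 by rewrite addr_ge0.
have [A cA] := ec (2 * (K + 1)) ltac:(by rewrite mulr_ge0).
exists A => k; rewrite (le_trans _ (cA k.+1))// /pseries_diffs normrM.
rewrite mulrAC mulrC ler_wpM2l// exprMn ger0_norm// ler_pM ?exprn_ge0//.
  by rewrite -natrX ler_nat ltnW// ltn_expl.
rewrite exprS (le_trans (_ : _ <= (K + 1) ^+ k))//.
  by rewrite lerXn2r ?nnegrE// lerDl.
by rewrite ler_peMl ?exprn_ge0// lerDr.
Qed.

Lemma is_derive_psum c x : entire c ->
  is_derive x (1 : R) (psum c) (psum (pseries_diffs c) x).
Proof.
move=> ec; apply: (@pseries_snd_diffs _ c (`|x| + 1)).
- exact: entire_cvg.
- exact/entire_cvg/entire_diffs.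
- exact/entire_cvg/entire_diffs/entire_diffs.
- by rewrite [ltRHS]ger0_norm ?addr_ge0// ltrDl.
Qed.

Lemma psum0 c : psum c 0 = c 0%N.
Proof.
apply: cvg_lim => //; apply: cvg_near_cst; exists 1%N => // -[//|n] _.
rewrite /pseries/series/= big_nat_recl//= expr0 mulr1 big1 ?addr0// => i _.
by rewrite expr0n mulr0.
Qed.

Lemma entire_cst0 : entire (fun=> 0).
Proof. by move=> K _; exists 0 => k; rewrite normr0 mul0r. Qed.

Lemma psum_cst0 x : psum (fun=> 0) x = 0.
Proof.
apply: cvg_lim => //; apply: cvg_near_cst; apply: nearW => n.
by rewrite /pseries/series/= big1// => i _; rewrite mul0r.
Qed.

Lemma psumN c x : psum c (- x) = psum (fun k => (- 1) ^+ k * c k) x.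
Proof.
congr (limn _); apply/funext => n; apply: eq_bigr => i _ /=.
by rewrite /= (exprNn x) mulrA [c i * _]mulrC.
Qed.

Lemma ler_psum c d x K : entire c -> entire d -> (forall k, `|c k| <= d k) ->
  `|x| <= K -> `|psum c x| <= psum d K.
Proof.
move=> ec ed cd xK; have K0 : 0 <= K := le_trans (normr_ge0 _) xK.
have cv : (fun n => `|pseries c x n|) n @[n --> \oo] --> `|psum c x|.
  by apply: cvg_norm; exact: entire_cvg.
rewrite -(cvg_lim _ cv)//; apply: limr_le; first by apply/cvg_ex; exists (`|psum c x|).
near=> n; rewrite /= /pseries /series/=.
apply: le_trans (_ : pseries d K n <= _).
  apply: le_trans (ler_norm_sum _ _ _) _; apply: ler_sum => i _.
  by rewrite normrM normrX ler_pM ?exprn_ge0// lerXn2r// nnegrE.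
apply: nondecreasing_cvgn_le; last exact: entire_cvg.
apply/nondecreasing_seqP => m; rewrite /pseries/series/= big_nat_recr//= lerDl.
by rewrite mulr_ge0 ?exprn_ge0//; exact: le_trans (normr_ge0 _) (cd m).
Unshelve. all: by end_near. Qed.

Lemma entire_lincomb c d (a : R) : entire c -> entire d ->
  entire (fun k => c k + a * d k).
Proof.
move=> ec ed K K0; have [A cA] := ec K K0; have [B dB] := ed K K0.
exists (A + `|a| * B) => k.
rewrite (le_trans (_ : _ <= (`|c k| + `|a| * `|d k|) * K ^+ k))//.
  by rewrite ler_wpM2r ?exprn_ge0// (le_trans (ler_normD _ _))// normrM.
by rewrite mulrDl lerD// -mulrA ler_wpM2l.
Qed.

Lemma psum_lincomb c d (a : R) x : entire c -> entire d ->
  psum (fun k => c k + a * d k) x = psum c x + a * psum d x.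
Proof.
move=> ec ed; apply: cvg_lim => //.
rewrite (_ : pseries _ x = (fun n => pseries c x n + a * pseries d x n)).
  by apply: cvgD; [|apply: cvgMl_tmp]; exact: entire_cvg.
apply/funext => n; rewrite /pseries /series/= mulr_sumr -big_split/=.
by apply: eq_bigr => i _; rewrite mulrDl mulrA.
Qed.

Lemma entire_euler c : entire c -> entire (fun k => k%:R * c k).
Proof.
move=> ec K K0; have [A cA] := entire_diffs ec K0; exists (K * A) => -[|k].
  by rewrite mul0r normr0 mul0r mulr_ge0// (le_trans _ (cA 0%N))// mulr_ge0.
by rewrite exprS mulrCA ler_wpM2l//; exact: cA.
Qed.

Lemma psum_euler c x : entire c ->
  psum (fun k => k%:R * c k) x = x * psum (pseries_diffs c) x.
Proof.
move=> ec.
have h := pseries_diffs_equiv (@entire_cvg _ x (entire_diffs ec)).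
apply: cvg_lim => //.
rewrite (_ : pseries _ x =
    (fun n => x * series (fun i => i%:R * c i * x ^+ i.-1) n)).
  exact: cvgMl_tmp.
apply/funext => n; rewrite /pseries /series/= mulr_sumr.
apply: eq_bigr => -[|i] _; first by rewrite !mul0r mulr0.
by rewrite exprS/=; ring.
Qed.

End entire.

Section hermite.
Variable R : realType.
Implicit Types (l x : R).

(** The recursion obtained by substituting a power series in v'' = x v' - l v. *)
Fixpoint hcoef l (n : nat) : R :=
  match n with
  | 0 => 0
  | 1 => 1
  | m.+2 => (m%:R - l) / (m.+1%:R * m.+2%:R) * hcoef l m
  end.

(** A series of the type of exp(L x^2 / 2), dominating the coefficients
    [hcoef l] for all l of a bounded interval at once. *)
Fixpoint majorant (L : R) (n : nat) : R :=
  match n with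
  | 0 => 1
  | 1 => 1
  | m.+2 => L / m.+2%:R * majorant L m
  end.

Lemma nat_ind2 (P : nat -> Prop) : P 0%N -> P 1%N ->
  (forall n, P n -> P n.+2) -> forall n, P n.
Proof.
move=> P0 P1 PS n; suff [] : P n /\ P n.+1 by [].
by elim: n => // n [? ?]; split => //; exact: PS.
Qed.

Lemma majorant_ge0 L n : 0 <= L -> 0 <= majorant L n.
Proof.
move=> L0; elim/nat_ind2: n => //= n IH.
by rewrite mulr_ge0// divr_ge0.
Qed.

Lemma entire_majorant L : 0 <= L -> entire (majorant L).
Proof.
move=> L0 K K0; pose a k := majorant L k * K ^+ k.
have a0 k : 0 <= a k by rewrite mulr_ge0 ?majorant_ge0 ?exprn_ge0.
pose N := Num.bound (L * K ^+ 2).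
exists (\sum_(i < N.+2) a i) => k.
rewrite ger0_norm ?majorant_ge0// -/(a k).
elim/ltn_ind: k => k IH.
have [kN|] := ltnP k N.+2.
  by rewrite (bigD1 (Ordinal kN))//= lerDl sumr_ge0.
case: k IH => [//|[//|k]] IH; rewrite !ltnS => Nk.
apply: le_trans (IH k _) => //.
rewrite /a /= (_ : _ * _ = (L * K ^+ 2 / k.+2%:R) * a k); last first.
  by rewrite /a !exprS; ring.
rewrite ler_piMl// ler_pdivrMr ?ltr0n// mul1r ltW//.
rewrite (lt_le_trans (archi_boundP _))//.
  by rewrite mulr_ge0// exprn_ge0.
by rewrite ler_nat (leq_trans Nk)// -addn2 leq_addr.
Qed.

Lemma le_entire (c d : R^nat) : entire d -> (forall k, `|c k| <= d k) -> entire c.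
Proof.
move=> ed cd K K0; have [A dA] := ed K K0; exists A => k.
apply: le_trans (dA k); rewrite ler_wpM2r ?exprn_ge0//.
exact: le_trans (ler_norm _).
Qed.

Lemma hcoef_ratio l M n : 0 <= l <= M ->
  `|(n%:R - l) / (n.+1%:R * n.+2%:R)| <= (1 + M) / n.+2%:R.
Proof.
move=> /andP[l0 lM].
rewrite normrM normfV [X in _ / X]ger0_norm ?mulr_ge0// invfM mulrA.
rewrite ler_pM2r ?invr_gt0 ?ltr0n// ler_pdivrMr ?ltr0n//.
rewrite (le_trans (ler_normB _ _))// !ger0_norm// -natr1.
have n0 : 0 <= n%:R :> R by [].
have : 0 <= M * n%:R by rewrite mulr_ge0// (le_trans l0).
nra.
Qed.

Lemma hcoef_bound l M n : 0 <= l <= M -> `|hcoef l n| <= majorant (2 * (1 + M)) n.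
Proof.
move=> lM; have M0 : 0 <= M by case/andP: lM => *; lra.
have L0 : 0 <= 2 * (1 + M) by lra.
elim/nat_ind2: n => [||n IH] /=; rewrite ?normr0 ?normr1//.
rewrite normrM ler_pM// (le_trans (hcoef_ratio _ lM))//.
by rewrite ler_pM2r ?invr_gt0 ?ltr0n//; lra.
Qed.

Lemma hcoef_lipschitz l l' M n : 0 <= l <= M -> 0 <= l' <= M ->
  `|hcoef l n - hcoef l' n| <= `|l - l'| * majorant (2 * (1 + M)) n.
Proof.
move=> lM lM'; have M0 : 0 <= M by case/andP: lM => *; lra.
have L0 : 0 <= 2 * (1 + M) by lra.
elim/nat_ind2: n => [||n IH] /=; rewrite ?subrr ?normr0 ?mulr_ge0//.
rewrite (_ : _ - _ = (n%:R - l) / (n.+1%:R * n.+2%:R) * (hcoef l n - hcoef l' n)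
  - (l - l') * (hcoef l' n / (n.+1%:R * n.+2%:R))); last by ring.
rewrite (le_trans (ler_normB _ _))//.
rewrite (normrM ((n%:R - l) / _)) (normrM (l - l')).
have h1 : `|(n%:R - l) / (n.+1%:R * n.+2%:R)| * `|hcoef l n - hcoef l' n| <=
    (1 + M) / n.+2%:R * (`|l - l'| * majorant (2 * (1 + M)) n).
  by rewrite ler_pM// hcoef_ratio.
have h2 : `|l - l'| * `|hcoef l' n / (n.+1%:R * n.+2%:R)| <=
    `|l - l'| * ((1 + M) / n.+2%:R * majorant (2 * (1 + M)) n).
  rewrite ler_wpM2l// normrM mulrC ler_pM//; last exact: hcoef_bound.
  rewrite normfV ger0_norm ?mulr_ge0// invfM ler_pM2r ?invr_gt0 ?ltr0n//.
  apply: (@le_trans _ _ 1); last by lra.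
  by rewrite invf_le1 ?ltr0n// ler1n.
apply: le_trans (lerD h1 h2) _.
by rewrite le_eqVlt; apply/orP; left; apply/eqP; ring.
Qed.

Lemma entire_hcoef l : 0 <= l -> entire (hcoef l).
Proof.
move=> l0; apply: (@le_entire _ (majorant (2 * (1 + l)))).
  by apply: entire_majorant; lra.
by move=> k; apply: hcoef_bound; rewrite l0/=.
Qed.

(** The odd Hermite function v and its derivative s = v'. *)
Definition herm l x := psum (hcoef l) x.
Definition herm' l x := psum (pseries_diffs (hcoef l)) x.

Lemma is_derive_herm l x : 0 <= l -> is_derive x (1 : R) (herm l) (herm' l x).
Proof. by move=> l0; apply: is_derive_psum; exact: entire_hcoef. Qed.

Lemma hermE l x : 0 <= l ->
  psum (pseries_diffs (pseries_diffs (hcoef l))) x = x * herm' l x - l * herm l x.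
Proof.
move=> l0; have ec := entire_hcoef l0.
rewrite -psum_euler// -mulNr -psum_lincomb//; last exact: entire_euler.
congr (psum _ x); apply/funext => k; rewrite /pseries_diffs/=.
have k0 : 0 <= k%:R :> R by [].
rewrite -!natr1; field.
by apply/andP; split; apply: lt0r_neq0; lra.
Qed.

Lemma is_derive_herm' l x : 0 <= l ->
  is_derive x (1 : R) (herm' l) (x * herm' l x - l * herm l x).
Proof.
move=> l0; rewrite -hermE//; apply: is_derive_psum.
exact/entire_diffs/entire_hcoef.
Qed.

Lemma herm'0 l : herm' l 0 = 1.
Proof. by rewrite /herm' psum0 /pseries_diffs/= mulr1. Qed.

Lemma hcoef_parity l n : (- 1) ^+ n * hcoef l n = - hcoef l n.
Proof.
elim/nat_ind2: n => [||n IH] /=; rewrite ?mulr0 ?oppr0 ?mulr1//.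
have e : (- 1) ^+ n.+2 = (- 1) ^+ n :> R.
  by rewrite -addn2 exprD sqrrN expr1n mulr1.
by rewrite e mulrCA IH mulrN.
Qed.

Lemma hermN l x : 0 <= l -> herm l (- x) = - herm l x.
Proof.
move=> l0; rewrite /herm psumN -[RHS]mulN1r -[RHS]add0r.
rewrite -(psum_cst0 x) -psum_lincomb; [|exact: entire_cst0|exact: entire_hcoef].
by congr (psum _ x); apply/funext => k; rewrite add0r mulN1r hcoef_parity.
Qed.

Lemma herm'N l x : 0 <= l -> herm' l (- x) = herm' l x.
Proof.
move=> l0; rewrite /herm' psumN; congr (psum _ x); apply/funext => k.
rewrite /pseries_diffs mulrCA; congr (_ * _).
by have := hcoef_parity l k.+1; rewrite exprS mulN1r mulNr => /oppr_inj.
Qed.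

(** The dependence on the spectral parameter l is what allows to move l until
    the first zero of v' reaches a. *)
Lemma herm'_lipschitz l l' M x a : 0 <= l <= M -> 0 <= l' <= M -> `|x| <= a ->
  `|herm' l x - herm' l' x| <=
  `|l - l'| * psum (pseries_diffs (majorant (2 * (1 + M)))) a.
Proof.
move=> lM lM' xa; have l0 : 0 <= l by case/andP: lM.
have l'0 : 0 <= l' by case/andP: lM'.
have M0 : 0 <= M by case/andP: lM => *; lra.
have eM : entire (pseries_diffs (majorant (2 * (1 + M)))).
  by apply/entire_diffs/entire_majorant; lra.
have := @psum_lincomb _ (pseries_diffs (hcoef l)) (pseries_diffs (hcoef l')) (-1) x
  (entire_diffs (entire_hcoef l0)) (entire_diffs (entire_hcoef l'0)).
rewrite mulN1r -/(herm' l x) -/(herm' l' x) => <-.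
have e0 := @entire_cst0 R.
rewrite -[leRHS]add0r -(psum_cst0 a) -psum_lincomb//.
apply: ler_psum => //; try apply: entire_lincomb => //;
  try exact/entire_diffs/entire_hcoef.
move=> k; rewrite /pseries_diffs add0r mulN1r -mulrBr normrM ger0_norm//.
by rewrite mulrCA ler_wpM2l// hcoef_lipschitz.
Qed.

End hermite.

(** * The Gaussian density and the ground state of an interval *)

Section density.
Variable R : realType.

Definition rho (x : R) : R := normal_pdf 0 1 x.

Lemma rhoE x : rho x = normal_peak 1 * expR (- (x ^+ 2) / 2).
Proof.
rewrite /rho /normal_pdf oner_eq0 /normal_fun subr0 expr1n mulNr -mulNr.
by [].
Qed.

Lemma rho_gt0 x : 0 < rho x.
Proof. by rewrite rhoE mulr_gt0 ?expR_gt0// normal_peak_gt0// oner_neq0. Qed.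

Lemma rho_neq0 x : rho x != 0.
Proof. exact: lt0r_neq0 (rho_gt0 x). Qed.

Lemma rhoN x : rho (- x) = rho x.
Proof. by rewrite !rhoE sqrrN. Qed.

Lemma is_derive_rho x : is_derive x (1 : R) rho (- x * rho x).
Proof.
rewrite (_ : rho = fun y => normal_peak 1 * expR (- 2^-1 * (y * y))); last first.
  by apply/funext => y; rewrite rhoE; congr (_ * expR _); field.
have hd := is_derive_mul (is_derive_id x (1 : R)) (is_derive_id x (1 : R)).
have he := is_derive_compose (f := expR) (is_derive_expR _)
  (is_derive_scale (- 2^-1) hd).
apply: is_derive_eq (is_derive_scale (normal_peak 1) he) _.
by rewrite mul1r mulr1; field.
Qed.

Lemma smooth1_rho : smooth1 rho.
Proof.
have /smooth1P sN : smooth1 (fun x : R => -1 * x + 0).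
  exact: (@smooth1_affine R (fun x => x) (-1) 0 (@smooth1_id R)).
apply/smooth1P; elim => //= n IH.
exists (fun x => (-1 * x + 0) * rho x); split; last exact: nsmoothM.
by move=> x; rewrite mulN1r addr0; exact: is_derive_rho.
Qed.

End density.

Section ground_state.
Variable R : realType.

Lemma is_derive_ge0_le (f f' : R -> R) (a b : R) :
  (forall x, is_derive x (1 : R) f (f' x)) -> a <= b ->
  (forall x, a <= x <= b -> 0 <= f' x) -> f a <= f b.
Proof.
move=> ff' ab f'0.
have cf : {within `[a, b], continuous f}.
  by apply: continuous_subspaceT => x; exact: is_derive_continuous (ff' x).
have [c cab fE] := MVT_segment ab (fun x _ => ff' x) cf.
rewrite -subr_ge0 fE mulr_ge0 ?subr_ge0//; apply: f'0.
by move: cab; rewrite in_itv.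
Qed.

Variable a : R.
Hypothesis a0 : 0 < a.

Let positive (l : R) := 0 <= l /\ forall x, 0 <= x <= a -> 0 < herm' l x.

(** For l = 0 the equation for s = v' is s' = x s: s is 1 / rho up to a constant. *)
Let positive0 : positive 0.
Proof.
split=> // x _.
have h y : is_derive y (1 : R) (fun z => herm' 0 z * rho z) 0.
  apply: is_derive_eq (is_derive_mul (is_derive_herm' y (lexx 0)) (is_derive_rho y)) _.
  by ring.
have := is_derive_0_is_cst x 0 h; rewrite herm'0 mul1r => e.
by rewrite -(pmulr_lgt0 _ (rho_gt0 x)) e rho_gt0.
Qed.

(** Sturm comparison of s = v' with g = (a^2 - x^2)^2.  The weighted Wronskian
    W = rho (s' g - s g') vanishes at 0 (by parity) and at a (where g has a double
    zero), but for l > 1 + 9 / a^2 and s > 0 its derivative is negative. *)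
Let positive_bound l : positive l -> l <= 1 + 9 / a ^+ 2.
Proof.
move=> [l0 lpos]; rewrite leNgt; apply/negP => lbig.
pose g x := (a ^+ 2 + - 1 * (x * x)) * (a ^+ 2 + - 1 * (x * x)).
pose g' x := - 4 * x * (a ^+ 2 - x * x).
have dg x : is_derive x (1 : R) g (g' x).
  have hd := is_derive_mul (is_derive_id x (1 : R)) (is_derive_id x (1 : R)).
  have h := is_derive_add (is_derive_cst (a ^+ 2) x (1 : R))
    (is_derive_scale (- 1) hd).
  by apply: is_derive_eq (is_derive_mul h h) _; rewrite /g' /cst/=; ring.
have dg' x : is_derive x (1 : R) g' (- 4 * a ^+ 2 + 12 * (x * x)).
  have hd := is_derive_mul (is_derive_id x (1 : R)) (is_derive_id x (1 : R)).
  have h := is_derive_add (is_derive_cst (a ^+ 2) x (1 : R)) (is_derive_opp hd).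
  have h' := is_derive_scale (- 4) (is_derive_id x (1 : R)).
  by apply: is_derive_eq (is_derive_mul h' h) _; rewrite /cst/=; ring.
pose s := herm' l; pose s' x := x * s x - l * herm l x.
have ds x : is_derive x (1 : R) s (s' x) by exact: is_derive_herm'.
have ds' x : is_derive x (1 : R) s' (x * s' x + (1 - l) * s x).
  have h1 := is_derive_mul (is_derive_id x (1 : R)) (ds x).
  have h2 := is_derive_scale l (is_derive_herm x l0).
  by apply: is_derive_eq (is_derive_add h1 (is_derive_opp h2)) _; rewrite -/(s x); ring.
pose W x := rho x * (s' x * g x - s x * g' x).
have dW x : is_derive x (1 : R) W (rho x * s x *
    ((1 - l) * g x + 4 * a ^+ 2 - 12 * (x * x) + x * g' x)).
  have h1 := is_derive_mul (ds' x) (dg x).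
  have h2 := is_derive_mul (ds x) (dg' x).
  have h := is_derive_mul (is_derive_rho x) (is_derive_add h1 (is_derive_opp h2)).
  by apply: is_derive_eq h _; rewrite /=; ring.
have herm0 : herm l 0 = 0.
  by have := hermN 0 l0; rewrite oppr0; lra.
have W0 : W 0 = 0 by rewrite /W /s' /g' herm0; ring.
have Wa : W a = 0 by rewrite /W /g /g'; ring.
have cW : {within `[0, a], continuous W}.
  by apply: continuous_subspaceT => x; exact: is_derive_continuous (dW x).
have [|c] := Rolle a0 (fun x _ => let: DeriveDef d _ := dW x in d) cW.
  by rewrite W0 Wa.
rewrite in_itv/= => /andP[c0 ca] [_ Wc]; have [_] := dW c.
rewrite {}Wc => /esym/eqP; rewrite !mulf_eq0 (negbTE (rho_neq0 c))/=.
rewrite (gt_eqF (lpos _ _)) ?(ltW c0) ?(ltW ca)//=; apply/negP.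
rewrite lt_eqF// /g /g'.
have la : 9 < (l - 1) * a ^+ 2.
  by rewrite -ltr_pdivrMr ?exprn_gt0// ltrBrDl.
(* t = c^2, and A = a^2 below.  If 3 t <= A then (A - t)^2 is at least 4/9 A^2,
   otherwise 12 t exceeds 4 A; this is where the constant 9 comes from. *)
set t := c * c; have -> : - 1 * t = - t by ring.
have t0 : 0 < t by rewrite mulr_gt0.
have ta : t < a ^+ 2 by rewrite /t expr2; nra.
have -> : (1 - l) * ((a ^+ 2 + - t) * (a ^+ 2 + - t)) + 4 * a ^+ 2 - 12 * t +
    c * (- 4 * c * (a ^+ 2 - t)) = - ((l - 1) * (a ^+ 2 - t) ^+ 2 - 4 * a ^+ 2 +
    12 * t + 4 * t * (a ^+ 2 - t)) by rewrite /t; ring.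
rewrite oppr_lt0; move: (a ^+ 2) la ta => A la ta.
have A0 : 0 < A by lra.
have l1 : 0 < l - 1 by rewrite -(pmulr_lgt0 _ A0); lra.
have [tA|tA] := lerP (3 * t) A.
  have : 4 / 9 * A ^+ 2 <= (A - t) ^+ 2 by rewrite !expr2; nra.
  move=> /(ler_wpM2l (ltW l1)).
  have : 4 * A < (l - 1) * (4 / 9 * A ^+ 2) by rewrite expr2; nra.
  have : 0 < t * (A - t) by rewrite mulr_gt0// subr_gt0.
  by lra.
have : 0 < t * (A - t) by rewrite mulr_gt0// subr_gt0.
have : 0 <= (l - 1) * (A - t) ^+ 2 by rewrite mulr_ge0 ?sqr_ge0// ltW.
by lra.
Qed.

(** Uniqueness for the linear equation of s, in the form of a Gronwall estimate:
    the energy s^2 + s'^2 times exp((2 + l) x) cannot decrease. *)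
Let nondegenerate (l x : R) : 0 <= l -> 0 <= x -> herm' l x = 0 ->
  x * herm' l x - l * herm l x <> 0.
Proof.
move=> l0 x0 sx0 s'x0.
pose s := herm' l; pose s' y := y * s y - l * herm l y.
have ds y : is_derive y (1 : R) s (s' y) by exact: is_derive_herm'.
have ds' y : is_derive y (1 : R) s' (y * s' y + (1 - l) * s y).
  have h1 := is_derive_mul (is_derive_id y (1 : R)) (ds y).
  have h2 := is_derive_scale l (is_derive_herm y l0).
  by apply: is_derive_eq (is_derive_add h1 (is_derive_opp h2)) _; rewrite -/(s y); ring.
pose E y := (s y * s y + s' y * s' y) * expR ((2 + l) * y + 0).
have dE y : is_derive y (1 : R) E ((2 * (y * (s' y) ^+ 2) +
    (2 * (s y + s' y) ^+ 2 + l * (s y - s' y) ^+ 2)) * expR ((2 + l) * y + 0)).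
  have h1 := is_derive_add (is_derive_mul (ds y) (ds y)) (is_derive_mul (ds' y) (ds' y)).
  have h2 := is_derive_compose (f := expR) (is_derive_expR _)
     (is_derive_affine (2 + l) 0 y).
  by apply: is_derive_eq (is_derive_mul h1 h2) _; ring.
have : E 0 <= E x.
  apply: is_derive_ge0_le dE x0 _ => y /andP[y0 _].
  apply: mulr_ge0; last exact: expR_ge0.
  have h1 : 0 <= y * s' y ^+ 2 by rewrite mulr_ge0 ?sqr_ge0.
  have h2 : 0 <= l * (s y - s' y) ^+ 2 by rewrite mulr_ge0 ?sqr_ge0.
  have h3 := sqr_ge0 (s y + s' y).
  by lra.
have -> : E x = 0.
  by rewrite /E (sx0 : s x = 0) (s'x0 : s' x = 0) !mulr0 addr0 mul0r.
have -> : E 0 = 1 + s' 0 ^+ 2.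
  by rewrite /E mulr0 addr0 expR0 mulr1 /s herm'0 mulr1 expr2.
have := sqr_ge0 (s' 0); lra.
Qed.

(** Take the supremum l of the parameters for which s > 0 on [0, a].  In the
    limit s >= 0; an interior zero would be a minimum, hence a double zero; and
    if s(a) > 0 then s > 0 on [0, a], which persists for a slightly larger l. *)
Lemma exists_ground_state : exists l : R, [/\ 0 < l,
  forall x, - a < x < a -> 0 < herm' l x, herm' l a = 0 & herm' l (- a) = 0].
Proof.
pose M := 2 + 9 / a ^+ 2.
have M1 : 0 < 9 / a ^+ 2 by rewrite divr_gt0// exprn_gt0.
pose C := `|psum (pseries_diffs (majorant (2 * (1 + M)))) a| + 1.
have C0 : 0 < C by rewrite ltr_wpDl.
have lip l l' x : 0 <= l <= M -> 0 <= l' <= M -> 0 <= x <= a ->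
    `|herm' l x - herm' l' x| <= `|l - l'| * C.
  move=> lM lM' /andP[x0 xa].
  apply: le_trans (herm'_lipschitz lM lM' (_ : `|x| <= a)) _.
    by rewrite ger0_norm.
  by rewrite ler_wpM2l// (le_trans (ler_norm _))// lerDl.
have hs : has_sup positive.
  split; first by exists 0.
  by exists (1 + 9 / a ^+ 2) => l /positive_bound.
pose l := sup positive.
have lub k : positive k -> k <= l by move=> kp; exact: sup_upper_bound.
have l0 : 0 <= l by exact: lub positive0.
have lb : l <= 1 + 9 / a ^+ 2.
  by apply: ge_sup; [exists 0|move=> k /positive_bound].
have lM : 0 <= l <= M by rewrite l0 /M; lra.
have s0 x : 0 <= x <= a -> 0 <= herm' l x.
  move=> xa; rewrite leNgt; apply/negP => sx.
  have e0 : 0 < - herm' l x / C by rewrite divr_gt0// oppr_gt0.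
  have [k kp klt] := sup_adherent e0 hs.
  have kl := lub _ kp.
  have kM : 0 <= k <= M by rewrite kp.1 (le_trans kl)//; case/andP: lM.
  have := lip _ _ _ kM lM xa; rewrite [`|k - l|]ler0_norm ?subr_le0// opprB.
  have h1 : (l - k) * C < - herm' l x.
    by rewrite -ltr_pdivlMr//; move: klt; rewrite -/l; lra.
  have h2 := ler_norm (herm' k x - herm' l x).
  have h3 := kp.2 _ xa.
  by lra.
have sp x : 0 < x < a -> 0 < herm' l x.
  move=> /andP[x0 xa]; rewrite lt_neqAle eq_sym s0 ?(ltW x0) ?(ltW xa)// andbT.
  apply/eqP => sx.
  apply: (nondegenerate l0 (ltW x0) sx).
  have [_ <-] := is_derive_herm' x l0.
  have := @derive1_at_min _ (herm' l) 0 a x (ltW a0)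
    (fun y _ => let: DeriveDef d _ := is_derive_herm' y l0 in d).
  rewrite in_itv/= x0 xa => /(_ isT) [] // y; rewrite in_itv/= => /andP[y0 ya].
  by rewrite sx s0// (ltW y0) ltW.
have sa : herm' l a = 0.
  apply/eqP; rewrite eq_le s0 ?lexx ?(ltW a0)// andbT leNgt; apply/negP => sa.
  have spos x : 0 <= x <= a -> 0 < herm' l x.
    move=> /andP[]; rewrite !le_eqVlt => /predU1P[<-|x0]; first by rewrite herm'0.
    by move=> /predU1P[->//|xa]; apply: sp; rewrite x0.
  have cs : {within `[0, a], continuous herm' l}.
    apply: continuous_subspaceT => x.
    exact: is_derive_continuous (is_derive_herm' x l0).
  have [c + cmin] := EVT_min (ltW a0) cs; rewrite in_itv/= => cI.
  pose d := Num.min 1 (herm' l c / (2 * C)).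
  have mc := spos _ cI.
  have d0 : 0 < d by rewrite lt_min ltr01/= divr_gt0// mulr_gt0.
  have d1 : d <= 1 by rewrite ge_min lexx.
  have dC : d * C < herm' l c.
    have : d <= herm' l c / (2 * C) by rewrite ge_min lexx orbT.
    rewrite ler_pdivlMr ?mulr_gt0//; nra.
  have ldM : 0 <= l + d <= M by rewrite /M; apply/andP; split; lra.
  suff /lub : positive (l + d) by rewrite gerDl leNgt d0.
  split; first by lra.
  move=> x xa; have := lip _ _ _ lM ldM xa.
  rewrite (_ : l - (l + d) = - d); last by ring.
  rewrite normrN (gtr0_norm d0).
  have : herm' l c <= herm' l x by apply: cmin; rewrite in_itv.
  have := ler_norm (herm' l x - herm' (l + d) x).
  by move: dC; lra.
exists l; split => //.
- rewrite lt_neqAle eq_sym l0 andbT; apply/eqP => l00.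
  by have := positive0.2 a; rewrite lexx (ltW a0) -[X in herm' X]l00 sa ltxx => /(_ isT).
- move=> x /andP[ax xa]; have [x0|x0|->] := ltgtP x 0.
  + by rewrite -herm'N//; apply: sp; rewrite oppr_gt0 x0 ltrNl.
  + by apply: sp; rewrite x0.
  + by rewrite herm'0.
- by rewrite herm'N.
Qed.

End ground_state.

(** * A density criterion in L2 of a finite measure *)

Lemma indic_setU (T : Type) (R : realType) (A B : set T) (z : T) :
  \1_(A `|` B) z = \1_A z + \1_B z - \1_(A `&` B) z :> R.
Proof.
rewrite !indicE in_setI in_setU.
by case: (z \in A); case: (z \in B) => /=; ring.
Qed.

Section L2.
Context d (T : measurableType d) (R : realType).
Variables (m : {measure set T -> \bar R}) (D : set T).
Hypothesis mD : measurable D.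
Implicit Types f g h : T -> R.

Definition L1 f := m.-integrable D (fun z => (f z)%:E).

Lemma L1_le f g : measurable_fun D f -> (forall z, D z -> `|f z| <= g z) ->
  L1 g -> L1 f.
Proof.
move=> mf fg ig; apply: (le_integrable mD _ _ ig).
  exact/measurable_EFinP.
by move=> z Dz; rewrite /= lee_fin (le_trans (fg z Dz))// ler_norm.
Qed.

Lemma L1D f g : L1 f -> L1 g -> L1 (fun z => f z + g z).
Proof. by move=> fi gi; exact: (integrableD mD fi gi). Qed.

Lemma L1Z (c : R) f : L1 f -> L1 (fun z => c * f z).
Proof. by move=> fi; exact: (integrableZl mD c fi). Qed.

Lemma L2_L1M f g : L2_on m D f -> L2_on m D g -> L1 (fun z => f z * g z).
Proof.
move=> [mf f2] [mg g2]; apply: (L1_le _ _ (L1D f2 g2)).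
  exact: measurable_funM.
move=> z _; rewrite normrM -(normr_id (f z)) -(normr_id (g z)).
rewrite -[f z ^+ 2]real_normK ?num_real// -[g z ^+ 2]real_normK ?num_real//.
move: `|f z| `|g z| (normr_ge0 (f z)) (normr_ge0 (g z)) => x y x0 y0.
by rewrite !ger0_norm// !expr2; nra.
Qed.

Lemma L2D f g : L2_on m D f -> L2_on m D g -> L2_on m D (fun z => f z + g z).
Proof.
move=> Lf Lg; have fg := L2_L1M Lf Lg; case: Lf Lg => [mf f2] [mg g2].
split; first exact: measurable_funD.
apply: eq_integrable (L1D (L1D f2 g2) (L1Z 2 fg)) => // z _.
by congr EFin; ring.
Qed.

Lemma L2Z (c : R) f : L2_on m D f -> L2_on m D (fun z => c * f z).
Proof.
move=> [mf f2]; split; first exact: measurable_funM.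
apply: eq_integrable (L1Z (c ^+ 2) f2) => // z _.
by congr EFin; ring.
Qed.

Lemma L2B f g : L2_on m D f -> L2_on m D g -> L2_on m D (fun z => f z - g z).
Proof.
move=> Lf /(L2Z (-1)) /(L2D Lf).
by under eq_fun do rewrite mulN1r.
Qed.

Lemma L2_le f g : measurable_fun D f -> (forall z, D z -> `|f z| <= g z) ->
  L2_on m D g -> L2_on m D f.
Proof.
move=> mf fg [_ g2]; split => //; apply: L1_le g2; first exact: measurable_funX.
move=> z Dz; rewrite normrX lerXn2r ?nnegrE ?fg//.
by rewrite (le_trans _ (fg z Dz)).
Qed.

Lemma L2_norm f : L2_on m D f -> L2_on m D (fun z => `|f z|).
Proof.
move=> [mf f2]; split; first exact: measurableT_comp.
by apply: eq_integrable f2 => // z _; rewrite real_normK ?num_real.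
Qed.

Lemma L2_cst (c : R) : (m D < +oo)%E -> L2_on m D (fun=> c).
Proof.
move=> fD; split; first exact: measurable_cst.
apply: (@measurable_bounded_integrable _ _ _ m (fun=> c ^+ 2)) => //.
by exists `|c ^+ 2|; split; [exact: num_real|move=> x lx z Dz; exact: ltW].
Qed.

Lemma L2_bounded f (M : R) : (m D < +oo)%E -> measurable_fun D f ->
  (forall z, D z -> `|f z| <= M) -> L2_on m D f.
Proof. by move=> fD mf fM; exact: L2_le mf fM (L2_cst M fD). Qed.

Lemma Rintegral_cvg (f_ : nat -> T -> R) f g :
  (forall n, measurable_fun D (f_ n)) -> measurable_fun D f ->
  (forall z, D z -> f_ n z @[n --> \oo] --> f z) ->
  (forall n z, D z -> `|f_ n z| <= g z) -> L1 g ->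
  \int[m]_(z in D) f_ n z @[n --> \oo] --> \int[m]_(z in D) f z.
Proof.
move=> mf_ mf ff fg ig.
have mf_E n : measurable_fun D (fun z => (f_ n z)%:E) by exact/measurable_EFinP.
have mfE : measurable_fun D (fun z => (f z)%:E) by exact/measurable_EFinP.
have ffE : {ae m, forall z, D z -> (f_ n z)%:E @[n --> \oo] --> (f z)%:E}.
  by apply: aeW => z Dz; apply: cvg_EFin; [exact: nearW|exact: ff].
have fgE : {ae m, forall z n, D z -> (`|(f_ n z)%:E| <= (g z)%:E)%E}.
  by apply: aeW => z n Dz; rewrite lee_fin fg.
have [fi _ h] := dominated_convergence mD mf_E mfE ffE ig fgE.
apply: fine_cvg; rewrite fineK//.
exact: integrable_fin_num.
Qed.

Variable V : set (T -> R).

Definition approximable f := L2_on m D f /\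
  forall e : R, 0 < e -> exists2 w, V w & \int[m]_(z in D) (f z - w z) ^+ 2 < e.

Hypothesis VL2 : forall w, V w -> L2_on m D w.
Hypothesis V_lin : forall (c : R) w w', V w -> V w' -> V (fun z => w z + c * w' z).
Hypothesis V0 : V (fun=> 0).

Lemma approximable_limit f : L2_on m D f ->
  (forall e : R, 0 < e -> exists2 g, approximable g &
    \int[m]_(z in D) (f z - g z) ^+ 2 < e) -> approximable f.
Proof.
move=> Lf fV; split => // e e0.
have e4 : 0 < e / 4 by rewrite divr_gt0.
have [g [Lg gV] fg] := fV _ e4; have [w Vw gw] := gV _ e4.
exists w => //; have Lw := VL2 Vw.
have h1 := (L2B Lf Lg).2; have h2 := (L2B Lg Lw).2.
apply: le_lt_trans (_ : 2 * (\int[m]_(z in D) (f z - g z) ^+ 2) +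
    2 * (\int[m]_(z in D) (g z - w z) ^+ 2) < e); last by lra.
rewrite -!RintegralZl// -RintegralD//; try exact: L1Z.
apply: le_Rintegral => //.
- exact: (L2B Lf Lw).2.
- by apply: L1D; exact: L1Z.
- move=> z Dz; have := sqr_ge0 ((f z - g z) - (g z - w z)).
  by rewrite !expr2; lra.
Qed.

Lemma approximable_sub w : V w -> approximable w.
Proof.
move=> Vw; split; first exact: VL2.
move=> e e0; exists w => //; rewrite (@eq_Rintegral _ _ _ m D (fun=> 0)).
  by rewrite Rintegral_cst// mul0r.
by move=> z _; rewrite subrr expr0n.
Qed.

Lemma approximable_eq f g : approximable f -> (forall z, D z -> f z = g z) ->
  approximable g.
Proof.
move=> [[mf f2] fV] fg; split; first split.
- by apply: eq_measurable_fun mf => z; rewrite inE => /fg.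
- by apply: eq_integrable f2 => // z; rewrite inE => /fg ->.
- move=> e /fV[w Vw fw]; exists w => //.
  rewrite (@eq_Rintegral _ _ _ m D (fun z => (f z - w z) ^+ 2))// => z.
  by rewrite inE => /fg ->.
Qed.

Lemma approximable_lin (c : R) f g : approximable f -> approximable g ->
  approximable (fun z => f z + c * g z).
Proof.
move=> [Lf fV] [Lg gV]; split; first by apply: L2D => //; exact: L2Z.
move=> e e0; have e4 : 0 < e / 4 by rewrite divr_gt0.
have c0 : 0 < c ^+ 2 + 1 by rewrite ltr_wpDl ?sqr_ge0.
have e4c : 0 < e / 4 / (c ^+ 2 + 1) by rewrite divr_gt0.
have [w Vw fw] := fV _ e4; have [w' Vw' gw'] := gV _ e4c.
exists (fun z => w z + c * w' z); first exact: V_lin.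
have h1 := (L2B Lf (VL2 Vw)).2; have h2 := (L2B Lg (VL2 Vw')).2.
move: gw'; rewrite ltr_pdivlMr// => gw'.
have i0 : 0 <= \int[m]_(z in D) (g z - w' z) ^+ 2.
  by apply: Rintegral_ge0 => z _; exact: sqr_ge0.
apply: le_lt_trans (_ : 2 * (\int[m]_(z in D) (f z - w z) ^+ 2) +
    (2 * c ^+ 2) * (\int[m]_(z in D) (g z - w' z) ^+ 2) < e); last by lra.
rewrite -!RintegralZl// -RintegralD//; try exact: L1Z.
apply: le_Rintegral => //.
- by apply: (L2B _ (VL2 (V_lin _ Vw Vw'))).2; apply: L2D => //; exact: L2Z.
- by apply: L1D; exact: L1Z.
- move=> z Dz; rewrite (_ : _ - _ = (f z - w z) + c * (g z - w' z)); last by ring.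
  have := sqr_ge0 ((f z - w z) - c * (g z - w' z)).
  by rewrite !expr2; lra.
Qed.

Lemma approximable_cvg (f_ : nat -> T -> R) f h :
  (forall n, approximable (f_ n)) -> measurable_fun D f ->
  (forall z, D z -> f_ n z @[n --> \oo] --> f z) ->
  (forall n z, D z -> `|f_ n z| <= h z) -> L2_on m D h -> approximable f.
Proof.
move=> af_ mf ff fh Lh.
have fh' z : D z -> `|f z| <= h z.
  move=> Dz; have cf : `|f_ n z| @[n --> \oo] --> `|f z|.
    by apply: cvg_norm; exact: ff.
  rewrite -(cvg_lim _ cf)//; apply: limr_le; first exact: cvgP cf.
  by apply: nearW => n; exact: fh.
have Lf : L2_on m D f by exact: L2_le Lh.
apply: approximable_limit => // e e0.
have c0 : \int[m]_(z in D) (f z - f_ n z) ^+ 2 @[n --> \oo] --> (0 : R).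
  rewrite (_ : 0 = \int[m]_(z in D) 0); last by rewrite Rintegral_cst// mul0r.
  have Lf_ n := (af_ n).1.
  apply: (@Rintegral_cvg _ _ (fun z => 4 * h z ^+ 2)).
  - by move=> n; apply: measurable_funX; exact: (L2B Lf (Lf_ n)).1.
  - exact: measurable_cst.
  - move=> z Dz; rewrite (_ : 0 = (f z - f z) * (f z - f z)); last by rewrite subrr mul0r.
    by under eq_fun do rewrite expr2; apply: cvgM; apply: cvgB => //;
      [exact: cvg_cst|exact: ff|exact: cvg_cst|exact: ff].
  - move=> n z Dz; rewrite ger0_norm ?sqr_ge0//.
    have := fh' z Dz; have := fh n z Dz; rewrite !ler_norml !expr2.
    by move=> /andP[? ?] /andP[? ?]; nra.
  - by apply: L1Z; exact: Lh.2.
move/cvgrPdist_lt : c0 => /(_ _ e0)[n _ /(_ n (leqnn n))].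
rewrite sub0r normrN => nf; exists (f_ n); first exact: af_.
by apply: le_lt_trans nf; exact: ler_norm.
Qed.

Lemma approximable_sum n (c : 'I_n -> R) (f_ : 'I_n -> T -> R) :
  (forall i, approximable (f_ i)) ->
  approximable (fun z => \sum_(i < n) c i * f_ i z).
Proof.
elim: n c f_ => [|n IH] c f_ af.
  by under eq_fun do rewrite big_ord0; exact: approximable_sub.
under eq_fun do rewrite big_ord_recr/=.
by apply: approximable_lin => //; exact: IH.
Qed.

(** The family B of sets whose indicators are known to be approximable need not
    generate the sigma-algebra: it is enough that a generating family G traces
    on B, and that D be covered by countably many members of B. *)
Hypothesis mDoo : (m D < +oo)%E.
Variables (B : set (set T)) (G : set (set T)) (Q : nat -> set T).
Hypothesis BI : setI_closed B.
Hypothesis BV : forall A, B A -> approximable \1_A.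
Hypothesis QB : forall i, B (Q i).
Hypothesis DQ : D = \bigcup_i Q i.
Hypothesis GI : setI_closed G.
Hypothesis Gm : @measurable _ T = <<s G >>.
Hypothesis GB : forall A C, G A -> B C -> B (A `&` C).

Lemma indicator_approximable A : measurable A -> approximable \1_A.
Proof.
have bdd A' z : `|\1_A' z : R| <= 1 by rewrite indicE ger0_norm// lern1; case: (_ \in _).
have dom : L2_on m D (fun=> 1) by exact: L2_cst.
have Bm C : B C -> measurable_fun D (\1_C : T -> R) by move=> /BV[[]].
(* Indicators of unions of B: inclusion-exclusion for the finite ones, then
   dominated convergence. *)
have fin (F : nat -> set T) : (forall i, B (F i)) ->
    forall n, forall C, B C -> approximable \1_((\big[setU/set0]_(i < n) F i) `&` C).
  move=> FB; elim => [|n IH] C BC.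
    by rewrite big_ord0 set0I indic0; exact: approximable_sub.
  rewrite big_ord_recr/= setIUl.
  have e : \1_(\big[setU/set0]_(i < n) F i `&` C `|` F n `&` C) =
      (fun z => (\1_(\big[setU/set0]_(i < n) F i `&` C) z + 1 * \1_(F n `&` C) z)
       + - 1 * \1_(\big[setU/set0]_(i < n) F i `&` (F n `&` C)) z) :> (T -> R).
    apply/funext => z; rewrite indic_setU setIACA setIid setIA.
    by rewrite mul1r mulN1r.
  rewrite e; apply: approximable_lin; last exact/IH/BI.
  by apply: approximable_lin; [exact: IH|exact/BV/BI].
have cnt (F : nat -> set T) : (forall i, B (F i)) ->
    (forall i, F i `<=` D) -> measurable_fun D (\1_(\bigcup_i F i) : T -> R) ->
    approximable \1_(\bigcup_i F i).
  move=> FB FD mF.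
  apply: (@approximable_cvg (fun n => \1_(\big[setU/set0]_(i < n) F i)) _ (fun=> 1)) => //.
  - move=> n.
    elim: n => [|n IH]; first by rewrite big_ord0 indic0; exact: approximable_sub.
    rewrite big_ord_recr/=.
    have e : \1_(\big[setU/set0]_(i < n) F i `|` F n) =
      (fun z => (\1_(\big[setU/set0]_(i < n) F i) z + 1 * \1_(F n) z)
       + - 1 * \1_(\big[setU/set0]_(i < n) F i `&` F n) z) :> (T -> R).
      by apply/funext => z; rewrite indic_setU mul1r mulN1r.
    rewrite e; apply: approximable_lin; last exact: fin.
    by apply: approximable_lin => //; exact: BV.
  - move=> z Dz; apply: cvg_near_cst.
    have [[i _ Fiz]|nF] := pselect ((\bigcup_i F i) z).
      exists i.+1 => // n /= ni; rewrite !indicE [in LHS]mem_set; last first.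
        by rewrite -bigcup_mkord; exists i.
      by rewrite mem_set//; exists i.
    apply: nearW => n; rewrite !indicE [in RHS]memNset//.
    rewrite memNset//; move=> Fz; apply: nF; move: Fz.
    by rewrite -bigcup_mkord => -[i _ Fiz]; exists i.
move=> mA.
have mI A' : measurable A' -> measurable_fun D (\1_A' : T -> R).
  by move=> ?; exact/measurable_funTS/measurable_indic.
have aT : approximable \1_setT.
  apply: (@approximable_eq \1_(\bigcup_i Q i)).
    apply: cnt => //; last by rewrite -DQ; exact: mI.
    by move=> i; rewrite DQ; exact: bigcup_sup.
  by move=> z; rewrite -DQ => Dz; rewrite !indicE !mem_set.
move: A mA; rewrite Gm; apply: (@dynkin_induction _ _ G (fun S => approximable \1_S)) => //.
- move=> A GA; apply: (@approximable_eq \1_(\bigcup_i (A `&` Q i))).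
    apply: cnt => //; first by move=> i; exact: GB.
      by move=> i; rewrite DQ => z [_ Qz]; exists i.
    rewrite -setI_bigcupr -DQ; apply: mI; apply: measurableI => //.
    by rewrite Gm; exact: sub_gen_smallest.
  move=> z Dz; rewrite -setI_bigcupr -DQ !indicE in_setI.
  by rewrite [z \in D]mem_set// andbT.
- move=> S mS aS.
  rewrite (_ : \1_(~` S) = (fun z => \1_setT z + -1 * \1_S z)).
    exact: approximable_lin.
  apply/funext => z; rewrite !indicE in_setC [z \in setT]mem_set//.
  by case: (z \in S) => /=; ring.
- move=> F mF tF aF.
  apply: (@approximable_cvg (fun n => \1_(\big[setU/set0]_(i < n) F i)) _ (fun=> 1)) => //.
  + elim => [|n IH]; first by rewrite big_ord0 indic0; exact: approximable_sub.
    rewrite big_ord_recr/=.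
    rewrite (_ : \1__ = (fun z => \1_(\big[setU/set0]_(i < n) F i) z + 1 * \1_(F n) z)).
      exact: approximable_lin.
    apply/funext => z; rewrite indic_setU mul1r.
    have tF' : trivIset (fun i : nat => xpredT i) F.
      by rewrite [X in trivIset X F](_ : _ = [set: nat])//; exact/seteqP.
    rewrite (trivIset_bigsetUI tF')//.
    by rewrite indic0 subr0.
  + by apply: mI; apply: bigcup_measurable.
  + move=> z Dz; apply: cvg_near_cst.
    have [[i _ Fiz]|nF] := pselect ((\bigcup_i F i) z).
      exists i.+1 => // n /= ni; rewrite !indicE [in LHS]mem_set; last first.
        by rewrite -bigcup_mkord; exists i.
      by rewrite mem_set//; exists i.
    apply: nearW => n; rewrite !indicE [in RHS]memNset//.
    rewrite memNset//; move=> Fz; apply: nF; move: Fz.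
    by rewrite -bigcup_mkord => -[i _ Fiz]; exists i.
Qed.

Import HBNNSimple.

(** A nonnegative f in L2 is the limit of simple functions dominated by f, which
    are combinations of indicators. *)
Lemma L2_approximable f : L2_on m D f -> approximable f.
Proof.
have nneg g : L2_on m D g -> (forall z, 0 <= g z) -> approximable g.
  move=> Lg g0.
  have mg : measurable_fun D (EFin \o g) by apply/measurable_EFinP; exact: Lg.1.
  have g0E z : D z -> (0 <= (EFin \o g) z)%E by rewrite lee_fin.
  pose s_ (n : nat) : T -> R := nnsfun_approx mD mg n.
  apply: (@approximable_cvg s_ g g) => //; rewrite /s_.
  - move=> n; set s := nnsfun_approx mD mg n.
    have -> : (s : T -> R) = _ := funext (fimfunEord s).
    apply: approximable_sum => i; apply: indicator_approximable.
    rewrite -[X in _ X](setTI); exact: measurable_funPT.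
  - exact: Lg.1.
  - move=> z Dz; have := cvg_nnsfun_approx mD mg g0E Dz.
    by move=> /fine_cvgP[].
  - move=> n z Dz; rewrite ger0_norm// nnsfun_approxE -lee_fin.
    exact: le_approx.
move=> Lf; have Lnf := L2_norm Lf.
have -> : f = (fun z => 2^-1 * (`|f z| + f z) + - 1 * (2^-1 * (`|f z| - f z))).
  by apply/funext => z; field.
apply: approximable_lin; apply: nneg.
- by apply: L2Z; exact: L2D.
- by move=> z; rewrite mulr_ge0// -lerBlDr sub0r -normrN ler_norm.
- by apply: L2Z; exact: L2B.
- by move=> z; rewrite mulr_ge0// subr_ge0 ler_norm.
Qed.

End L2.

(** * Gaussian measures through their Lebesgue densities *)

Section density_change.
Context d (T : measurableType d) (R : realType).
Variables (nu mu : {measure set T -> \bar R}) (g : T -> R).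
Hypothesis g_gt0 : forall x, 0 < g x.
Hypothesis mg : measurable_fun setT g.

(** For nonnegative integrands no integrability is at stake; real-valued ones
    follow by decomposition in positive and negative parts. *)
Definition has_density := forall E (f : T -> \bar R), measurable E ->
  measurable_fun E f -> (forall x, 0 <= f x)%E ->
  (\int[nu]_(x in E) f x = \int[mu]_(x in E) (f x * (g x)%:E))%E.

Hypothesis nug : has_density.

Let maxM (x : T) (y : R) :
  (maxe y%:E 0 * (g x)%:E = maxe (y * g x)%:E 0)%E.
Proof.
have [y0|y0] := leP 0 y.
  by rewrite !max_l ?lee_fin ?mulr_ge0// ltW.
by rewrite !max_r ?lee_fin ?mul0e ?(ltW y0)// pmulr_lle0// ltW.
Qed.

Lemma Rintegral_density E (f : T -> R) : measurable E -> measurable_fun E f ->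
  \int[nu]_(x in E) f x = \int[mu]_(x in E) (f x * g x).
Proof.
move=> mE mf; congr fine; have mfE : measurable_fun E (EFin \o f).
  exact/measurable_EFinP.
rewrite integralE [RHS]integralE; congr (_ - _)%E.
- rewrite nug//; last exact: measurable_funepos.
  by apply: eq_integral => x _; rewrite !funeposE /= maxM.
- rewrite nug//; last exact: measurable_funeneg.
  by apply: eq_integral => x _; rewrite !funenegE /= maxM mulNr.
Qed.

Lemma integrable_density E (f : T -> R) : measurable E -> measurable_fun E f ->
  nu.-integrable E (fun x => (f x)%:E) <->
  mu.-integrable E (fun x => (f x * g x)%:E).
Proof.
move=> mE mf; have mfE : measurable_fun E (EFin \o f) by exact/measurable_EFinP.
have mfg : measurable_fun E (fun x => (f x * g x)%:E).
  by apply/measurable_EFinP; apply: measurable_funM => //; exact: measurable_funTS.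
have e : (\int[nu]_(x in E) `|(f x)%:E| = \int[mu]_(x in E) `|(f x * g x)%:E|)%E.
  rewrite nug//; last exact: measurableT_comp.
  by apply: eq_integral => x _; rewrite /= -EFinM normrM (gtr0_norm (g_gt0 x)).
by split=> /integrableP[_ h]; apply/integrableP; split => //; move: h; rewrite e.
Qed.

End density_change.

Section gauss1.
Variable R : realType.
Local Open Scope ereal_scope.

Lemma measurable_rho : measurable_fun setT (@rho R).
Proof. exact: measurable_normal_pdf. Qed.

Lemma gauss1_RN : ae_eq (leb1 R) setT
  (Radon_Nikodym_SigmaFinite.f (normal_prob (0:R) 1) (@lebesgue_measure R)) (EFin \o @rho R).
Proof.
apply: integral_ae_eq => //.
- apply: Radon_Nikodym_SigmaFinite.f_integrable; exact: normal_prob_dominates.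
- apply/measurable_EFinP; exact: measurable_rho.
- move=> E _ mE; rewrite -Radon_Nikodym_SigmaFinite.f_integral//.
  exact: normal_prob_dominates.
Qed.

Lemma gauss1_density : has_density (gauss1 R) (leb1 R) (@rho R).
Proof.
move=> E f mE mf f0; rewrite /gauss1 /leb1.
rewrite -(Radon_Nikodym_SigmaFinite.change_of_variables (mu := @lebesgue_measure R))//;
  last exact: normal_prob_dominates.
apply: ae_eq_integral => //.
- apply: emeasurable_funM => //; apply: measurable_funTS.
  apply: (measurable_int (@lebesgue_measure R)).
  apply: Radon_Nikodym_SigmaFinite.f_integrable; exact: normal_prob_dominates.
- apply: emeasurable_funM => //; apply/measurable_EFinP/measurable_funTS.
  exact: measurable_rho.
- by apply: ae_eqe_mul2l; apply: ae_eq_subset gauss1_RN.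
Qed.

Lemma gauss2_ge0_integralT (f : R * R -> \bar R) : measurable_fun setT f ->
  (forall x, 0 <= f x) ->
  \int[gauss2 R]_z f z = \int[gauss1 R]_y \int[gauss1 R]_x f (x, y).
Proof.
move=> mf f0.
exact: (@fubini_tonelli2 _ _ _ _ R (normal_prob 0 1) (normal_prob 0 1) f mf f0).
Qed.

Lemma leb2_ge0_integralT (f : R * R -> \bar R) : measurable_fun setT f ->
  (forall x, 0 <= f x) ->
  \int[leb2 R]_z f z = \int[leb1 R]_y \int[leb1 R]_x f (x, y).
Proof.
move=> mf f0.
exact: (@fubini_tonelli2 _ _ _ _ R (@lebesgue_measure R) (@lebesgue_measure R) f mf f0).
Qed.

Definition rho2 (z : R * R) : R := (rho z.1 * rho z.2)%R.

Lemma measurable_rho2 : measurable_fun setT rho2.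
Proof.
by apply: measurable_funM; apply: measurableT_comp => //; exact: measurable_rho.
Qed.

Lemma gauss2_density : has_density (gauss2 R) (leb2 R) rho2.
Proof.
move=> E f mE mf f0.
rewrite integral_mkcond [RHS]integral_mkcond.
set h := f \_ E.
have mh : measurable_fun setT h by apply/(measurable_restrictT _ _).1.
have h0 z : 0 <= h z by exact: erestrict_ge0.
rewrite (_ : (fun z => _) \_ E = fun z => h z * (rho2 z)%:E); last first.
  by apply/funext => z; rewrite /h /patch; case: ifP => // _; rewrite mul0e.
rewrite gauss2_ge0_integralT// leb2_ge0_integralT//; last 2 first.
- by apply: emeasurable_funM => //; apply/measurable_EFinP; exact: measurable_rho2.
- by move=> z; rewrite mule_ge0// lee_fin mulr_ge0// ltW// rho_gt0.
have mhy y : measurable_fun setT (fun x => h (x, y)).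
  by apply: measurableT_comp => //; exact: measurable_pair2.
rewrite gauss1_density//; last 2 first.
- exact: (@measurable_fun_fubini_tonelli_G _ _ _ _ R (normal_prob 0 1)).
- by move=> y; exact: integral_ge0.
apply: eq_integral => y _.
rewrite gauss1_density// -ge0_integralZr//.
- by apply: eq_integral => x _; rewrite /rho2/= EFinM muleA.
- apply: emeasurable_funM => //; apply/measurable_EFinP; exact: measurable_rho.
- by move=> x _; rewrite mule_ge0// lee_fin ltW// rho_gt0.
- by rewrite lee_fin ltW// rho_gt0.
Qed.

Lemma gauss1_setT : gauss1 R setT = 1.
Proof. exact: (@probability_setT _ _ R (normal_prob 0 1)). Qed.

Lemma gauss1_lty D : measurable D -> gauss1 R D < +oo.
Proof.
move=> mD; apply: (@le_lt_trans _ _ (gauss1 R setT)).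
  by rewrite le_measure ?inE.
by rewrite gauss1_setT ltry.
Qed.

Lemma gauss2_lty D : measurable D -> gauss2 R D < +oo.
Proof.
move=> mD; apply: (@le_lt_trans _ _ (gauss2 R setT)).
  by rewrite le_measure ?inE.
rewrite -[X in X < _]mul1e -integral_cst// gauss2_ge0_integralT//.
under eq_integral do rewrite integral_cst//= mul1e.
rewrite gauss1_setT integral_cst// [X in _ * X]gauss1_setT mule1.
exact: ltry.
Qed.

Lemma gauss1_oppr (f : R -> \bar R) : measurable_fun setT f ->
  (forall x, 0 <= f x) ->
  \int[gauss1 R]_x f (- x)%R = \int[gauss1 R]_x f x.
Proof.
move=> mf f0.
have mo : measurable_fun setT (-%R : R -> measurableTypeR R) by [].
rewrite !gauss1_density//; last exact: measurableT_comp.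
pose F x := f x * (rho x)%:E.
have mF : measurable_fun setT F.
  apply: emeasurable_funM => //; apply/measurable_EFinP; exact: measurable_rho.
have F0 x : 0 <= F x by rewrite mule_ge0// lee_fin ltW// rho_gt0.
have h := @ge0_integral_pushforward _ _ (measurableTypeR R) (measurableTypeR R) R
  (-%R : R -> measurableTypeR R) mo (leb1 R) setT F measurableT mF (fun y _ => F0 y).
rewrite -[RHS]/(\int[leb1 R]_x F x).
transitivity (\int[leb1 R]_(x in setT) (F \o -%R) x).
  by apply: eq_integral => x _; rewrite /F /= rhoN.
rewrite -[LHS]h.
by apply: eq_measure_integral => A mA _; exact: lebesgue_measureN.
Qed.

Definition flip (z : R * R) : R * R := (- z.1, z.2)%R.

Lemma measurable_flip : measurable_fun setT flip.
Proof.
apply: measurable_fun_pair; last exact: measurable_snd.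
by apply: measurableT_comp => //; exact: measurable_fst.
Qed.

(** Used to bound the distance to the odd part of a function. *)
Lemma gauss2_flip (f : R * R -> \bar R) : measurable_fun setT f ->
  (forall x, 0 <= f x) ->
  \int[gauss2 R]_z f (flip z) = \int[gauss2 R]_z f z.
Proof.
move=> mf f0.
have mff : measurable_fun setT (f \o flip).
  by apply: measurableT_comp => //; exact: measurable_flip.
rewrite (gauss2_ge0_integralT mf f0).
rewrite -[LHS]/(\int[gauss2 R]_z (f \o flip) z).
rewrite (gauss2_ge0_integralT mff (fun z => f0 (flip z))).
apply: eq_integral => y _; rewrite -[RHS]gauss1_oppr//.
by apply: measurableT_comp => //; exact: measurable_pair2.
Qed.

End gauss1.

(** * Open rectangles and the Borel structure of the plane *)

Section plane_measurable.
Variable R : realType.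
Notation plane := (measurableTypeR R * measurableTypeR R)%type.

Definition rect (s t s' t' : R) : set (R * R) := `]s, t[ `*` `]s', t'[.

Lemma itvoo_setI (s t u v : R) : `]s, t[%classic `&` `]u, v[%classic =
  `]Num.max s u, Num.min t v[%classic.
Proof.
apply/seteqP; split => x /=; rewrite !in_itv/= gt_max lt_min.
  by move=> [/andP[-> ->] /andP[-> ->]].
by move=> /andP[/andP[-> ->] /andP[-> ->]].
Qed.

Lemma rect_setI s t s' t' u v u' v' :
  rect s t s' t' `&` rect u v u' v' =
  rect (Num.max s u) (Num.min t v) (Num.max s' u') (Num.min t' v').
Proof. by rewrite /rect -setXI !itvoo_setI. Qed.

Lemma measurable_rect s t s' t' : measurable (rect s t s' t' : set plane).
Proof. by apply: measurableX; exact: measurable_itv. Qed.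

Definition rects : set (set (R * R)) :=
  [set A | exists s t s' t', A = rect s t s' t'].

Lemma rects_setI : setI_closed rects.
Proof.
by move=> _ _ [s [t [s' [t' ->]]]] [u [v [u' [v' ->]]]]; rewrite rect_setI;
  do 4 eexists.
Qed.

Lemma measurable_plane_rects :
  @measurable _ plane = <<s (rects : set (set plane)) >>.
Proof.
apply/seteqP; split; last first.
  apply: smallest_sub; first exact: sigma_algebra_measurable.
  by move=> _ [s [t [s' [t' ->]]]]; exact: measurable_rect.
pose T' := g_sigma_algebraType (rects : set (set plane)).
have nbound (x : R) : exists n : nat, - n%:R < x < n%:R.
  exists (Num.bound `|x|); rewrite -ltr_norml.
  exact: archi_boundP (normr_ge0 x).
have mfst : measurable_fun setT (fst : T' -> measurableTypeR R).
  apply: (measurability _ (RGenOpens.measurableE R)).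
  move=> _ [_ [s [t ->]] <-]; rewrite setTI.
  rewrite (_ : _ @^-1` _ = \bigcup_n rect s t (- n%:R) n%:R).
    apply: bigcupT_measurable => n; apply: sub_sigma_algebra.
    by do 4 eexists.
  apply/seteqP; split => [[x y] /= xst|[x y] [n _ [] //]].
  by have [n yn] := nbound y; exists n => //; split => //=; rewrite in_itv.
have msnd : measurable_fun setT (snd : T' -> measurableTypeR R).
  apply: (measurability _ (RGenOpens.measurableE R)).
  move=> _ [_ [s [t ->]] <-]; rewrite setTI.
  rewrite (_ : _ @^-1` _ = \bigcup_n rect (- n%:R) n%:R s t).
    apply: bigcupT_measurable => n; apply: sub_sigma_algebra.
    by do 4 eexists.
  apply/seteqP; split => [[x y] /= xst|[x y] [n _ [] //]].
  by have [n yn] := nbound x; exists n => //; split => //=; rewrite in_itv.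
rewrite measurable_prod_measurableType.
apply: smallest_sub; first exact: smallest_sigma_algebra.
move=> _ [A mA [B mB <-]].
rewrite (_ : A `*` B = (fst @^-1` A) `&` (snd @^-1` B))//.
have h1 : @measurable _ T' (fst @^-1` A) by rewrite -[X in measurable X]setTI; exact: mfst.
have h2 : @measurable _ T' (snd @^-1` B) by rewrite -[X in measurable X]setTI; exact: msnd.
exact: (measurableI _ _ h1 h2).
Qed.

(** The rational rectangles inside U, enumerated by [pickle]; the codes that are
    not of this form give the empty set. *)
Definition rat_rect (U : set (R * R)) (n : nat) : set (R * R) :=
  if unpickle n is Some (s, t, s', t') then
    let A := rect (ratr (s : rat)) (ratr (t : rat)) (ratr (s' : rat)) (ratr (t' : rat)) in
    if `[< A `<=` U >] then A else set0
  else set0.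

Lemma rect_set0 : rect 0 0 0 0 = set0.
Proof. by apply/seteqP; split => // -[x y] []/=; rewrite in_itv/= => /andP[]; lra. Qed.

Lemma rat_rect_rects U n : rects (rat_rect U n) /\ rat_rect U n `<=` U.
Proof.
rewrite /rat_rect; case: unpickle => [[[[s t] s'] t']|] /=.
  case: asboolP => h; split => //; first by do 4 eexists.
  by exists 0, 0, 0, 0; rewrite rect_set0.
by split => //; exists 0, 0, 0, 0; rewrite rect_set0.
Qed.

Lemma open_rat_rect U : open U -> U = \bigcup_n rat_rect U n.
Proof.
move=> oU; apply/seteqP; split; last first.
  by move=> z [n _]; apply: (rat_rect_rects U n).2.
move=> [x y] Uxy.
have /nbhs_ballP[e /= e0 eU] : nbhs (x, y) U by exact: open_nbhs_nbhs.
have [s] : exists q : rat, ratr q \in `](x - e), x[ by apply: rat_in_itvoo; lra.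
have [t] : exists q : rat, ratr q \in `]x, (x + e)[ by apply: rat_in_itvoo; lra.
have [s'] : exists q : rat, ratr q \in `](y - e), y[ by apply: rat_in_itvoo; lra.
have [t'] : exists q : rat, ratr q \in `]y, (y + e)[ by apply: rat_in_itvoo; lra.
rewrite !in_itv/= => /andP[t'1 t'2] /andP[s'1 s'2] /andP[t1 t2] /andP[s1 s2].
exists (pickle (s, t, s', t')); first exact: I.
rewrite /rat_rect pickleK.
case: asboolP => [_|]; first by split; rewrite /= in_itv/= ?s2 ?s'2.
case; move=> [u v] [/=]; rewrite !in_itv/= => /andP[u1 u2] /andP[v1 v2].
apply: eU; split; rewrite /ball/= ltr_norml; apply/andP; split; lra.
Qed.

Lemma open_plane_measurable (U : set (R * R)) : open U ->
  measurable (U : set plane).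
Proof.
move=> /open_rat_rect ->; apply: bigcupT_measurable => n.
by have [[s [t [s' [t' ->]]]] _] := rat_rect_rects U n; exact: measurable_rect.
Qed.

Lemma continuous_plane_measurable (f : R * R -> R) : continuous f ->
  measurable_fun setT (f : plane -> measurableTypeR R).
Proof.
move=> /continuousP cf; apply: (measurability _ (RGenOpens.measurableE R)).
move=> _ [_ [s [t ->]] <-]; rewrite setTI; apply: open_plane_measurable.
exact/cf/interval_open.
Qed.

End plane_measurable.

(** * A Hardy inequality from the ground state *)

Section hardy.
Variable R : realType.
Variables (a l : R).
Hypothesis l0 : 0 < l.
Hypothesis s_gt0 : forall x, - a < x < a -> 0 < herm' l x.

Lemma is_derive_inv (f : R -> R) x df : f x != 0 -> is_derive x (1 : R) f df ->
  is_derive x (1 : R) (fun y => (f y)^-1) (- (f x) ^- 2 * df).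
Proof. exact: is_deriveV. Qed.

Lemma continuous_sqr (f : R -> R) (x : R) : {for x, continuous f} ->
  {for x, continuous (fun y => f y ^+ 2)}.
Proof.
move=> cf; rewrite (_ : (fun y => _) = (fun y => f y * f y)).
  exact: continuousM.
by apply/funext => y; rewrite expr2.
Qed.

(** Picone's identity: k = - l v / s solves k' = - x k - k^2 - l, whence
      (k phi^2 / rho)' = (phi'^2 - l phi^2 - (phi' - k phi)^2) / rho,
    and the left-hand side integrates to 0. *)
Lemma hardy (phi phi' : R -> R) (c : R) : c < a ->
  (forall x, is_derive x (1 : R) phi (phi' x)) -> continuous phi' ->
  (forall x, ~~ (- c <= x <= c) -> phi x = 0) ->
  (\int[leb1 R]_x (l * (phi x ^+ 2 / rho x))%:E <=
   \int[leb1 R]_x (phi' x ^+ 2 / rho x)%:E)%E.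
Proof.
move=> ca dphi cphi' phi0.
have [c0|c0] := ltP c 0.
  rewrite [leLHS](eq_integral (cst 0%E)); last first.
    move=> x _; rewrite phi0 ?expr0n/= ?mul0r ?mulr0//.
    by apply/negP => /andP[]; lra.
  rewrite integral_cst//= mul0e; apply: integral_ge0 => x _.
  by rewrite lee_fin divr_ge0 ?sqr_ge0// ltW// rho_gt0.
(* a point strictly between the support and the ends, where k is still smooth *)
pose c' := (c + a) / 2.
have cc' : c < c' by rewrite /c'; lra.
have c'a : c' < a by rewrite /c'; lra.
have l0' := ltW l0.
pose k (x : R) : R := - l * herm l x / herm' l x.
have dk x : - a < x < a -> is_derive x (1 : R) k (- x * k x - k x ^+ 2 - l).
  move=> xa; have s0 := lt0r_neq0 (s_gt0 xa).
  have h := is_derive_mul (is_derive_scale (- l) (is_derive_herm x l0'))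
    (is_derive_inv s0 (is_derive_herm' x l0')).
  by apply: is_derive_eq h _; rewrite /k; field.
pose P (x : R) : R := k x * (phi x * phi x) * (rho x)^-1.
pose D (x : R) : R := (phi' x ^+ 2 - l * phi x ^+ 2 - (phi' x - k x * phi x) ^+ 2) / rho x.
have dP x : - a < x < a -> is_derive x (1 : R) P (D x).
  move=> xa.
  have h := is_derive_mul (is_derive_mul (dk x xa) (is_derive_mul (dphi x) (dphi x)))
    (is_derive_inv (f := @rho R) (rho_neq0 x) (is_derive_rho x)).
  by apply: is_derive_eq h _; rewrite /D; field; rewrite rho_neq0.
have sub x : - c' <= x <= c' -> - a < x < a by move=> /andP[? ?]; apply/andP; split; lra.
have c'0 : - c' < c' by lra.
have cphi : continuous phi by move=> x; exact: (is_derive_continuous (dphi x)).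
have crho (x : R) : {for x, continuous (fun y : R => (rho y)^-1)}.
  have h := is_derive_inv (f := @rho R) (rho_neq0 x) (is_derive_rho x).
  exact: (is_derive_continuous h).
have cA (x : R) : {for x, continuous (fun y : R => phi' y ^+ 2 / rho y)}.
  apply: (@continuousM _ _ (fun y => phi' y ^+ 2)); last exact: crho.
  by apply: continuous_sqr; exact: cphi'.
have cB (x : R) : {for x, continuous (fun y : R => l * (phi y ^+ 2 / rho y))}.
  apply: (@continuousM _ _ (fun y => l)); first exact: cst_continuous.
  apply: (@continuousM _ _ (fun y => phi y ^+ 2)); last exact: crho.
  by apply: continuous_sqr; exact: cphi.
have cD : {within `[- c', c'], continuous D}.
  apply: continuous_in_subspaceT => x; rewrite inE/= in_itv/= => /sub xa.
  have ck : {for x, continuous k} by exact: (is_derive_continuous (dk x xa)).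
  rewrite (_ : D = fun y => phi' y ^+ 2 / rho y - l * (phi y ^+ 2 / rho y) -
      (phi' y - k y * phi y) ^+ 2 / rho y); last first.
    by apply/funext => y; rewrite /D !mulrBl mulrA.
  apply: cvgB; first by apply: cvgB; [exact: cA|exact: cB].
  apply: (@continuousM _ _ (fun y => (phi' y - k y * phi y) ^+ 2)); last exact: crho.
  apply: (@continuous_sqr (fun y => phi' y - k y * phi y)).
  have ckp : {for x, continuous (fun y => k y * phi y)}.
    by apply: continuousM => //; exact: cphi.
  by apply: cvgB; [exact: cphi'|exact: ckp].
have cP : derivable_oo_LRcontinuous P (- c') c'.
  split.
  - move=> x; rewrite in_itv/= => /andP[x1 x2].
    have xa : - a < x < a by apply/andP; split; lra.
    by have [] := dP x xa.
  - apply: cvg_at_right_filter; apply: (is_derive_continuous (dP _ _)).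
    by apply/andP; split; lra.
  - apply: cvg_at_left_filter; apply: (is_derive_continuous (dP _ _)).
    by apply/andP; split; lra.
have P0 x : `|x| = c' -> P x = 0.
  move=> xc'; rewrite /P phi0 ?mul0r ?mulr0 ?mul0r//.
  by rewrite -ler_norml xc' -ltNge.
have intD : (\int[leb1 R]_(x in `[(- c')%R, c']) (D x)%:E = 0)%E.
  rewrite (continuous_FTC2 c'0 cD cP).
    by rewrite !P0 ?subee// ?normrN gtr0_norm//; lra.
  move=> x; rewrite in_itv/= => /andP[x1 x2]; rewrite derive1E.
  have xa : - a < x < a by apply/andP; split; lra.
  by have [_ ->] := dP x xa.
pose A (x : R) : R := phi' x ^+ 2 / rho x; pose B (x : R) : R := l * (phi x ^+ 2 / rho x).
have iI (f : R -> R) : continuous f ->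
    (leb1 R).-integrable `[- c', c'] (fun x => (f x)%:E).
  move=> cf; apply: continuous_compact_integrable; first exact: segment_compact.
  exact: continuous_subspaceT.
have iA : (leb1 R).-integrable `[- c', c'] (fun x => (A x)%:E) by exact: iI.
have iB : (leb1 R).-integrable `[- c', c'] (fun x => (B x)%:E) by exact: iI.
have iD : (leb1 R).-integrable `[- c', c'] (fun x => (D x)%:E).
  by apply: continuous_compact_integrable => //; exact: segment_compact.
have BE : (\int[leb1 R]_x (B x)%:E = \int[leb1 R]_(x in `[(- c')%R, c']) (B x)%:E)%E.
  rewrite [RHS]integral_mkcond; apply: eq_integral => x _; rewrite /patch.
  case: ifPn => //; rewrite notin_setE/= in_itv/= => /negP xc.
  rewrite /B phi0 ?expr0n/= ?mul0r ?mulr0//; apply: contra xc => /andP[? ?].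
  by apply/andP; split; lra.
rewrite -/(B _) BE.
apply: (@le_trans _ _ (\int[leb1 R]_(x in `[(- c')%R, c']) (A x)%:E)%E); last first.
  apply: ge0_subset_integral => //.
    by apply/measurable_EFinP; apply: continuous_measurable_fun => x; exact: cA.
  by move=> x _; rewrite lee_fin divr_ge0 ?sqr_ge0// ltW// rho_gt0.
rewrite -[leLHS]adde0 -intD -integralD//.
apply: le_integral => //; first exact: integrableD.
move=> x xI; rewrite -EFinD lee_fin /A /B /D.
have h : 0 <= (phi' x - k x * phi x) ^+ 2 / rho x.
  by rewrite divr_ge0 ?sqr_ge0// ltW// rho_gt0.
move: h; rewrite !mulrBl; lra.
Qed.

End hardy.

(** * From test functions to Poincare inequalities *)

Section poincare_dense.
Context d (T : measurableType d) (R : realType).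
Variables (m : {measure set T -> \bar R}) (D : set T).
Hypothesis mD : measurable D.

Lemma Rintegral_sqrB (f g : T -> R) : L2_on m D f -> L2_on m D g ->
  \int[m]_(z in D) (f z - g z) ^+ 2 = \int[m]_(z in D) (f z ^+ 2)
    - 2 * \int[m]_(z in D) (f z * g z) + \int[m]_(z in D) (g z ^+ 2).
Proof.
move=> Lf Lg; have fg := L2_L1M mD Lf Lg; case: (Lf) => _ f2; case: (Lg) => _ g2.
rewrite (_ : \int[m]_(z in D) (f z - g z) ^+ 2 =
    \int[m]_(z in D) (f z ^+ 2 + -2 * (f z * g z) + g z ^+ 2)); last first.
  by apply: eq_Rintegral => z _; ring.
rewrite RintegralD//; last by apply: L1D => //; exact: L1Z.
by rewrite RintegralD ?RintegralZl ?mulNr//; exact: L1Z.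
Qed.

(** Duality.  With W close to u, int u^2 is about int u W = int g F, and the
    bound on F gives, by expanding int (g - l F)^2 >= 0,
    2 l int g F <= int g^2 + l int W^2. *)
Lemma poincare_dense (l : R) (u g : T -> R) : 0 < l ->
  L2_on m D u -> L2_on m D g ->
  (forall e : R, 0 < e -> exists W F, [/\ L2_on m D W, L2_on m D F,
    \int[m]_(z in D) (u z * W z) = \int[m]_(z in D) (g z * F z),
    l * \int[m]_(z in D) (F z ^+ 2) <= \int[m]_(z in D) (W z ^+ 2) &
    \int[m]_(z in D) (u z - W z) ^+ 2 < e]) ->
  l * \int[m]_(z in D) (u z ^+ 2) <= \int[m]_(z in D) (g z ^+ 2).
Proof.
move=> l0 Lu Lg dense; apply/ler_addgt0Pl => e e0.
have [W [F [LW LF uW lF uWe]]] := dense _ (divr_gt0 e0 l0).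
move: uWe; rewrite ltr_pdivlMr// mulrC Rintegral_sqrB//.
have : 0 <= \int[m]_(z in D) (g z - l * F z) ^+ 2.
  by apply: Rintegral_ge0 => z _; exact: sqr_ge0.
rewrite Rintegral_sqrB//; last exact: L2Z.
rewrite (_ : \int[m]_(z in D) (g z * (l * F z)) = l * \int[m]_(z in D) (g z * F z)).
  rewrite (_ : \int[m]_(z in D) ((l * F z) ^+ 2) = l ^+ 2 * \int[m]_(z in D) (F z ^+ 2)).
    rewrite uW; move: lF => /(ler_wpM2l (ltW l0)); rewrite expr2; lra.
  rewrite -RintegralZl//; last exact: LF.2.
  by apply: eq_Rintegral => z _; rewrite exprMn.
rewrite -RintegralZl//; last exact: L2_L1M.
by apply: eq_Rintegral => z _; rewrite mulrCA.
Qed.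

End poincare_dense.

Lemma compact_support_bounded (R : realType) (T : topologicalType) (K : set T)
    (f : T -> R) : compact K -> continuous f -> (forall z, ~ K z -> f z = 0) ->
  exists M, forall z, `|f z| <= M.
Proof.
move=> cK cf f0; have [K0|/set0P[k Kk]] := eqVneq K set0.
  by exists 0 => z; rewrite f0 ?normr0// K0.
have cfn : continuous (fun z => `|f z|).
  by move=> z; apply: cvg_norm; exact: cf.
have [c cK' cmax] := @compact_EVT_max _ _ (fun z => `|f z|) K
  (ex_intro _ k Kk) cK (continuous_subspaceT cfn).
exists `|f c| => z; have [Kz|Kz] := pselect (K z).
  by apply: cmax; rewrite inE.
by rewrite f0 ?normr0.
Qed.

Section compact_bounds.
Variables (R : realType) (T : topologicalType) (K : set T) (h : T -> R).
Hypothesis cK : compact K.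
Hypothesis ch : continuous h.

Let norm_max (k : T) : K k ->
  exists2 z, K z & forall t, K t -> - `|h z| <= h t <= `|h z|.
Proof.
move=> Kk; have cn : continuous (fun z => `|h z|).
  by move=> z; apply: cvg_norm; exact: ch.
have [z + zmax] := @compact_EVT_max _ _ _ K (ex_intro _ k Kk) cK
  (continuous_subspaceT cn).
rewrite inE => Kz; exists z => // t Kt.
by rewrite -ler_norml; apply: zmax; rewrite inE.
Qed.

Lemma compact_coordinate_bound : exists c, forall z, K z -> - c <= h z <= c.
Proof.
have [K0|/set0P[k /norm_max[z _ zmax]]] := eqVneq K set0; last by exists `|h z|.
by exists 0 => z; rewrite K0.
Qed.

Lemma compact_inner_bound (a : R) : (forall z, K z -> - a < h z < a) ->
  exists2 c, c < a & forall z, K z -> - c <= h z <= c.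
Proof.
move=> Ka; have [K0|/set0P[k /norm_max[z Kz zmax]]] := eqVneq K set0.
  by exists (a - 1); [rewrite gtrBl|move=> z; rewrite K0].
by exists `|h z| => //; rewrite ltr_norml Ka.
Qed.

End compact_bounds.

Section primitive.
Variable R : realType.
Notation line := (measurableTypeR R).

Lemma integrable1_compact (g : R -> R) (c : R) : continuous g ->
  (forall x, ~~ (- c <= x <= c) -> g x = 0) ->
  (leb1 R).-integrable [set: line] (fun x => (g x)%:E).
Proof.
move=> cg g0.
have -> : (fun x => (g x)%:E) = (fun x => (g x)%:E) \_ `[- c, c].
  apply/funext => x; rewrite /patch; case: ifPn => //.
  by rewrite notin_setE/= in_itv/= => /negP /g0 ->.
apply: (integrable_mkcond (mu := leb1 R) (EFin \o g) (measurable_itv _)).1.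
apply: (@continuous_compact_integrable _ g `[- c, c]%classic); first exact: segment_compact.
exact: continuous_subspaceT.
Qed.

Lemma compact_support_primitive (h : R -> R) (c : R) : continuous h ->
  (forall x, ~~ (- c <= x <= c) -> h x = 0) ->
  exists H : R -> R, [/\ forall x, is_derive x (1 : R) H (h x),
    forall x, x < - c -> H x = 0 & forall x, c < x -> H x = \int[leb1 R]_y h y].
Proof.
move=> ch h0.
have ih (A : set (measurableTypeR R)) : measurable A -> (leb1 R).-integrable A (EFin \o h).
  move=> mA; apply: (integrableS measurableT) => //.
  exact: integrable1_compact ch h0.
exists (fun x => \int[leb1 R]_(t in `]-oo, x]) h t); split.
- move=> x; have x1 : x < x + 1 by rewrite ltrDl.
  have ihx : (leb1 R).-integrable `]-oo, x + 1] (EFin \o h) by exact: ih.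
  have [dH H'] := @continuous_FTC1 R h -oo%O x (x + 1) x1 ihx (ltNyr x) (ch x).
  by split => //; rewrite -derive1E.
- move=> x xc; rewrite (@eq_Rintegral _ _ _ _ _ (fun=> 0)).
    by rewrite Rintegral_cst// mul0r.
  move=> t; rewrite inE/= in_itv/= => tx; apply: h0.
  by apply/negP => /andP[]; lra.
- move=> x xc; rewrite Rintegral_mkcond; apply: eq_Rintegral => t _.
  rewrite /patch; case: ifPn => //; rewrite notin_setE/= in_itv/= => /negP.
  rewrite -ltNge => xt; rewrite h0//.
  by apply/negP => /andP[]; lra.
Qed.

End primitive.

(** * Test functions on a planar domain *)

Lemma continuous_slice (R : realType) (y : R) :
  continuous (fun s : R => (s, y)).
Proof.
move=> x A [[P Q] [/= xP yQ] PQ]; have : \forall s \near x, P s by [].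
by apply: filterS => s Ps; apply: PQ; split => //=; exact: nbhs_singleton.
Qed.

Section test_functions.
Variables (R : realType) (Omega : set (R * R)).
Hypothesis oO : open Omega.
Notation plane := (measurableTypeR R * measurableTypeR R)%type.
Implicit Types phi u g : R * R -> R.

Lemma mO : measurable (Omega : set plane).
Proof. exact: open_plane_measurable. Qed.

Lemma supported_partial_x phi (K : set (R * R)) : compact K ->
  (forall z, ~ K z -> phi z = 0) -> forall z, ~ K z -> partial_x phi z = 0.
Proof.
move=> cK phi0 [x y] nK; rewrite /partial_x derive1E/=.
have oK : open (~` K).
  by apply: closed_openC; apply: compact_closed => //; exact: norm_hausdorff.
have [_ ->] : is_derive x (1 : R) (fun s => phi (s, y)) 0 => //.
apply: (@near_eq_is_derive _ _ _ (cst 0)) => //.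
have nb : nbhs (x, y) (~` K) by exact: open_nbhs_nbhs.
have : \forall s \near x, (~` K) (s, y) by exact: (continuous_slice nb).
by apply: filterS => s /phi0 ->.
Qed.

Lemma rho2_gt0 z : 0 < rho2 (z : R * R).
Proof. by rewrite mulr_gt0 ?rho_gt0. Qed.

Lemma rho2_neq0 z : rho2 (z : R * R) != 0.
Proof. exact: lt0r_neq0 (rho2_gt0 z). Qed.

Lemma continuous_rho2V : continuous (fun z : R * R => (rho2 z)^-1).
Proof.
move=> z; apply: cvgV; first exact: rho2_neq0.
have cr := smooth1_continuous (@smooth1_rho R).
have -> : @rho2 R = tensor (@rho R) (@rho R) by [].
exact: continuous_tensor.
Qed.

(** Dividing a test function by the density turns Lebesgue integrals against it
    into integrals for the Gaussian measure. *)
Lemma test_L2 (K : set (R * R)) phi : compact K -> continuous phi ->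
  (forall z, ~ K z -> phi z = 0) ->
  L2_on (gauss2 R) Omega (fun z => phi z / rho2 z).
Proof.
move=> cK cphi phi0.
have cq : continuous (fun z => phi z / rho2 z).
  by move=> z; apply: cvgM; [exact: cphi|exact: continuous_rho2V].
have q0 z : ~ K z -> phi z / rho2 z = 0 by move=> /phi0 ->; rewrite mul0r.
have [M hM] := compact_support_bounded cK cq q0.
apply: (@L2_bounded _ _ _ _ _ mO _ M) => //; first exact: (gauss2_lty mO).
by apply: measurable_funTS; exact: continuous_plane_measurable.
Qed.

Definition test phi := smooth2 phi /\ supported_in Omega phi.

(** The weak derivative rewritten for the Gaussian measure. *)
Lemma test_weak_x u ux phi : L2_on (gauss2 R) Omega u ->
  L2_on (gauss2 R) Omega ux -> weak_partial_x Omega u ux -> test phi ->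
  \int[gauss2 R]_(z in Omega) (u z * (- partial_x phi z / rho2 z)) =
  \int[gauss2 R]_(z in Omega) (ux z * (phi z / rho2 z)).
Proof.
move=> Lu Lux wx [sphi [K [cK KO phi0]]].
have LF := test_L2 cK (smooth2_continuous sphi) phi0.
have LW := test_L2 cK (smooth2_partial_x sphi) (supported_partial_x cK phi0).
have := wx phi sphi (ex_intro _ K (And3 cK KO phi0)).
have e (f h : R * R -> R) : L2_on (gauss2 R) Omega f ->
    L2_on (gauss2 R) Omega (fun z => h z / rho2 z) ->
    \int[leb2 R]_(z in Omega) (f z * h z) =
    \int[gauss2 R]_(z in Omega) (f z * (h z / rho2 z)).
  move=> Lf Lh.
  have mfh : measurable_fun Omega (fun z => f z * (h z / rho2 z)).
    exact: measurable_funM Lf.1 Lh.1.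
  rewrite (@Rintegral_density _ plane R (gauss2 R) (leb2 R) (@rho2 R) rho2_gt0
    (@gauss2_density R) Omega _ mO mfh).
  by apply: eq_Rintegral => z _; rewrite -mulrA divfK// rho2_neq0.
rewrite (e _ _ Lu LW) (e _ _ Lux LF).
move=> h.
transitivity (- \int[gauss2 R]_(z in Omega) (u z * (partial_x phi z / rho2 z))).
  rewrite -mulN1r -RintegralZl//; [|exact: mO|exact: (L2_L1M mO Lu LW)].
  by apply: eq_Rintegral => z _; ring.
by rewrite h opprK.
Qed.

Variables (a l : R).
Hypothesis l0 : 0 < l.
Hypothesis s_gt0 : forall x, - a < x < a -> 0 < herm' l x.
Hypothesis Oa : forall z, Omega z -> - a < z.1 < a.

(** [hardy] on each horizontal line, then Tonelli. *)
Lemma test_hardy phi : test phi ->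
  l * \int[gauss2 R]_(z in Omega) ((phi z / rho2 z) ^+ 2) <=
  \int[gauss2 R]_(z in Omega) ((- partial_x phi z / rho2 z) ^+ 2).
Proof.
move=> [sphi [K [cK KO phi0]]].
have LF := test_L2 cK (smooth2_continuous sphi) phi0.
have LW := test_L2 cK (smooth2_partial_x sphi) (supported_partial_x cK phi0).
have [c ca hc] := compact_inner_bound cK (@continuous_fst R) (fun z Kz => Oa (KO z Kz)).
pose P (z : R * R) : R := l * (phi z ^+ 2 / rho2 z).
pose Q (z : R * R) : R := partial_x phi z ^+ 2 / rho2 z.
have sqr_cont (f : R * R -> R) : continuous f -> continuous (fun z => f z ^+ 2 / rho2 z).
  move=> cf z; apply: cvgM; last exact: continuous_rho2V.
  rewrite (_ : (fun z => f z ^+ 2) = (fun z => f z * f z)).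
    by apply: cvgM; exact: cf.
  by apply/funext => t; rewrite expr2.
have mP : measurable_fun setT (EFin \o P : plane -> \bar R).
  apply/measurable_EFinP; apply: measurable_funM => //.
  by apply: continuous_plane_measurable; apply: sqr_cont; exact: smooth2_continuous.
have mQ : measurable_fun setT (EFin \o Q : plane -> \bar R).
  apply/measurable_EFinP.
  by apply: continuous_plane_measurable; apply: sqr_cont; exact: smooth2_partial_x.
have P0 z : (0 <= (EFin \o P) z)%E.
  by rewrite lee_fin mulr_ge0 ?(ltW l0)// divr_ge0 ?sqr_ge0// ltW// rho2_gt0.
have Q0 z : (0 <= (EFin \o Q) z)%E.
  by rewrite lee_fin divr_ge0 ?sqr_ge0// ltW// rho2_gt0.
have PE : (\int[gauss2 R]_(z in Omega) (l * (phi z / rho2 z) ^+ 2)%:E =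
    \int[leb2 R]_z (P z)%:E)%E.
  rewrite gauss2_density//; [|exact: mO| |].
  - rewrite integral_mkcond; apply: eq_integral => z _; rewrite /patch.
    case: ifPn => [_|]; last first.
      by rewrite notin_setE => nO; rewrite /P phi0 ?expr0n/= ?mul0r ?mulr0// => /KO.
    by rewrite -EFinM /P; congr EFin; field; exact: rho2_neq0.
  - by apply/measurable_EFinP; apply: measurable_funM => //; exact: measurable_funX LF.1.
  - by move=> z; rewrite lee_fin mulr_ge0 ?sqr_ge0// ltW.
have QE : (\int[gauss2 R]_(z in Omega) ((- partial_x phi z / rho2 z) ^+ 2)%:E =
    \int[leb2 R]_z (Q z)%:E)%E.
  have e z : (- partial_x phi z / rho2 z) ^+ 2 = (partial_x phi z / rho2 z) ^+ 2.
    by rewrite mulNr sqrrN.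
  under eq_integral do rewrite e.
  rewrite gauss2_density//; [|exact: mO| |].
  - rewrite integral_mkcond; apply: eq_integral => z _; rewrite /patch.
    case: ifPn => [_|]; last first.
      rewrite notin_setE => nO; rewrite /Q (supported_partial_x cK phi0).
        by rewrite expr0n/= mul0r.
      by move=> /KO.
    by rewrite -EFinM /Q; congr EFin; field; exact: rho2_neq0.
  - by apply/measurable_EFinP; exact: measurable_funX LW.1.
  - by move=> z; rewrite lee_fin sqr_ge0.
have PQ : (\int[leb2 R]_z (P z)%:E <= \int[leb2 R]_z (Q z)%:E)%E.
  rewrite (leb2_ge0_integralT mP P0) (leb2_ge0_integralT mQ Q0).
  apply: ge0_le_integral => //.
  - by move=> y _; apply: integral_ge0 => x _; exact: P0.
  - exact: (@measurable_fun_fubini_tonelli_G _ _ _ _ R (@lebesgue_measure R) _ mP P0).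
  - exact: (@measurable_fun_fubini_tonelli_G _ _ _ _ R (@lebesgue_measure R) _ mQ Q0).
  - move=> y _.
    have sup x : ~~ (- c <= x <= c) -> phi (x, y) = 0.
      by move=> /negP xc; apply: phi0 => /hc.
    have cpx : continuous (fun x => partial_x phi (x, y)).
      move=> x; have c1 : {for x, continuous (fun s : R => (s, y))} by exact: continuous_slice.
      have c2 : {for ((x, y) : R * R), continuous (partial_x phi)}.
        by have := smooth2_partial_x sphi; apply.
      exact: (continuous_comp c1 c2).
    have := @hardy R a l l0 s_gt0 (fun x => phi (x, y)) (fun x => partial_x phi (x, y))
      c ca (fun x => smooth2_is_derive_x x y sphi) cpx sup.
    have r0 : (0 <= ((rho y)^-1)%:E)%E by rewrite lee_fin invr_ge0 ltW// rho_gt0.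
    move=> /(lee_wpmul2r r0).
    have mrV : measurable_fun setT (fun x : R => (rho x)^-1).
      apply: continuous_measurable_fun => x.
      by apply: cvgV; [exact: rho_neq0|exact: (smooth1_continuous (@smooth1_rho R))].
    have mq (f : R -> R) : continuous f ->
        measurable_fun setT (fun x => f x ^+ 2 / rho x).
      move=> cf; apply: measurable_funM => //; apply: measurable_funX.
      exact: continuous_measurable_fun.
    have mPy : measurable_fun setT (fun x => (l * (phi (x, y) ^+ 2 / rho x))%:E).
      apply/measurable_EFinP; apply: measurable_funM => //; apply: (mq (fun x => phi (x, y))).
      move=> x; have [+ _] := smooth2_is_derive_x x y sphi.
      by move=> /derivable1_diffP/differentiable_continuous.
    have mQy : measurable_fun setT (fun x => (partial_x phi (x, y) ^+ 2 / rho x)%:E).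
      by apply/measurable_EFinP; exact: (mq (fun x => partial_x phi (x, y))).
    rewrite -!ge0_integralZr//; last 2 first.
    + by move=> x _; rewrite lee_fin divr_ge0 ?sqr_ge0// ltW// rho_gt0.
    + by move=> x _; rewrite lee_fin mulr_ge0 ?(ltW l0)// divr_ge0 ?sqr_ge0// ltW// rho_gt0.
    congr (_ <= _)%E; apply: eq_integral => x _; rewrite -EFinM; congr EFin;
      rewrite /P /Q /rho2/=; field; rewrite !rho_neq0//.
have LW' : L2_on (gauss2 R) Omega (fun z => - partial_x phi z / rho2 z).
  by have := L2Z mO (-1) LW; under eq_fun do rewrite mulN1r -mulNr.
rewrite -RintegralZl//; [|exact: mO|exact: LF.2].
apply: fine_le.
- exact: (integrable_fin_num mO (L1Z mO l LF.2)).
- exact: (integrable_fin_num mO LW'.2).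
- by rewrite PE QE.
Qed.

End test_functions.

(** * Poincare inequality for odd functions *)

Section odd_poincare.
Variables (R : realType) (Omega : set (R * R)).
Hypothesis oO : open Omega.
Hypothesis hull : forall x x' y : R, Omega (x, y) -> `|x'| <= `|x| -> Omega (x', y).
Notation plane := (measurableTypeR R * measurableTypeR R)%type.
Implicit Types (u w phi : R * R -> R).

Definition odd_part w : R * R -> R := fun z => (w z - w (flip z)) / 2.

(** The functions w whose odd part is of the form W = - phi_x / rho2 with phi a
    test function.  Stated for w and not for W, so that the class contains the
    approximations of indicators of small rectangles. *)
Definition odd_testable : set (R * R -> R) := [set w |
  [/\ measurable_fun setT (w : plane -> R), exists M, forall z, `|w z| <= M &
   exists2 phi, test Omega phi &
     forall z, - partial_x phi z = rho2 z * odd_part w z]].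

Lemma test0 : test Omega (fun=> 0).
Proof.
split; last by exists set0; split => //; exact: compact0.
have -> : (fun=> 0) = tensor (fun=> 0) (fun=> 0) :> (R * R -> R).
  by apply/funext => z; rewrite /tensor mul0r.
by apply: smooth2_tensor; exact: smooth1_cst.
Qed.

Lemma test_lincomb phi psi (c : R) : test Omega phi -> test Omega psi ->
  test Omega (fun z => phi z + c * psi z).
Proof.
move=> [sphi [K [cK KO phi0]]] [spsi [K' [cK' KO' psi0]]].
split; first exact: smooth2_lincomb.
exists (K `|` K'); split; [exact: compactU|by move=> z [/KO|/KO']|].
by move=> z /not_orP[/phi0 -> /psi0 ->]; rewrite mulr0 addr0.
Qed.

Lemma odd_testable0 : odd_testable (fun=> 0).
Proof.
split; [exact: measurable_cst|by exists 0 => z; rewrite normr0|].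
exists (fun=> 0); first exact: test0.
by move=> z; rewrite /odd_part subrr mul0r mulr0 /partial_x derive1_cst oppr0.
Qed.

Lemma odd_testable_lin (c : R) w w' : odd_testable w -> odd_testable w' ->
  odd_testable (fun z => w z + c * w' z).
Proof.
move=> [mw [M wM] [phi tphi phiw]] [mw' [M' wM'] [psi tpsi psiw]]; split.
- by apply: measurable_funD => //; exact: measurable_funM.
- exists (M + `|c| * M') => z; rewrite (le_trans (ler_normD _ _))// lerD//.
  by rewrite normrM ler_wpM2l.
- exists (fun z => phi z + c * psi z); first exact: test_lincomb.
  move=> z; rewrite (partial_x_lincomb c tphi.1 tpsi.1) opprD phiw -mulrN psiw /odd_part.
  by ring.
Qed.

Lemma odd_testable_L2 w : odd_testable w -> L2_on (gauss2 R) Omega w.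
Proof.
move=> [mw [M wM] _]; apply: (@L2_bounded _ _ _ _ _ (mO oO) _ M) => //.
  exact: (gauss2_lty (mO oO)).
exact: measurable_funTS.
Qed.

(** The odd part of a product of bumps times the density has an even primitive
    in x, which vanishes to the left of the support of the integrand, hence by
    parity also to the right.  By convexity and symmetry the rectangle that joins
    the bump to its mirror image is still in Omega. *)
Lemma odd_testable_bump (s t s' t' : R) n : rect s t s' t' `<=` Omega ->
  odd_testable (tensor (bump s t n.+1) (bump s' t' n.+1)).
Proof.
move=> stO; set b := bump s t n.+1; set b' := bump s' t' n.+1.
set s1 := s + n.+1%:R^-1; set t1 := t - n.+1%:R^-1.
set s'1 := s' + n.+1%:R^-1; set t'1 := t' - n.+1%:R^-1.
have n0 : 0 < n.+1%:R^-1 :> R by rewrite invr_gt0 ltr0n.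
have ss1 : s < s1 by rewrite ltrDl.
have tt1 : t1 < t by rewrite gtrBl.
have ss1' : s' < s'1 by rewrite ltrDl.
have tt1' : t'1 < t' by rewrite gtrBl.
have [st1|/negP st1] := boolP (s1 <= t1); last first.
  rewrite (_ : tensor _ _ = fun=> 0); first exact: odd_testable0.
  apply/funext => -[x y]; rewrite /tensor/= [b x]bump_eq0 ?mul0r//.
  apply/negP => /andP[? ?]; apply: st1; exact: le_trans (_ : _ <= x) _.
have sb : smooth1 b by exact: smooth1_bump.
have sb' : smooth1 b' by exact: smooth1_bump.
split.
- by apply: continuous_plane_measurable; apply: continuous_tensor; exact: smooth1_continuous.
- exists 1 => z; rewrite /tensor normrM mulr_ile1// ger0_norm;
    by have /andP[] := bump_itv s t n.+1 z.1; have /andP[] := bump_itv s' t' n.+1 z.2.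
pose m := Num.max `|s1| `|t1|.
(* the odd part of b times the density; -1 * x + 0 stands for - x so as to apply
   the lemmas on affine changes of variable *)
pose h (x : R) : R := rho x * ((b x + -1 * b (-1 * x + 0)) * 2^-1).
have sh : smooth1 h.
  apply: smooth1M; first exact: smooth1_rho.
  apply: smooth1M; last exact: smooth1_cst.
  have sbN := smooth1M (@smooth1_cst R (-1)) (@smooth1_affine _ b (-1) 0 sb).
  by have := smooth1D sb sbN.
have hE x : h x = rho x * ((b x - b (- x)) / 2) by rewrite /h !mulN1r addr0.
have bm x : ~~ (- m <= x <= m) -> b x = 0.
  move=> xm; apply: bump_eq0; apply: contra xm => /andP[].
  rewrite -/s1 -/t1 => sx xt.
  have s1m : `|s1| <= m by rewrite le_max lexx.
  have t1m : `|t1| <= m by rewrite le_max lexx orbT.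
  have := ler_norm (- s1); have := ler_norm t1; rewrite normrN => ? ?.
  by apply/andP; split; lra.
have h0 x : ~~ (- m <= x <= m) -> h x = 0.
  move=> xm; rewrite hE bm// bm ?subrr ?mul0r ?mulr0//.
  by apply: contra xm => /andP[? ?]; apply/andP; split; lra.
have [H [dH H0 _]] := compact_support_primitive (smooth1_continuous sh) h0.
have HN x : H (- x) = H x.
  have dK y : is_derive y (1 : R) (fun z => H z + - H (-1 * z + 0)) 0.
    have e := @is_derive_compose _ H (fun v => -1 * v + 0) y _ _ (dH _)
      (is_derive_affine (-1) 0 y).
    apply: is_derive_eq (is_derive_add (dH y) (is_derive_opp e)) _.
    by rewrite mulN1r addr0 !hE rhoN opprK; ring.
  have := is_derive_0_is_cst x 0 dK; rewrite !mulN1r !addr0 oppr0 subrr.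
  by move/eqP; rewrite subr_eq0 => /eqP.
have sH : smooth1 H := smooth1_primitive dH sh.
pose g (y : R) : R := -1 * (b' y * rho y).
have sg : smooth1 g.
  have sbr := smooth1M sb' (@smooth1_rho R).
  by have := smooth1M (@smooth1_cst R (-1)) sbr.
exists (tensor H g).
  split; first exact: smooth2_tensor.
  exists (`[- m, m] `*` `[s'1, t'1]); split.
  - by apply: compact_setX; exact: segment_compact.
  - move=> [x y] /= [xm ys].
    have sty (v : R) : s1 <= v <= t1 -> Omega (v, y).
      move=> /andP[? ?]; apply: stO; split; rewrite /= in_itv/=.
        by apply/andP; split; lra.
      by move: ys; rewrite in_itv/= => /andP[? ?]; apply/andP; split; lra.
    have xm' : `|x| <= m by move: xm; rewrite in_itv/= ler_norml.
    move: xm'; rewrite le_max => /orP[|]; apply: hull; apply: sty.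
      by rewrite lexx.
    by rewrite lexx st1.
  - move=> [x y] /= nK; rewrite /tensor/=.
    have [xm|xm] := boolP (- m <= x <= m); last first.
      rewrite (_ : H x = 0) ?mul0r//; move: xm; rewrite negb_and -!ltNge => /orP[/H0//|xm].
      by rewrite -HN H0// ltrN2.
    rewrite (_ : g y = 0) ?mulr0// /g [b' y]bump_eq0 ?mul0r ?mulr0//.
    by apply/negP => ys; apply: nK; split; rewrite /= in_itv.
move=> z; rewrite partial_x_tensor// (is_derive_derive1 dH) /tensor hE /g /odd_part /rho2 /flip/=.
by ring.
Qed.

Lemma odd_testable_rect (s t s' t' : R) : rect s t s' t' `<=` Omega ->
  approximable (gauss2 R) Omega odd_testable (\1_(rect s t s' t') : plane -> R).
Proof.
move=> stO.
pose f_ n := tensor (bump s t n.+1) (bump s' t' n.+1).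
have lyO := gauss2_lty (mO oO).
apply: (@approximable_cvg _ plane R (gauss2 R) Omega (mO oO) odd_testable odd_testable_L2
  f_ _ (fun=> 1)).
- move=> n; apply: approximable_sub; [exact: mO|exact: odd_testable_L2|].
  exact: odd_testable_bump.
- by apply: measurable_funTS; apply: measurable_indic; exact: measurable_rect.
- move=> [x y] _.
  have -> : \1_(rect s t s' t') (x, y) = \1_`]s, t[ x * \1_`]s', t'[ y :> R.
    by rewrite !indicE in_setX -natrM mulnb.
  by apply: cvgM; exact: bump_cvgS.
- move=> n z _; rewrite /f_ /tensor normrM mulr_ile1// ger0_norm;
    by have /andP[] := bump_itv s t n.+1 z.1; have /andP[] := bump_itv s' t' n.+1 z.2.
- exact: (@L2_cst _ plane R (gauss2 R) Omega (mO oO) 1 lyO).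
Qed.

Lemma odd_testable_dense u : L2_on (gauss2 R) Omega u ->
  approximable (gauss2 R) Omega odd_testable u.
Proof.
apply: (@L2_approximable _ plane R (gauss2 R) Omega (mO oO) odd_testable
  odd_testable_L2 odd_testable_lin odd_testable0 (gauss2_lty (mO oO))
  [set A | rects A /\ A `<=` Omega] (@rects R) (rat_rect Omega)).
- move=> A A' [rA AO] [rA' A'O]; split; first exact: rects_setI.
  by move=> z [/AO].
- by move=> _ [[s [t [s' [t' ->]]]] /odd_testable_rect].
- by move=> i; exact: rat_rect_rects.
- exact: open_rat_rect.
- exact: rects_setI.
- exact: measurable_plane_rects.
- move=> A C rA [rC CO]; split; first exact: rects_setI.
  by move=> z [_ /CO].
Qed.

(** When u is odd, u - odd_part w is the odd part of u - w. *)
Lemma odd_part_closer u w : L2_on (gauss2 R) Omega u -> odd_on Omega u ->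
  odd_testable w -> L2_on (gauss2 R) Omega (odd_part w) ->
  \int[gauss2 R]_(z in Omega) (u z - odd_part w z) ^+ 2 <=
  \int[gauss2 R]_(z in Omega) (u z - w z) ^+ 2.
Proof.
move=> Lu ou Vw Low; have Lw := odd_testable_L2 Vw.
have mO' := mO oO.
have Luw := L2B mO' Lu Lw; have Luo := L2B mO' Lu Low.
pose e : plane -> R := (fun z => u z - w z) \_ Omega.
have me : measurable_fun setT e by exact: ((measurable_restrictT _ mO').1 Luw.1).
pose q z := (e z ^+ 2)%:E.
have mq : measurable_fun setT q by apply/measurable_EFinP; exact: measurable_funX.
have q0 z : (0 <= q z)%E by rewrite lee_fin sqr_ge0.
have flipO z : Omega z -> Omega (flip z).
  by case: z => x y /hull; apply; rewrite normrN.
apply: fine_le.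
- exact: (integrable_fin_num mO' Luo.2).
- exact: (integrable_fin_num mO' Luw.2).
have qE : (\int[gauss2 R]_(z in Omega) ((u z - w z) ^+ 2)%:E = \int[gauss2 R]_z q z)%E.
  rewrite integral_mkcond; apply: eq_integral => z _; rewrite /q /e /patch.
  by case: ifP => //; rewrite expr0n.
have mqf : measurable_fun setT (q \o @flip R).
  by apply: measurableT_comp => //; exact: measurable_flip.
have hq : (\int[gauss2 R]_z (2^-1%:E * (q z + q (flip z))) = \int[gauss2 R]_z q z)%E.
  rewrite ge0_integralZl//; last 2 first.
  - by apply: emeasurable_funD.
  - by move=> z _; rewrite adde_ge0.
  rewrite ge0_integralD// gauss2_flip// -qE.
  have /fineK <- := integrable_fin_num mO' Luw.2.
  by rewrite -EFinD -EFinM; congr EFin; field.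
rewrite qE -hq.
apply: (@le_trans _ _ (\int[gauss2 R]_(z in Omega) (2^-1%:E * (q z + q (flip z))))%E); last first.
  apply: ge0_subset_integral => //.
  - by apply: measurable_funeM; exact: emeasurable_funD.
  - by move=> z _; rewrite mule_ge0// adde_ge0.
apply: ae_ge0_le_integral => //.
- by move=> z _; rewrite lee_fin sqr_ge0.
- exact: (measurable_int _ Luo.2).
- by move=> z _; rewrite mule_ge0// adde_ge0.
- by apply: measurable_funTS; apply: measurable_funeM; exact: emeasurable_funD.
apply: (@filterS _ _ (ae_filter_ringOfSetsType (gauss2 R)) _ _ _ ou) => z uz Oz.
rewrite /q /e !patchE !mem_set//; last exact: flipO.
rewrite -EFinD -EFinM lee_fin /odd_part.
have -> : u (flip z) = - u z by exact: uz.
have := sqr_ge0 ((u z - w z) + (- u z - w (flip z))).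
rewrite !expr2; lra.
Qed.

Variables (a l : R).
Hypothesis l0 : 0 < l.
Hypothesis s_gt0 : forall x, - a < x < a -> 0 < herm' l x.
Hypothesis Oa : forall z, Omega z -> - a < z.1 < a.

(** [poincare_dense] with W the odd part of an approximation of u. *)
Lemma odd_poincare u ux : L2_on (gauss2 R) Omega u -> L2_on (gauss2 R) Omega ux ->
  weak_partial_x Omega u ux -> odd_on Omega u ->
  l * \int[gauss2 R]_(z in Omega) (u z ^+ 2) <=
  \int[gauss2 R]_(z in Omega) (ux z ^+ 2).
Proof.
move=> Lu Lux wx ou; apply: (@poincare_dense _ plane R (gauss2 R) Omega (mO oO)) => //.
move=> e e0; have [_ /(_ e e0)[w Vw uw]] := odd_testable_dense Lu.
have [_ _ [phi tphi phiw]] := Vw.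
have [K [cK KO phi0]] := tphi.2.
have LF := test_L2 oO cK (smooth2_continuous tphi.1) phi0.
have oE : (fun z => - partial_x phi z / rho2 z) = odd_part w.
  by apply/funext => z; rewrite phiw mulrC mulKf// rho2_neq0.
have LW : L2_on (gauss2 R) Omega (odd_part w).
  rewrite -oE; have := L2Z (mO oO) (-1)
    (test_L2 oO cK (smooth2_partial_x tphi.1) (supported_partial_x cK phi0)).
  by under eq_fun do rewrite mulN1r -mulNr.
exists (odd_part w), (fun z => phi z / rho2 z); split => //.
- by rewrite -oE; exact: test_weak_x.
- by rewrite -oE; exact: (test_hardy oO l0 s_gt0 Oa).
- exact: le_lt_trans (odd_part_closer Lu ou Vw LW) uw.
Qed.

End odd_poincare.

(** * Poincare inequality for functions of mean zero *)

Section mean_zero_poincare.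
Variables (R : realType) (a : R).
Notation line := (measurableTypeR R).
Let D : set line := `]- a, a[%classic.
Implicit Types (u w phi : R -> R).

Let mD : measurable D. Proof. exact: measurable_itv. Qed.
Let Doo : (gauss1 R D < +oo)%E. Proof. exact: gauss1_lty. Qed.

Definition test1 phi := smooth1 phi /\ supported_in (`]- a, a[%classic : set R) phi.

Lemma supported_derive1 phi (K : set R) : compact K ->
  (forall z, ~ K z -> phi z = 0) -> forall z, ~ K z -> derive1 phi z = 0.
Proof.
move=> cK phi0 x nK; rewrite derive1E.
have oK : open (~` K).
  by apply: closed_openC; apply: compact_closed => //; exact: Rhausdorff.
have [_ ->] : is_derive x (1 : R) phi 0 => //.
apply: (@near_eq_is_derive _ _ _ (cst 0)) => //.
have nb : nbhs x (~` K) by exact: open_nbhs_nbhs.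
by apply: filterS nb => s /phi0 ->.
Qed.

Lemma continuous_rhoV : continuous (fun x : R => (rho x)^-1).
Proof.
move=> x; apply: cvgV; first exact: rho_neq0.
exact: (smooth1_continuous (@smooth1_rho R)).
Qed.

Lemma test1_L2 (K : set R) phi : compact K -> continuous phi ->
  (forall z, ~ K z -> phi z = 0) ->
  L2_on (gauss1 R) D (fun x => phi x / rho x).
Proof.
move=> cK cphi phi0.
have cq : continuous (fun x => phi x / rho x).
  by move=> x; apply: cvgM; [exact: cphi|exact: continuous_rhoV].
have q0 x : ~ K x -> phi x / rho x = 0 by move=> /phi0 ->; rewrite mul0r.
have [M hM] := compact_support_bounded cK cq q0.
apply: (@L2_bounded _ _ _ _ _ mD _ M) => //.
by apply: measurable_funTS; exact: continuous_measurable_fun.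
Qed.

Lemma test1_weak u u' phi : L2_on (gauss1 R) D u -> L2_on (gauss1 R) D u' ->
  weak_deriv D u u' -> test1 phi ->
  \int[gauss1 R]_(x in D) (u x * (- derive1 phi x / rho x)) =
  \int[gauss1 R]_(x in D) (u' x * (phi x / rho x)).
Proof.
move=> Lu Lu' wu [sphi [K [cK KO phi0]]].
have LF := test1_L2 cK (smooth1_continuous sphi) phi0.
have LW := test1_L2 cK (smooth1_continuous (smooth1_derive sphi)) (supported_derive1 cK phi0).
have := wu phi sphi (ex_intro _ K (And3 cK KO phi0)).
have e (f h : R -> R) : L2_on (gauss1 R) D f ->
    L2_on (gauss1 R) D (fun z => h z / rho z) ->
    \int[leb1 R]_(z in D) (f z * h z) =
    \int[gauss1 R]_(z in D) (f z * (h z / rho z)).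
  move=> Lf Lh.
  have mfh : measurable_fun D (fun z => f z * (h z / rho z)).
    exact: measurable_funM Lf.1 Lh.1.
  rewrite (@Rintegral_density _ line R (gauss1 R) (leb1 R) (@rho R) (@rho_gt0 R)
    (@gauss1_density R) D _ mD mfh).
  by apply: eq_Rintegral => z _; rewrite -mulrA divfK// rho_neq0.
rewrite (e _ _ Lu LW) (e _ _ Lu' LF).
move=> h.
transitivity (- \int[gauss1 R]_(z in D) (u z * (derive1 phi z / rho z))).
  rewrite -mulN1r -RintegralZl//; last exact: (L2_L1M mD Lu LW).
  by apply: eq_Rintegral => z _; ring.
by rewrite h opprK.
Qed.

Variable l : R.
Hypothesis l0 : 0 < l.
Hypothesis s_gt0 : forall x, - a < x < a -> 0 < herm' l x.

Lemma test1_hardy phi : test1 phi ->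
  l * \int[gauss1 R]_(x in D) ((phi x / rho x) ^+ 2) <=
  \int[gauss1 R]_(x in D) ((- derive1 phi x / rho x) ^+ 2).
Proof.
move=> [sphi [K [cK KO phi0]]].
have LF := test1_L2 cK (smooth1_continuous sphi) phi0.
have LW := test1_L2 cK (smooth1_continuous (smooth1_derive sphi)) (supported_derive1 cK phi0).
have LW' : L2_on (gauss1 R) D (fun z => - derive1 phi z / rho z).
  by have := L2Z mD (-1) LW; under eq_fun do rewrite mulN1r -mulNr.
have Ka x : K x -> - a < x < a by move=> /KO; rewrite /= in_itv.
have cid : continuous (fun x : R => x) by move=> x; exact: cvg_id.
have [c ca hc] := compact_inner_bound cK cid Ka.
have sup x : ~~ (- c <= x <= c) -> phi x = 0.
  by move=> /negP xc; apply: phi0 => /hc.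
have H := @hardy R a l l0 s_gt0 phi (derive1 phi) c ca
  (fun x => smooth1_is_derive x sphi) (smooth1_continuous (smooth1_derive sphi)) sup.
rewrite -RintegralZl//; last exact: LF.2.
apply: fine_le.
- exact: (integrable_fin_num mD (L1Z mD l LF.2)).
- exact: (integrable_fin_num mD LW'.2).
rewrite gauss1_density//; last 2 first.
- by apply/measurable_EFinP; apply: measurable_funM => //; exact: measurable_funX LF.1.
- by move=> z; rewrite lee_fin mulr_ge0 ?sqr_ge0// ltW.
rewrite gauss1_density//; last 2 first.
- exact: (measurable_int _ LW'.2).
- by move=> z; rewrite lee_fin sqr_ge0.
apply: (le_trans (le_trans _ H)); rewrite le_eqVlt; apply/orP; left; apply/eqP.
- rewrite integral_mkcond; apply: eq_integral => z _; rewrite /patch.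
  case: ifPn => [_|].
    by rewrite -EFinM; congr EFin; field; exact: rho_neq0.
  by rewrite notin_setE => nO; rewrite phi0 ?expr0n/= ?mul0r ?mulr0// => /KO.
- rewrite [RHS]integral_mkcond; apply: eq_integral => z _; rewrite /patch.
  case: ifPn => [_|].
    by rewrite -EFinM; congr EFin; field; exact: rho_neq0.
  rewrite notin_setE => nO; rewrite (supported_derive1 cK phi0).
    by rewrite expr0n/= mul0r.
  by move=> /KO.
Qed.

Lemma sqr_Rintegral_le h : L2_on (gauss1 R) D h ->
  (\int[gauss1 R]_(x in D) h x) ^+ 2 <= \int[gauss1 R]_(x in D) (h x ^+ 2).
Proof.
move=> Lh; set M := \int[gauss1 R]_(x in D) h x.
have LM := L2_cst mD M Doo.
have : 0 <= \int[gauss1 R]_(x in D) (h x - M) ^+ 2.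
  by apply: Rintegral_ge0 => x _; exact: sqr_ge0.
rewrite (Rintegral_sqrB mD Lh LM) Rintegral_cst// RintegralZr//; last first.
  have := L2_L1M mD Lh (L2_cst mD 1 Doo).
  by under eq_fun do rewrite mulr1.
rewrite -/M.
have g1 : fine (gauss1 R D) <= 1.
  rewrite -[1]/(fine (1%E : \bar R)) -(gauss1_setT R); apply: fine_le.
  - by rewrite ge0_fin_numE.
  - by rewrite (_ : gauss1 R setT = 1%E)//; exact: gauss1_setT.
  - by rewrite le_measure ?inE.
have := sqr_ge0 M; move: g1; rewrite expr2; nra.
Qed.

(** A fixed bump of Gaussian mass 1, used to correct the mean of a function
    without leaving the compactly supported ones. *)
Lemma unit_mass_bump : gauss1 R D != 0%E -> exists psi c, [/\ smooth1 psi, c < a,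
  forall x, ~~ (- c <= x <= c) -> psi x = 0 & \int[gauss1 R]_(x in D) psi x = 1].
Proof.
move=> D0; have L1D := L2_cst mD 1 Doo.
have bm n : measurable_fun D (bump (- a) a n.+1).
  apply: measurable_funTS; apply: continuous_measurable_fun.
  exact/smooth1_continuous/smooth1_bump.
have bb n x : `|bump (- a) a n.+1 x| <= 1.
  by have /andP[b0 b1] := bump_itv (- a) a n.+1 x; rewrite ger0_norm.
have i1 : L1 (gauss1 R) D (fun=> 1).
  by have := L1D.2; under eq_fun do rewrite expr1n.
have : \int[gauss1 R]_(x in D) bump (- a) a n.+1 x @[n --> \oo] -->
    \int[gauss1 R]_(x in D) (1 : R).
  apply: (@Rintegral_cvg _ _ _ (gauss1 R) D mD _ _ (fun=> 1)) => //.
  move=> x Dx; rewrite -[X in _ --> X](_ : \1_`]- a, a[ x = 1).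
    exact: bump_cvgS.
  by rewrite indicE mem_set.
have I0 : 0 < \int[gauss1 R]_(x in D) (1 : R).
  rewrite Rintegral_cst// mul1r fine_gt0// lt_neqAle eq_sym D0 measure_ge0/=.
  exact: Doo.
move=> /cvgrPdist_lt /(_ _ I0)[n _ /(_ n (leqnn n))] /=.
rewrite ltr_norml => /andP[_]; rewrite ltrBlDr ltrDl => In.
set I := Rintegral _ _ _ in In.
exists (fun x => I^-1 * bump (- a) a n.+1 x), (a - n.+1%:R^-1); split.
- by apply: smooth1M; [exact: smooth1_cst|exact: smooth1_bump].
- by rewrite gtrBl invr_gt0 ltr0n.
- by move=> x xa; move: xa; rewrite opprD opprK => /bump_eq0 ->; rewrite mulr0.
- rewrite RintegralZl//; first by rewrite mulVf// gt_eqF.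
  exact: (L1_le mD (bm n) (fun x _ => bb n x) i1).
Qed.

Section mean_zero.
Variables (psi : R -> R) (c : R).
Hypothesis spsi : smooth1 psi.
Hypothesis ca : c < a.
Hypothesis psi0 : forall x, ~~ (- c <= x <= c) -> psi x = 0.
Hypothesis psi1 : \int[gauss1 R]_(x in D) psi x = 1.

Definition mean w := \int[gauss1 R]_(x in D) w x.

Definition centered w : R -> R := fun x => w x - mean w * psi x.

(** The functions w for which w, once corrected to mean zero, is of the form
    - phi' / rho with phi a test function. *)
Definition mean_testable : set (line -> R) := [set w |
  [/\ measurable_fun setT (w : line -> R), exists M, forall x, `|w x| <= M &
   exists2 phi, test1 phi & forall x, - derive1 phi x = rho x * centered w x]].

Lemma mean_testable_L2 w : mean_testable w -> L2_on (gauss1 R) D w.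
Proof.
move=> [mw [M wM] _]; apply: (@L2_bounded _ _ _ _ _ mD _ M) => //.
exact: measurable_funTS.
Qed.

Lemma L2_L1 w : L2_on (gauss1 R) D w -> L1 (gauss1 R) D w.
Proof.
move=> Lw; have := L2_L1M mD Lw (L2_cst mD 1 Doo).
by under eq_fun do rewrite mulr1.
Qed.

Lemma test1_0 : test1 (fun=> 0).
Proof.
by split; [exact: smooth1_cst|exists set0; split => //; exact: compact0].
Qed.

Lemma mean_testable0 : mean_testable (fun=> 0).
Proof.
split; [exact: measurable_cst|by exists 0 => x; rewrite normr0|].
exists (fun=> 0); first exact: test1_0.
move=> x; rewrite derive1_cst /centered /mean Rintegral_cst// !mul0r subrr.
by rewrite mulr0 oppr0.
Qed.

Lemma mean_testable_lin (k : R) w w' : mean_testable w -> mean_testable w' ->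
  mean_testable (fun x => w x + k * w' x).
Proof.
move=> Vw Vw'; have Lw := mean_testable_L2 Vw; have Lw' := mean_testable_L2 Vw'.
have [mw [M wM] [phi [sphi [K [cK KO phi0]]] phiw]] := Vw.
have [mw' [M' wM'] [phi' [sphi' [K' [cK' KO' phi'0]]] phiw']] := Vw'.
split.
- by apply: measurable_funD => //; exact: measurable_funM.
- exists (M + `|k| * M') => z; rewrite (le_trans (ler_normD _ _))// lerD//.
  by rewrite normrM ler_wpM2l.
have d x : is_derive x (1 : R) (fun x => phi x + k * phi' x)
    (derive1 phi x + k * derive1 phi' x).
  exact: is_derive_add (smooth1_is_derive x sphi)
    (is_derive_scale k (smooth1_is_derive x sphi')).
exists (fun x => phi x + k * phi' x).
  split.
    have s2 := smooth1M (@smooth1_cst R k) sphi'.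
    by have := smooth1D sphi s2.
  exists (K `|` K'); split; [exact: compactU|by move=> z [/KO|/KO']|].
  by move=> z /not_orP[/phi0 -> /phi'0 ->]; rewrite mulr0 addr0.
move=> x; rewrite (is_derive_derive1 d) opprD phiw -mulrN phiw' /centered.
rewrite (_ : mean (fun x => w x + k * w' x) = mean w + k * mean w'); last first.
  rewrite /mean RintegralD// ?RintegralZl//; try exact: L2_L1.
  by apply: L1Z => //; exact: L2_L1.
by ring.
Qed.

(** The primitive of a compactly supported function of total integral zero is
    compactly supported. *)
Lemma mean_testable_bump (s t : R) n : `]s, t[ `<=` `]- a, a[ ->
  mean_testable (bump s t n.+1).
Proof.
move=> stO; set b := bump s t n.+1.
set s1 := s + n.+1%:R^-1; set t1 := t - n.+1%:R^-1.
have n0 : 0 < n.+1%:R^-1 :> R by rewrite invr_gt0 ltr0n.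
have ss1 : s < s1 by rewrite ltrDl.
have tt1 : t1 < t by rewrite gtrBl.
have [st1|/negP st1] := boolP (s1 <= t1); last first.
  rewrite (_ : b = fun=> 0); first exact: mean_testable0.
  apply/funext => x; rewrite /b bump_eq0//.
  apply/negP => /andP[? ?]; apply: st1; exact: le_trans (_ : _ <= x) _.
have sb : smooth1 b by exact: smooth1_bump.
have mb : measurable_fun setT (b : line -> R).
  exact: continuous_measurable_fun (smooth1_continuous sb).
have b1 x : `|b x| <= 1.
  by have /andP[b0 b1] := bump_itv s t n.+1 x; rewrite ger0_norm.
split => //; first by exists 1.
have Lb : L2_on (gauss1 R) D b.
  by apply: (@L2_bounded _ _ _ _ _ mD _ 1) => //; exact: measurable_funTS.
have s1a : - a < s1 < a.
  by have := stO s1; rewrite /= !in_itv/=; apply; apply/andP; split; lra.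
have t1a : - a < t1 < a.
  by have := stO t1; rewrite /= !in_itv/=; apply; apply/andP; split; lra.
pose m := Num.max c (Num.max (- s1) t1).
have mc : c <= m by rewrite le_max lexx.
have ms1 : - s1 <= m by rewrite !le_max lexx orbT.
have mt1 : t1 <= m by rewrite !le_max lexx !orbT.
have ma : m < a by rewrite !gt_max ca; lra.
pose h (x : R) : R := rho x * (b x + - mean b * psi x).
have sh : smooth1 h.
  have s2 := smooth1D sb (smooth1M (@smooth1_cst R (- mean b)) spsi).
  by have := smooth1M (@smooth1_rho R) s2.
have hE x : h x = rho x * centered b x by rewrite /h mulNr.
have h0 x : ~~ (- m <= x <= m) -> h x = 0.
  move=> xm; rewrite /h psi0 ?mulr0 ?addr0; last first.
    by apply: contra xm => /andP[? ?]; apply/andP; split; lra.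
  rewrite /b bump_eq0 ?mulr0//; apply: contra xm => /andP[].
  by rewrite -/s1 -/t1 => ? ?; apply/andP; split; lra.
have [H [dH H0 H1]] := compact_support_primitive (smooth1_continuous sh) h0.
have ih : \int[leb1 R]_x h x = 0.
  have mcb : measurable_fun D (centered b).
    apply: measurable_funTS; apply: measurable_funB => //.
    apply: measurable_funM => //.
    exact: continuous_measurable_fun (smooth1_continuous spsi).
  transitivity (\int[leb1 R]_(x in D) (centered b x * rho x)).
    rewrite [RHS]Rintegral_mkcond; apply: eq_Rintegral => x _; rewrite /patch.
    case: ifPn => [_|]; first by rewrite hE mulrC.
    rewrite notin_setE /D/= in_itv/= => /negP xa; rewrite h0//.
    by apply: contra xa => /andP[? ?]; apply/andP; split; lra.
  rewrite -(@Rintegral_density _ line R (gauss1 R) (leb1 R) (@rho R) (@rho_gt0 R)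
    (@gauss1_density R) D _ mD mcb).
  have Lpsi : L2_on (gauss1 R) D psi.
    have cpsi := smooth1_continuous spsi.
    have pc x : ~ `[- c, c]%classic x -> psi x = 0.
      by move=> nx; apply: psi0; apply/negP => xc; apply: nx; rewrite /= in_itv.
    have [M pM] := compact_support_bounded (@segment_compact _ (- c) c) cpsi pc.
    apply: (@L2_bounded _ _ _ _ _ mD _ M) => //.
    by apply: measurable_funTS; exact: continuous_measurable_fun.
  rewrite /centered RintegralB//; [|exact: L2_L1|by apply: L1Z => //; exact: L2_L1].
  by rewrite RintegralZl ?psi1 ?mulr1 ?subrr//; exact: L2_L1.
have sH : smooth1 H := smooth1_primitive dH sh.
exists (fun x => -1 * H x).
  split; first by have := smooth1M (@smooth1_cst R (-1)) sH.
  exists `[- m, m]%classic; split.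
  - exact: segment_compact.
  - by move=> x; rewrite /= !in_itv/= => /andP[? ?]; apply/andP; split; lra.
  - move=> x nx; have : ~~ (- m <= x <= m).
      by apply/negP => xm; apply: nx; rewrite /= in_itv.
    rewrite negb_and -!ltNge => /orP[/H0 ->|/H1 ->]; first by rewrite mulr0.
    by rewrite ih mulr0.
move=> x; have d y : is_derive y (1 : R) (fun x => -1 * H x) (-1 * h y).
  exact: is_derive_scale.
by rewrite (is_derive_derive1 d) mulN1r opprK hE.
Qed.

Lemma mean_testable_itv (s t : R) : `]s, t[ `<=` `]- a, a[ ->
  approximable (gauss1 R) D mean_testable (\1_(`]s, t[%classic : set line) : line -> R).
Proof.
move=> stO.
apply: (@approximable_cvg _ line R (gauss1 R) D mD mean_testable mean_testable_L2
  (fun n => bump s t n.+1) _ (fun=> 1)).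
- move=> n; apply: approximable_sub; [exact: mD|exact: mean_testable_L2|].
  exact: mean_testable_bump.
- by apply: measurable_funTS; apply: measurable_indic; exact: measurable_itv.
- by move=> x _; exact: bump_cvgS.
- by move=> n x _; have /andP[b0 b1] := bump_itv s t n.+1 x; rewrite ger0_norm.
- exact: (@L2_cst _ line R (gauss1 R) D mD 1 Doo).
Qed.

Lemma mean_testable_dense u : L2_on (gauss1 R) D u ->
  approximable (gauss1 R) D mean_testable u.
Proof.
apply: (@L2_approximable _ line R (gauss1 R) D mD mean_testable
  mean_testable_L2 mean_testable_lin mean_testable0 Doo
  [set A | (exists s t, A = `]s, t[%classic) /\ A `<=` D]
  [set A | exists s t, A = `]s, t[%classic] (fun=> D)).
- move=> _ _ [[s [t ->]] stD] [[s' [t' ->]] stD']; split; last by move=> x [/stD].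
  by rewrite itvoo_setI; do 2 eexists.
- by move=> _ [[s [t ->]] /mean_testable_itv].
- by move=> i; split => //; exists (- a), a.
- by rewrite bigcup_const//; exists 0%N.
- move=> _ _ [s [t ->]] [s' [t' ->]].
  by rewrite itvoo_setI; do 2 eexists.
- exact: RGenOpens.measurableE.
- move=> _ _ [s [t ->]] [[s' [t' ->]] stD']; split; last by move=> x [_ /stD'].
  by rewrite itvoo_setI; do 2 eexists.
Qed.

(** If u has mean zero and w is close to u, then the mean of w is small, so the
    corrected w is close to u as well; this is what the constant 2 (1 + C)
    accounts for. *)
Lemma mean_zero_poincare_bump u u' : L2_on (gauss1 R) D u -> L2_on (gauss1 R) D u' ->
  weak_deriv D u u' -> \int[gauss1 R]_(x in D) u x = 0 ->
  l * \int[gauss1 R]_(x in D) (u x ^+ 2) <= \int[gauss1 R]_(x in D) (u' x ^+ 2).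
Proof.
move=> Lu Lu' wu u0.
have cpsi := smooth1_continuous spsi.
have Lpsi : L2_on (gauss1 R) D psi.
  have pc x : ~ `[- c, c]%classic x -> psi x = 0.
    by move=> nx; apply: psi0; apply/negP => xc; apply: nx; rewrite /= in_itv.
  have [M pM] := compact_support_bounded (@segment_compact _ (- c) c) cpsi pc.
  apply: (@L2_bounded _ _ _ _ _ mD _ M) => //.
  by apply: measurable_funTS; exact: continuous_measurable_fun.
set C := \int[gauss1 R]_(x in D) (psi x ^+ 2).
have C0 : 0 <= C by apply: Rintegral_ge0 => x _; exact: sqr_ge0.
apply: (@poincare_dense _ line R (gauss1 R) D mD) => // e e0.
have d0 : 0 < e / (2 * (1 + C)) by rewrite divr_gt0// mulr_gt0//; lra.
have [_ /(_ _ d0)[w Vw uw]] := mean_testable_dense Lu.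
have Lw := mean_testable_L2 Vw.
have [_ _ [phi tphi phiw]] := Vw.
have [K [cK KO phi0]] := tphi.2.
have LF := test1_L2 cK (smooth1_continuous tphi.1) phi0.
have oE : (fun x => - derive1 phi x / rho x) = centered w.
  by apply/funext => z; rewrite phiw mulrC mulKf// rho_neq0.
have Luw := L2B mD Lu Lw.
have LW : L2_on (gauss1 R) D (centered w) by apply: L2B => //; exact: L2Z.
exists (centered w), (fun x => phi x / rho x); split => //.
- by rewrite -oE; exact: test1_weak.
- by rewrite -oE; exact: test1_hardy.
have mw : mean w ^+ 2 <= \int[gauss1 R]_(x in D) ((u x - w x) ^+ 2).
  apply: le_trans (sqr_Rintegral_le Luw).
  by rewrite RintegralB//; [rewrite u0 sub0r sqrrN|exact: L2_L1|exact: L2_L1].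
move: uw; rewrite ltr_pdivlMr; last by lra.
apply: le_lt_trans.
apply: (@le_trans _ _ (2 * \int[gauss1 R]_(x in D) ((u x - w x) ^+ 2) + 2 * mean w ^+ 2 * C)).
  rewrite -!RintegralZl//; [|exact: Lpsi.2|exact: Luw.2].
  rewrite -RintegralD//; [|exact: L1Z Luw.2|exact: L1Z Lpsi.2].
  apply: le_Rintegral => //.
  - exact: (L2B mD Lu LW).2.
  - by apply: L1D => //; [exact: L1Z Luw.2|exact: L1Z Lpsi.2].
  - move=> x _; rewrite /centered.
    have := sqr_ge0 ((u x - w x) - mean w * psi x); rewrite !expr2; lra.
have := ler_wpM2r C0 mw; lra.
Qed.

End mean_zero.

(** An interval without bump of mass 1 is null, and the left-hand side is 0. *)
Lemma mean_zero_poincare u u' : L2_on (gauss1 R) D u -> L2_on (gauss1 R) D u' ->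
  weak_deriv D u u' -> \int[gauss1 R]_(x in D) u x = 0 ->
  l * \int[gauss1 R]_(x in D) (u x ^+ 2) <= \int[gauss1 R]_(x in D) (u' x ^+ 2).
Proof.
move=> Lu Lu' wu u0; have [D0|D0] := eqVneq (gauss1 R D) 0%E.
  rewrite [X in l * X](_ : _ = 0) ?mulr0.
    by apply: Rintegral_ge0 => x _; exact: sqr_ge0.
  by rewrite /Rintegral null_set_integral//; exact: (measurable_int _ Lu.2).
have [psi [c [spsi ca psi0 psi1]]] := unit_mass_bump D0.
exact: (mean_zero_poincare_bump spsi ca psi0 psi1 Lu Lu' wu u0).
Qed.

End mean_zero_poincare.

(** * Weak derivatives of smooth functions *)

Section integration_by_parts.
Variable R : realType.
Notation line := (measurableTypeR R).
Notation plane := (measurableTypeR R * measurableTypeR R)%type.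

Lemma integral_derive_compact (f f' : R -> R) (c : R) :
  (forall x, is_derive x (1 : R) f (f' x)) -> continuous f' ->
  (forall x, ~~ (- c <= x <= c) -> f x = 0) ->
  (forall x, ~~ (- c <= x <= c) -> f' x = 0) ->
  (\int[leb1 R]_x (f' x)%:E = 0)%E.
Proof.
move=> df cf' f0 f'0.
have [H [dH H0 H1]] := compact_support_primitive cf' f'0.
pose M := `|c| + 1.
have cM : c < M by rewrite (le_lt_trans (ler_norm _))// ltrDl.
have nM : - M < - c by rewrite ltrN2.
have dHf x : is_derive x (1 : R) (fun x => H x + - f x) 0.
  by apply: is_derive_eq (is_derive_add (dH x) (is_derive_opp (df x))) _; rewrite subrr.
have fM : f M = 0 by apply: f0; apply/negP => /andP[_]; rewrite leNgt cM.
have fNM : f (- M) = 0 by apply: f0; apply/negP => /andP[+ _]; rewrite leNgt nM.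
have := is_derive_0_is_cst M (- M) dHf.
rewrite fM fNM (H0 _ nM) (H1 _ cM) !oppr0 !addr0 => I0.
have ig := integrable1_compact cf' f'0.
by rewrite -[LHS]fineK ?integrable_fin_num//; congr EFin.
Qed.

Lemma integrable2_compact (g : R * R -> R) (K : set (R * R)) : compact K ->
  continuous g -> (forall z, ~ K z -> g z = 0) ->
  (leb2 R).-integrable [set: plane] (fun z => (g z)%:E).
Proof.
move=> cK cg g0.
have Lg := test_L2 (@openT (R * R)%type) cK cg g0.
have i1 : (gauss2 R).-integrable [set: plane] (fun z => (g z / rho2 z)%:E).
  have := L2_L1M measurableT Lg (L2_cst measurableT 1 (gauss2_lty measurableT)).
  by rewrite /L1; under eq_fun do rewrite mulr1.
have := (@integrable_density _ plane R (gauss2 R) (leb2 R) (@rho2 R) (@rho2_gt0 R)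
  (@measurable_rho2 R) (@gauss2_density R) setT _ measurableT Lg.1).1 i1.
by under eq_fun do rewrite divfK ?rho2_neq0//.
Qed.

Lemma continuous_slice_y (x : R) : continuous (fun s : R => (x, s)).
Proof.
move=> y A [[P Q] [/= xP yQ] PQ]; have : \forall s \near y, Q s by [].
by apply: filterS => s Ps; apply: PQ; split => //=; exact: nbhs_singleton.
Qed.

Lemma supported_partial_y (phi : R * R -> R) (K : set (R * R)) : compact K ->
  (forall z, ~ K z -> phi z = 0) -> forall z, ~ K z -> partial_y phi z = 0.
Proof.
move=> cK phi0 [x y] nK; rewrite /partial_y derive1E/=.
have oK : open (~` K).
  by apply: closed_openC; apply: compact_closed => //; exact: norm_hausdorff.
have [_ ->] : is_derive y (1 : R) (fun s => phi (x, s)) 0 => //.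
apply: (@near_eq_is_derive _ _ _ (cst 0)) => //.
have nb : nbhs (x, y) (~` K) by exact: open_nbhs_nbhs.
have : \forall s \near y, (~` K) (x, s) by exact: (continuous_slice_y nb).
by apply: filterS => s /phi0 ->.
Qed.

(** Fubini, with the vanishing integral of the derivative on each line. *)
Lemma integral_partial_x (F g : R * R -> R) (K : set (R * R)) : compact K ->
  continuous g -> (forall z, ~ K z -> F z = 0) -> (forall z, ~ K z -> g z = 0) ->
  (forall x y, is_derive x (1 : R) (fun s => F (s, y)) (g (x, y))) ->
  \int[leb2 R]_z g z = 0.
Proof.
move=> cK cg F0 g0 dF; have [c hc] := compact_coordinate_bound cK (@continuous_fst R).
have ig := integrable2_compact cK cg g0; rewrite /Rintegral.
rewrite -(@integral21_prod_meas1 _ _ line line R lebesgue_measure lebesgue_measure _ ig).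
rewrite integral0_eq// => y _; rewrite /fubini_G.
apply: (@integral_derive_compact (fun x => F (x, y)) (fun x => g (x, y)) c) => //.
- move=> x; apply: continuous_comp; first exact: continuous_slice.
  exact: cg.
- by move=> x /negP xc; apply: F0 => /hc.
- by move=> x /negP xc; apply: g0 => /hc.
Qed.

Lemma integral_partial_y (F g : R * R -> R) (K : set (R * R)) : compact K ->
  continuous g -> (forall z, ~ K z -> F z = 0) -> (forall z, ~ K z -> g z = 0) ->
  (forall x y, is_derive y (1 : R) (fun s => F (x, s)) (g (x, y))) ->
  \int[leb2 R]_z g z = 0.
Proof.
move=> cK cg F0 g0 dF; have [c hc] := compact_coordinate_bound cK (@continuous_snd R).
have ig := integrable2_compact cK cg g0; rewrite /Rintegral.
rewrite -(@integral12_prod_meas1 _ _ line line R lebesgue_measure lebesgue_measure _ ig).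
rewrite integral0_eq// => x _; rewrite /fubini_F.
apply: (@integral_derive_compact (fun y => F (x, y)) (fun y => g (x, y)) c) => //.
- move=> y; apply: continuous_comp; first exact: continuous_slice_y.
  exact: cg.
- by move=> y /negP yc; apply: F0 => /hc.
- by move=> y /negP yc; apply: g0 => /hc.
Qed.

Lemma Rintegral_supported d (T : measurableType d) (m : {measure set T -> \bar R})
    (D : set T) (g : T -> R) : (forall z, ~ D z -> g z = 0) ->
  \int[m]_(z in D) g z = \int[m]_z g z.
Proof.
move=> g0; rewrite Rintegral_mkcond; apply: eq_Rintegral => z _; rewrite /patch.
by case: ifPn => //; rewrite notin_setE => /g0 ->.
Qed.

Lemma smooth1_weak_deriv (f : R -> R) (D : set R) : smooth1 f ->
  weak_deriv D f (derive1 f).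
Proof.
move=> sf phi sphi [K [cK KD phi0]].
have dphi0 := supported_derive1 cK phi0.
have cid : continuous (fun x : R => x) by move=> x; exact: cvg_id.
have [c hc] := compact_coordinate_bound cK cid.
have K0 (g : R -> R) : (forall x, ~ K x -> g x = 0) ->
    forall x, ~~ (- c <= x <= c) -> g x = 0.
  by move=> g0 x /negP xc; apply: g0 => /hc.
have D0 (g : R -> R) : (forall x, ~ K x -> g x = 0) -> forall x, ~ D x -> g x = 0.
  by move=> g0 x Dx; apply: g0 => /KD.
have [cf cf'] := (smooth1_continuous sf, smooth1_continuous (smooth1_derive sf)).
have [cp cp'] := (smooth1_continuous sphi, smooth1_continuous (smooth1_derive sphi)).
pose g1 x := f x * derive1 phi x; pose g2 x := derive1 f x * phi x.
have g10 x : ~ K x -> g1 x = 0 by rewrite /g1 => /dphi0 ->; rewrite mulr0.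
have g20 x : ~ K x -> g2 x = 0 by rewrite /g2 => /phi0 ->; rewrite mulr0.
have c1 : continuous g1 by move=> x; apply: cvgM; [exact: cf|exact: cp'].
have c2 : continuous g2 by move=> x; apply: cvgM; [exact: cf'|exact: cp].
rewrite (Rintegral_supported (leb1 R) (D0 _ g10)) (Rintegral_supported (leb1 R) (D0 _ g20)).
apply/eqP; rewrite -addr_eq0.
rewrite -RintegralD//; last 2 first.
- exact: (integrable1_compact c1 (K0 _ g10)).
- exact: (integrable1_compact c2 (K0 _ g20)).
rewrite /Rintegral [X in fine X](_ : _ = 0%E)//.
apply: (@integral_derive_compact (fun x => f x * phi x) _ c).
- move=> x; apply: is_derive_eq (is_derive_mul (smooth1_is_derive x sf)
    (smooth1_is_derive x sphi)) _.
  by rewrite addrC.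
- by move=> x; apply: cvgD; [exact: c1|exact: c2].
- by move=> x xc; rewrite (K0 _ phi0) ?mulr0.
- by move=> x xc; rewrite (K0 _ g10)// (K0 _ g20)// addr0.
Qed.

Let continuous_fstM (f : R -> R) (g : R * R -> R) : continuous f -> continuous g ->
  continuous (fun z => f z.1 * g z).
Proof.
move=> cf cg z; apply: cvgM; last exact: cg.
by apply: (@continuous_comp _ _ _ fst f); [exact: continuous_fst|exact: cf].
Qed.

Lemma fst_weak_partial_x (f : R -> R) (D : set (R * R)) : smooth1 f ->
  weak_partial_x D (fun z => f z.1) (fun z => derive1 f z.1).
Proof.
move=> sf phi sphi [K [cK KD phi0]].
have dphi0 := supported_partial_x cK phi0.
have D0 (g : R * R -> R) : (forall x, ~ K x -> g x = 0) -> forall x, ~ D x -> g x = 0.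
  by move=> g0 x Dx; apply: g0 => /KD.
have [cf cf'] := (smooth1_continuous sf, smooth1_continuous (smooth1_derive sf)).
have [cp cp'] := (smooth2_continuous sphi, smooth2_partial_x sphi).
pose g1 z := f z.1 * partial_x phi z; pose g2 z := derive1 f z.1 * phi z.
have g10 x : ~ K x -> g1 x = 0 by rewrite /g1 => /dphi0 ->; rewrite mulr0.
have g20 x : ~ K x -> g2 x = 0 by rewrite /g2 => /phi0 ->; rewrite mulr0.
have c1 : continuous g1 by exact: continuous_fstM.
have c2 : continuous g2 by exact: continuous_fstM.
rewrite (Rintegral_supported (leb2 R) (D0 _ g10)) (Rintegral_supported (leb2 R) (D0 _ g20)).
apply/eqP; rewrite -addr_eq0.
rewrite -RintegralD//; last 2 first.
- exact: (integrable2_compact cK c1 g10).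
- exact: (integrable2_compact cK c2 g20).
apply/eqP; apply: (@integral_partial_x (fun z => f z.1 * phi z) _ K) => //.
- by move=> x; apply: cvgD; [exact: c1|exact: c2].
- by move=> z /phi0 ->; rewrite mulr0.
- by move=> z zK; rewrite g10// g20// addr0.
- move=> x y; apply: is_derive_eq (is_derive_mul (smooth1_is_derive x sf)
    (smooth2_is_derive_x x y sphi)) _.
  by rewrite addrC.
Qed.

Lemma fst_weak_partial_y (f : R -> R) (D : set (R * R)) : smooth1 f ->
  weak_partial_y D (fun z => f z.1) (fun=> 0).
Proof.
move=> sf phi sphi [K [cK KD phi0]].
have dphi0 := supported_partial_y cK phi0.
pose g z := f z.1 * partial_y phi z.
have g0 x : ~ K x -> g x = 0 by rewrite /g => /dphi0 ->; rewrite mulr0.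
rewrite (@Rintegral_supported _ plane (leb2 R) D g); last by move=> z Dz; apply: g0 => /KD.
have -> : \int[leb2 R]_z g z = 0.
  apply: (@integral_partial_y (fun z => f z.1 * phi z) _ K) => //.
  - by apply: continuous_fstM; [exact: smooth1_continuous|exact: smooth2_partial_y].
  - by move=> z /phi0 ->; rewrite mulr0.
  - by move=> x y; exact: (is_derive_scale (f x) (smooth2_is_derive_y x y sphi)).
under eq_Rintegral do rewrite mul0r.
by rewrite /Rintegral integral0 oppr0.
Qed.

End integration_by_parts.

(** * Weak equations in the limit and Dirichlet cut-offs *)

Section weak_limit.
Context d (T : measurableType d) (R : realType).
Variables (m : {measure set T -> \bar R}) (D : set T).
Hypothesis mD : measurable D.
Hypothesis mDoo : (m D < +oo)%E.

Lemma Rintegral_weak_cvg (u : T -> R) (f_ : nat -> T -> R) (f : T -> R) (C : R) :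
  L2_on m D u -> (forall n, measurable_fun D (f_ n)) -> measurable_fun D f ->
  (forall z, D z -> f_ n z @[n --> \oo] --> f z) ->
  (forall n z, D z -> `|f_ n z| <= C) ->
  \int[m]_(z in D) (u z * f_ n z) @[n --> \oo] --> \int[m]_(z in D) (u z * f z).
Proof.
move=> Lu mf_ mf ff fC.
apply: (@Rintegral_cvg _ _ _ m D mD _ _ (fun z => `|u z| * C)).
- by move=> n; exact: measurable_funM Lu.1 (mf_ n).
- exact: measurable_funM Lu.1 mf.
- by move=> z Dz; apply: cvgMl_tmp; exact: ff.
- by move=> n z Dz; rewrite normrM ler_wpM2l// fC.
- by have := L2_L1M mD (L2_norm mD Lu) (L2_cst mD C mDoo).
Qed.

(** A weak equation may be tested with functions that are only bounded pointwise
    limits of test functions. *)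
Lemma weak_limit (u u' : T -> R) (W_ F_ : nat -> T -> R) (W F : T -> R) (C : R) :
  L2_on m D u -> L2_on m D u' ->
  (forall n, \int[m]_(z in D) (u z * W_ n z) = \int[m]_(z in D) (u' z * F_ n z)) ->
  (forall n, measurable_fun D (W_ n)) -> measurable_fun D W ->
  (forall n, measurable_fun D (F_ n)) -> measurable_fun D F ->
  (forall z, D z -> W_ n z @[n --> \oo] --> W z) ->
  (forall z, D z -> F_ n z @[n --> \oo] --> F z) ->
  (forall n z, D z -> `|W_ n z| <= C) -> (forall n z, D z -> `|F_ n z| <= C) ->
  \int[m]_(z in D) (u z * W z) = \int[m]_(z in D) (u' z * F z).
Proof.
move=> Lu Lu' WF mW_ mW mF_ mF cW cF bW bF.
have h1 := Rintegral_weak_cvg Lu mW_ mW cW bW.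
have h2 := Rintegral_weak_cvg Lu' mF_ mF cF bF.
have e : (fun n => \int[m]_(z in D) (u z * W_ n z)) =
    (fun n => \int[m]_(z in D) (u' z * F_ n z)) by apply/funext.
rewrite e in h1; exact: (cvg_unique (@Rhausdorff R) h1 h2).
Qed.

End weak_limit.

Section cutoff.
Variable R : realType.

Lemma mul_flat (P : {poly R}) (t : R) : t * flat ('X * P) t = flat P t.
Proof.
rewrite /flat; case: ifPn => t0; last by rewrite mulr0.
by rewrite hornerM hornerX !mulrA mulfV ?mul1r// gt_eqF.
Qed.

Lemma flat_add (P Q : {poly R}) (t : R) : flat (P + Q) t = flat P t + flat Q t.
Proof. by rewrite /flat; case: ifPn; rewrite ?addr0// hornerD mulrDl. Qed.

(** With t = n (x - s) - 1, the derivative n t^-2 exp(- 1/t) of the factor of a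
    bump, multiplied by x - s = (t + 1) / n, is (t + 1) t^-2 exp(- 1/t): a bounded
    function of t that tends to 0 at infinity. *)
Definition kappa (t : R) : R := flat ('X * (1 + 'X)) t.

Lemma kappaE t : (t + 1) * flat 'X^2 t = kappa t.
Proof.
rewrite /kappa mulrDr mulr1 flat_add -expr2 mulrDl mul1r; congr (_ + _).
by rewrite expr2 mul_flat.
Qed.

Lemma kappa_bounded : exists C, forall t, `|kappa t| <= C.
Proof.
by have [C _ hC] := @flat_bound R ('X * (1 + 'X)) 0; exists C => t; have := hC t;
  rewrite expr0 mulr1.
Qed.

Lemma kappa_cvg0 (d : R) : 0 < d -> kappa (n%:R * d - 1) @[n --> \oo] --> (0 : R).
Proof.
move=> d0; have [C C0 hC] := @flat_bound R (1 + 'X) 0.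
apply/cvgrPdist_le => e e0.
have C1 : 0 < C + 1 by rewrite ltr_wpDl.
exists (Num.bound ((1 + (C + 1) / e) / d)) => // n /= xn.
have n1 : (C + 1) / e <= n%:R * d - 1.
  rewrite lerBrDl -ler_pdivrMr// ltW// (lt_le_trans (archi_boundP _))//.
    by rewrite divr_ge0 ?addr_ge0 ?divr_ge0// ltW.
  by rewrite ler_nat.
set t := n%:R * d - 1 in n1 *.
have t0 : 0 < t by apply: lt_le_trans n1; rewrite divr_gt0.
rewrite sub0r normrN; have := hC t; rewrite expr0 mulr1 -mul_flat normrM (gtr0_norm t0).
rewrite -/(kappa t) => tk.
have : C <= t * e by rewrite -ler_pdivrMr// (le_trans _ n1)// ler_pM2r ?invr_gt0// lerDl.
move=> Ct; rewrite -(ler_pM2l t0); exact: le_trans tk Ct.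
Qed.

Definition dbump (s t : R) (n : nat) (x : R) : R :=
  n%:R * flat 'X^2 (n%:R * (x - s) - 1) * flat 1 (n%:R * (t - x) - 1) -
  flat 1 (n%:R * (x - s) - 1) * (n%:R * flat 'X^2 (n%:R * (t - x) - 1)).

Lemma is_derive_bump s t n x : is_derive x (1 : R) (bump s t n) (dbump s t n x).
Proof.
have e : 'X^2 * (1 - 1^`()) = 'X^2 :> {poly R} by rewrite derivC subr0 mulr1.
have d1 : is_derive x (1 : R) (fun y => flat 1 (n%:R * (y - s) - 1))
    (n%:R * flat 'X^2 (n%:R * (x - s) - 1)).
  have h := @is_derive_compose _ (flat 1) (fun y => n%:R * y + (- n%:R * s - 1)) x _ _
    (is_derive_flat 1 _) (is_derive_affine n%:R (- n%:R * s - 1) x).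
  rewrite e in h.
  rewrite (_ : (fun y => flat 1 (n%:R * (y - s) - 1)) =
    (fun y => flat 1 (n%:R * y + (- n%:R * s - 1)))); last first.
    by apply/funext => y; congr flat; ring.
  by apply: is_derive_eq h _; congr (_ * flat _ _); ring.
have d2 : is_derive x (1 : R) (fun y => flat 1 (n%:R * (t - y) - 1))
    (- (n%:R * flat 'X^2 (n%:R * (t - x) - 1))).
  have h := @is_derive_compose _ (flat 1) (fun y => - n%:R * y + (n%:R * t - 1)) x _ _
    (is_derive_flat 1 _) (is_derive_affine (- n%:R) (n%:R * t - 1) x).
  rewrite e in h.
  rewrite (_ : (fun y => flat 1 (n%:R * (t - y) - 1)) =
    (fun y => flat 1 (- n%:R * y + (n%:R * t - 1)))); last first.
    by apply/funext => y; congr flat; ring.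
  have ex : - n%:R * x + (n%:R * t - 1) = n%:R * (t - x) - 1 by ring.
  by apply: is_derive_eq h _; rewrite ex mulNr.
by apply: is_derive_eq (is_derive_mul d1 d2) _; rewrite mulrN.
Qed.

Lemma dbumpE s t n x : s < x < t -> dbump s t n x =
  kappa (n%:R * (x - s) - 1) / (x - s) * flat 1 (n%:R * (t - x) - 1) -
  flat 1 (n%:R * (x - s) - 1) * (kappa (n%:R * (t - x) - 1) / (t - x)).
Proof.
move=> /andP[sx xt]; have h (d : R) : 0 < d ->
    kappa (n%:R * d - 1) / d = n%:R * flat 'X^2 (n%:R * d - 1).
  by move=> d0; rewrite -kappaE subrK; field; exact: lt0r_neq0.
by rewrite !h ?subr_gt0.
Qed.

(** f stands for the flux, which satisfies the Dirichlet condition. *)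
Variables (s t L : R) (f : R -> R).
Hypothesis L0 : 0 <= L.
Hypothesis fL : forall x, s < x < t -> `|f x| <= L * (x - s) /\ `|f x| <= L * (t - x).

(** The derivative of the cut-off is of the order of the inverse of the distance
    to the ends, which the linear vanishing of f compensates. *)
Lemma dirichlet_cutoff_bounded : exists C, forall n x, s < x < t ->
  `|f x * dbump s t n x| <= C.
Proof.
have [C kC] := kappa_bounded; exists (L * C + L * C) => n x xst.
have [/andP[sx xt] [f1 f2]] := (xst, fL xst).
have b1 (y : R) : `|flat 1 y| <= 1.
  by have /andP[h0 h1] := flat1_itv y; rewrite ger0_norm.
have main (d y z : R) : 0 < d -> `|f x| <= L * d ->
    `|f x * (kappa y / d * flat 1 z)| <= L * C.
  move=> d0 fd; rewrite mulrA normrM -[leRHS]mulr1 ler_pM// normrM normrM normfV.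
  rewrite (gtr0_norm d0) mulrCA mulrC; apply: ler_pM => //.
  - by rewrite divr_ge0// ltW.
  - by rewrite ler_pdivrMr.
rewrite dbumpE// mulrBr (le_trans (ler_normB _ _))// lerD//.
- by apply: main => //; rewrite subr_gt0.
- by rewrite [flat _ _ * _]mulrC; apply: main => //; rewrite subr_gt0.
Qed.

Lemma dirichlet_cutoff_cvg x : s < x < t ->
  f x * dbump s t n x @[n --> \oo] --> (0 : R).
Proof.
move=> xst; have /andP[sx xt] := xst.
have x1 : 0 < x - s by rewrite subr_gt0.
have x2 : 0 < t - x by rewrite subr_gt0.
have h : f x * (kappa (n%:R * (x - s) - 1) / (x - s) * flat 1 (n%:R * (t - x) - 1) -
    flat 1 (n%:R * (x - s) - 1) * (kappa (n%:R * (t - x) - 1) / (t - x)))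
    @[n --> \oo] --> f x * (0 / (x - s) * 1 - 1 * (0 / (t - x))).
  apply: cvgMl_tmp; apply: cvgB; apply: cvgM; try exact: flat1_cvg;
    by apply: cvgMr_tmp; exact: kappa_cvg0.
move: h; rewrite !mul0r mulr0 subrr mulr0; under eq_fun do rewrite -dbumpE//.
by [].
Qed.

End cutoff.

(** * The ground state as a Neumann eigenfunction *)

Section ground_state_functions.
Variables (R : realType) (a l : R).
Hypothesis a0 : 0 < a.
Hypothesis l0 : 0 < l.
Hypothesis s_gt0 : forall x, - a < x < a -> 0 < herm' l x.
Hypothesis sa : herm' l a = 0.
Hypothesis sNa : herm' l (- a) = 0.
Notation line := (measurableTypeR R).
Notation plane := (measurableTypeR R * measurableTypeR R)%type.
Let l0' := ltW l0.

Lemma smooth1_herm : smooth1 (herm l) /\ smooth1 (herm' l).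
Proof.
have h n : nsmooth n (herm l) /\ nsmooth n (herm' l).
  elim: n => [//|n [IH IH']]; split.
    by exists (herm' l); split => // x; exact: is_derive_herm.
  exists (fun x => x * herm' l x + - l * herm l x); split.
    by move=> x; rewrite mulNr; exact: is_derive_herm'.
  have nid : nsmooth n (fun x : R => x).
    by move: n {IH IH'}; apply/smooth1P; exact: smooth1_id.
  exact: nsmoothD (nsmoothM nid IH') (nsmoothM (nsmooth_cst n (- l)) IH).
by split; apply/smooth1P => n; have [] := h n.
Qed.

Let cv : continuous (herm l). Proof. exact: smooth1_continuous smooth1_herm.1. Qed.
Let cs : continuous (herm' l). Proof. exact: smooth1_continuous smooth1_herm.2. Qed.

Lemma herm_linear_bound : exists2 L : R, 0 <= L &
  forall x, - a < x < a -> `|herm' l x| <= L * (x - - a) /\ `|herm' l x| <= L * (a - x).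
Proof.
pose s' x := x * herm' l x - l * herm l x.
have cs' : continuous s'.
  move=> x; apply: cvgB; first by apply: cvgM; [exact: cvg_id|exact: cs].
  by apply: cvgMl_tmp; exact: cv.
have cns' : {within `[- a, a], continuous (fun x => `|s' x|)}.
  by apply: continuous_subspaceT => x; apply: cvg_norm; exact: cs'.
have aa : - a <= a by rewrite ge0_cp//; exact: ltW.
have [c _ cmax] := EVT_max aa cns'.
have css x y : {within `[x, y], continuous (herm' l)}.
  by apply: continuous_subspaceT; exact: cs.
exists `|s' c| => // x /andP[xa ax].
have bnd y : y \in `[- a, a] -> `|s' y| <= `|s' c| by exact: cmax.
split.
- have [y] := MVT_segment (ltW xa) (fun y _ => is_derive_herm' y l0') (css _ _).
  rewrite in_itv/= => /andP[y1 y2]; rewrite sNa subr0 => ->.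
  rewrite normrM [`|x - _|]ger0_norm ?subr_ge0 ?(ltW xa)//.
  rewrite ler_wpM2r ?subr_ge0 ?(ltW xa)//; apply: bnd; rewrite in_itv/= y1.
  exact: le_trans y2 (ltW ax).
- have [y] := MVT_segment (ltW ax) (fun y _ => is_derive_herm' y l0') (css _ _).
  rewrite in_itv/= => /andP[y1 y2]; rewrite sa sub0r => /eqP; rewrite eqr_oppLR => /eqP ->.
  rewrite normrN normrM [`|a - x|]ger0_norm ?subr_ge0 ?(ltW ax)//.
  rewrite ler_wpM2r ?subr_ge0 ?(ltW ax)//; apply: bnd; rewrite in_itv/= y2 andbT.
  exact: le_trans (ltW xa) y1.
Qed.

Lemma herm_gt0 x : 0 < x < a -> 0 < herm l x.
Proof.
move=> /andP[x0 xa].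
have cvx : {within `[0, x], continuous herm l}.
  by apply: continuous_subspaceT; exact: cv.
have [y] := MVT_segment (ltW x0) (fun y _ => is_derive_herm y l0') cvx.
have -> : herm l 0 = 0 by have := hermN 0 l0'; rewrite oppr0; lra.
rewrite in_itv/= !subr0 => /andP[y1 y2] ->; rewrite mulr_gt0// s_gt0//.
by apply/andP; split; lra.
Qed.

(** The test function v' rho, cut off near the ends of the interval. *)
Definition flux (n : nat) (x : R) : R := herm' l x * rho x * bump (- a) a n.+1 x.

Lemma smooth1_flux n : smooth1 (flux n).
Proof.
have h := smooth1M smooth1_herm.2 (@smooth1_rho R).
by have := smooth1M h (@smooth1_bump R (- a) a n.+1).
Qed.

Lemma is_derive_flux n x : is_derive x (1 : R) (flux n)
  (- rho x * (l * herm l x * bump (- a) a n.+1 x - herm' l x * dbump (- a) a n.+1 x)).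
Proof.
have h := is_derive_mul (is_derive_mul (is_derive_herm' x l0') (is_derive_rho x))
  (is_derive_bump (- a) a n.+1 x).
by apply: is_derive_eq h _; ring.
Qed.

(** [flux] and minus its derivative, divided by the density. *)
Definition fluxF (n : nat) (x : R) := herm' l x * bump (- a) a n.+1 x.
Definition fluxW (n : nat) (x : R) :=
  l * herm l x * bump (- a) a n.+1 x - herm' l x * dbump (- a) a n.+1 x.

Lemma flux_supported n x : ~ `[- (a - n.+1%:R^-1), a - n.+1%:R^-1]%classic x -> flux n x = 0.
Proof.
move=> nx; rewrite /flux bump_eq0 ?mulr0//; apply/negP => xI; apply: nx.
by rewrite /= in_itv/= opprD opprK.
Qed.

Lemma test1_flux n : test1 a (flux n).
Proof.
have n0 : 0 < n.+1%:R^-1 :> R by rewrite invr_gt0 ltr0n.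
split; first exact: smooth1_flux.
exists (`[- (a - n.+1%:R^-1), a - n.+1%:R^-1]%classic); split.
- exact: segment_compact.
- move=> x /=; rewrite !in_itv/= => /andP[x1 x2]; apply/andP; split.
    by apply: lt_le_trans x1; rewrite opprD opprK ltrDl.
  by apply: le_lt_trans x2 _; rewrite gtrBl.
- exact: flux_supported.
Qed.

Lemma flux_limits : exists C : R, forall x, - a < x < a ->
  [/\ forall n, `|fluxF n x| <= C, forall n, `|fluxW n x| <= C,
    fluxF n x @[n --> \oo] --> herm' l x &
    fluxW n x @[n --> \oo] --> l * herm l x].
Proof.
have [L L0 sL] := herm_linear_bound.
have [C hC] := dirichlet_cutoff_bounded sL.
have aa : - a <= a by rewrite ge0_cp//; exact: ltW.
have cvn : {within `[- a, a], continuous (fun x => `|herm l x|)}.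
  by apply: continuous_subspaceT => x; apply: cvg_norm; exact: cv.
have csn : {within `[- a, a], continuous (fun x => `|herm' l x|)}.
  by apply: continuous_subspaceT => x; apply: cvg_norm; exact: cs.
have [c1 _ c1max] := EVT_max aa cvn.
have [c2 _ c2max] := EVT_max aa csn.
have C0 : 0 <= C by apply: le_trans (hC 0%N 0 _) => //; rewrite oppr_lt0 a0.
exists (`|herm' l c2| + (l * `|herm l c1| + C)) => x xa.
have xI : x \in `[- a, a] by rewrite in_itv/=; case/andP: xa => *; apply/andP; split; exact: ltW.
have bb n : `|bump (- a) a n.+1 x| <= 1.
  by have /andP[b0 b1] := bump_itv (- a) a n.+1 x; rewrite ger0_norm.
have vC : `|herm l x| <= `|herm l c1| by exact: c1max.
have sC : `|herm' l x| <= `|herm' l c2| by exact: c2max.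
have bc : bump (- a) a n.+1 x @[n --> \oo] --> (1 : R).
  by have := @bump_cvgS R (- a) a x; rewrite indicE mem_set.
split.
- move=> n; rewrite /fluxF normrM (le_trans (_ : _ <= `|herm' l x| * 1))//.
    by rewrite ler_wpM2l.
  by rewrite mulr1 (le_trans sC)// lerDl addr_ge0// mulr_ge0.
- move=> n; rewrite /fluxW (le_trans (ler_normB _ _))//.
  rewrite (le_trans (_ : _ <= l * `|herm l c1| + C))//; last by rewrite lerDr.
  rewrite lerD//; last exact: hC.
  rewrite (normrM (l * _)) (normrM l) (gtr0_norm l0) -mulrA ler_pM2l// (le_trans _ vC)//.
  by apply: ler_piMr => //; exact: bb.
- have h : herm' l x * bump (- a) a n.+1 x @[n --> \oo] --> herm' l x * 1.
    exact: cvgMl_tmp.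
  by rewrite mulr1 in h; exact: h.
- have h1 : l * herm l x * bump (- a) a n.+1 x @[n --> \oo] --> l * herm l x * 1.
    exact: cvgMl_tmp.
  have h2 : herm' l x * dbump (- a) a n.+1 x @[n --> \oo] --> (0 : R).
    rewrite (cvg_shiftS (fun n => herm' l x * dbump (- a) a n x)).
    exact: dirichlet_cutoff_cvg xa.
  have h := cvgB h1 h2.
  by rewrite mulr1 subr0 in h; exact: h.
Qed.

Let D : set line := `]- a, a[%classic.
Let mD : measurable D. Proof. exact: measurable_itv. Qed.
Let Doo : (gauss1 R D < +oo)%E. Proof. exact: gauss1_lty. Qed.

Lemma continuous_L2 (f : R -> R) : continuous f -> L2_on (gauss1 R) D f.
Proof.
move=> cf; have aa : - a <= a by rewrite ge0_cp//; exact: ltW.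
have cn : {within `[- a, a], continuous (fun x => `|f x|)}.
  by apply: continuous_subspaceT => x; apply: cvg_norm; exact: cf.
have [c _ cmax] := EVT_max aa cn.
apply: (@L2_bounded _ _ _ _ _ mD _ `|f c|) => //.
  by apply: measurable_funTS; exact: continuous_measurable_fun.
move=> x; rewrite /D/= in_itv/= => /andP[x1 x2]; apply: cmax.
by rewrite in_itv/=; apply/andP; split; exact: ltW.
Qed.

(** Test the weak derivative of u with [flux n] and let n tend to infinity. *)
Lemma herm_weak_equation (u u' : R -> R) : H1_1 D u u' ->
  \int[gauss1 R]_(x in D) (herm' l x * u' x) =
  l * \int[gauss1 R]_(x in D) (herm l x * u x).
Proof.
move=> [Lu Lu' wu]; have [C hC] := flux_limits.
have Lv := continuous_L2 cv; have Ls := continuous_L2 cs.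
have DE x : D x -> - a < x < a by rewrite /D/= in_itv.
have WE n : (fun x => - derive1 (flux n) x / rho x) = fluxW n.
  apply/funext => x; rewrite (is_derive_derive1 (is_derive_flux n)) /fluxW.
  by field; exact: rho_neq0.
have FE n : (fun x => flux n x / rho x) = fluxF n.
  by apply/funext => x; rewrite /flux /fluxF; field; exact: rho_neq0.
have LFW n := test1_L2 a (@segment_compact _ _ _) (smooth1_continuous (@smooth1_flux n))
   (@flux_supported n).
have LW n : L2_on (gauss1 R) D (fluxW n).
  rewrite -WE; have := L2Z mD (-1) (test1_L2 a (@segment_compact _ _ _)
    (smooth1_continuous (smooth1_derive (@smooth1_flux n)))
    (supported_derive1 (@segment_compact _ _ _) (@flux_supported n))).
  by under eq_fun do rewrite mulN1r -mulNr.
have h := @weak_limit _ line R (gauss1 R) D mD Doo u u' fluxW fluxF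
  (fun x => l * herm l x) (herm' l) C Lu Lu'.
transitivity (\int[gauss1 R]_(x in D) (u' x * herm' l x)).
  by apply: eq_Rintegral => x _; rewrite mulrC.
rewrite -h.
- rewrite -RintegralZl//; last exact: (L2_L1M mD Lv Lu).
  by apply: eq_Rintegral => x _; ring.
- by move=> n; rewrite -WE -FE; apply: test1_weak => //; exact: test1_flux.
- by move=> n; exact: (LW n).1.
- exact: (L2Z mD l Lv).1.
- by move=> n; rewrite -FE; exact: (LFW n).1.
- exact: Ls.1.
- by move=> x /DE /hC[].
- by move=> x /DE /hC[].
- by move=> n x /DE /hC[].
- by move=> n x /DE /hC[].
Qed.

End ground_state_functions.

Section nonvanishing.
Variable R : realType.
Notation line := (measurableTypeR R).
Notation plane := (measurableTypeR R * measurableTypeR R)%type.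

Lemma not_ae_eq0 d (T : measurableType d) (m : {measure set T -> \bar R})
    (D E : set T) (f : T -> R) : m E != 0%E -> measurable E -> E `<=` D ->
  (forall z, E z -> f z != 0) -> ~ {ae m, forall z, D z -> f z = 0}.
Proof.
move=> mE0 mE ED fE [N [mN N0 sN]]; move/eqP: mE0; apply.
apply: (subset_measure0 mE mN) => // z Ez; apply: sN => /= h.
by have := fE z Ez; rewrite (h (ED _ Ez)) eqxx.
Qed.

(** The Lebesgue measure of a set is the Gaussian integral of 1 / rho on it. *)
Lemma gauss1_itv_neq0 (s t : R) : s < t -> gauss1 R `]s, t[%classic != 0%E.
Proof.
move=> st; apply/eqP => g0.
have mI : measurable (`]s, t[%classic : set line) by exact: measurable_itv.
have mrV : measurable_fun (`]s, t[%classic : set line) (fun x : R => ((rho x)^-1)%:E).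
  apply/measurable_EFinP; apply: measurable_funTS.
  exact: continuous_measurable_fun (@continuous_rhoV R).
have r0 x : (0 <= ((rho (x : R))^-1)%:E)%E by rewrite lee_fin invr_ge0 ltW// rho_gt0.
have := gauss1_density mI mrV r0; rewrite null_set_integral//.
under eq_integral do rewrite -EFinM mulVf ?rho_neq0//.
rewrite integral_cst// mul1e (_ : leb1 R _ = (t%:E - s%:E)%E).
  by move=> /esym/eqP; rewrite -EFinB eqe subr_eq0 gt_eqF.
by have := @lebesgue_measure_itv R `]s, t[; rewrite /= lte_fin st.
Qed.

Lemma gauss2_rect_neq0 (s t s' t' : R) : s < t -> s' < t' ->
  gauss2 R (rect s t s' t') != 0%E.
Proof.
move=> st st'.
have -> : gauss2 R (rect s t s' t') =
    (gauss1 R `]s, t[%classic * gauss1 R `]s', t'[%classic)%E.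
  exact: (@product_measure1E _ _ line line R (normal_prob 0 1) (normal_prob 0 1)
    _ _ (measurable_itv _) (measurable_itv _)).
by rewrite mule_neq0// gauss1_itv_neq0.
Qed.

End nonvanishing.

Section ground_state_eigenvalue.
Variables (R : realType) (a l : R).
Hypothesis a0 : 0 < a.
Hypothesis l0 : 0 < l.
Hypothesis s_gt0 : forall x, - a < x < a -> 0 < herm' l x.
Hypothesis sa : herm' l a = 0.
Hypothesis sNa : herm' l (- a) = 0.
Notation line := (measurableTypeR R).
Notation plane := (measurableTypeR R * measurableTypeR R)%type.
Let l0' := ltW l0.
Let shm : smooth1 (herm l). Proof. by have [] := smooth1_herm l0. Qed.
Let shm' : smooth1 (herm' l). Proof. by have [] := smooth1_herm l0. Qed.
Let dherm : derive1 (herm l) = herm' l.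
Proof. exact: (is_derive_derive1 (fun y => is_derive_herm y l0')). Qed.

Lemma herm_eigenvalue1 :
  neumann_eigenvalue1 (`]- a, a[%classic : set R) l.
Proof.
exists (herm l), (herm' l); split; last exact: herm_weak_equation.
- split; [exact: (continuous_L2 a0 (smooth1_continuous shm))|
    exact: (continuous_L2 a0 (smooth1_continuous shm'))|].
  by rewrite -dherm; exact: smooth1_weak_deriv.
- apply: (@not_ae_eq0 _ _ line _ _ (`]0, a[%classic : set R)).
  + exact: gauss1_itv_neq0.
  + exact: measurable_itv.
  + move=> x; rewrite /= !in_itv/= => /andP[x0 ->]; rewrite andbT.
    by apply: lt_trans x0; rewrite oppr_lt0.
  + by move=> x; rewrite /= in_itv/= => xa; rewrite gt_eqF// (herm_gt0 l0 s_gt0).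
Qed.

Variables (Omega : set (R * R)) (b : R).
Hypothesis b0 : 0 < b.
Hypothesis oO : open Omega.
Hypothesis OmegaE : Omega = rect (- a) a (- b) b.

Let mOm := mO oO.
Let Omoo : (gauss2 R Omega < +oo)%E. Proof. exact: gauss2_lty. Qed.

Let Oa z : Omega z -> - a < z.1 < a.
Proof. by rewrite OmegaE => -[]; rewrite /= in_itv. Qed.

Lemma fst_L2 (f : R -> R) : continuous f ->
  L2_on (gauss2 R) Omega (fun z => f z.1).
Proof.
move=> cf; have aa : - a <= a by rewrite ge0_cp//; exact: ltW.
have cn : {within `[- a, a], continuous (fun x => `|f x|)}.
  by apply: continuous_subspaceT => x; apply: cvg_norm; exact: cf.
have [c _ cmax] := EVT_max aa cn.
apply: (@L2_bounded _ _ _ _ _ mOm _ `|f c|) => //.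
  apply: measurable_funTS; apply: continuous_plane_measurable => z.
  by apply: (@continuous_comp _ _ _ fst f); [exact: continuous_fst|exact: cf].
move=> z /Oa /andP[x1 x2]; apply: cmax.
by rewrite in_itv/=; apply/andP; split; exact: ltW.
Qed.

(** As on the interval, with a further cut-off in y; it contributes no derivative
    since only the x-derivative of u is involved. *)
Lemma rectangle_weak_equation (u ux : R * R -> R) : L2_on (gauss2 R) Omega u ->
  L2_on (gauss2 R) Omega ux -> weak_partial_x Omega u ux ->
  \int[gauss2 R]_(z in Omega) (herm' l z.1 * ux z) =
  l * \int[gauss2 R]_(z in Omega) (herm l z.1 * u z).
Proof.
move=> Lu Lux wu; have [C hC] := flux_limits a0 l0 sa sNa.
have Lv := fst_L2 (smooth1_continuous shm); have Ls := fst_L2 (smooth1_continuous shm').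
pose bb n (y : R) : R := bump (- b) b n.+1 y.
pose psi n (y : R) : R := bb n y * rho y.
have spsi n : smooth1 (psi n).
  exact: smooth1M (@smooth1_bump R (- b) b n.+1) (@smooth1_rho R).
pose F n (z : R * R) : R := fluxF a l n z.1 * bb n z.2.
pose W n (z : R * R) : R := fluxW a l n z.1 * bb n z.2.
pose phi n := tensor (flux a l n) (psi n).
have sphi n : smooth2 (phi n) by exact: (smooth2_tensor (@smooth1_flux R a l l0 n) (spsi n)).
pose I n (c : R) : set R := `[- (c - n.+1%:R^-1), c - n.+1%:R^-1]%classic.
pose K n : set (R * R) := I n a `*` I n b.
have cK n : compact (K n) by apply: compact_setX; exact: segment_compact.
have n0 n : 0 < n.+1%:R^-1 :> R by rewrite invr_gt0 ltr0n.
have KO n : K n `<=` Omega.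
  have sub (c : R) : I n c `<=` `]- c, c[%classic.
    rewrite /I => x /=; rewrite !in_itv/= => /andP[x1 x2]; apply/andP; split.
      by apply: lt_le_trans x1; rewrite opprD opprK ltrDl.
    by apply: le_lt_trans x2 _; rewrite gtrBl.
  by rewrite OmegaE => z [/= /sub z1 /sub z2]; split.
have phi0 n z : ~ K n z -> phi n z = 0.
  move=> /not_andP[nz|nz]; rewrite /phi /tensor; first by rewrite flux_supported ?mul0r.
  rewrite /psi /bb bump_eq0 ?mul0r ?mulr0//; apply/negP => zI; apply: nz.
  by rewrite /I /= in_itv/= opprD opprK.
have tphi n : test Omega (phi n).
  by split; [exact: sphi|exists (K n); split; [exact: cK|exact: KO|exact: phi0]].
have WE n : (fun z => - partial_x (phi n) z / rho2 z) = W n.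
  apply/funext => z; rewrite /phi partial_x_tensor; last exact: smooth1_flux.
  rewrite /tensor (is_derive_derive1 (is_derive_flux a l0 n)) /W /fluxW /rho2 /psi.
  by field; rewrite !rho_neq0.
have FE n : (fun z => phi n z / rho2 z) = F n.
  apply/funext => z; rewrite /phi /tensor /flux /F /fluxF /psi /rho2.
  by rewrite -/(bb n z.2); field; rewrite !rho_neq0.
have LF n : L2_on (gauss2 R) Omega (F n).
  rewrite -FE; exact: (test_L2 oO (cK n) (smooth2_continuous (sphi n)) (phi0 n)).
have LW n : L2_on (gauss2 R) Omega (W n).
  rewrite -WE; have := L2Z mOm (-1) (test_L2 oO (cK n) (smooth2_partial_x (sphi n))
    (supported_partial_x (cK n) (phi0 n))).
  by under eq_fun do rewrite mulN1r -mulNr.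
have b1 n y : `|bb n y| <= 1.
  by have /andP[? ?] := bump_itv (- b) b n.+1 y; rewrite ger0_norm.
have bM n (x y : R) : `|x| <= C -> `|x * bb n y| <= C.
  by move=> xC; rewrite normrM (le_trans _ xC)// ler_piMr.
have bc z : Omega z -> bb n z.2 @[n --> \oo] --> (1 : R).
  rewrite OmegaE => -[_ zb]; rewrite -[X in _ --> X](_ : \1_`]- b, b[ z.2 = 1).
    exact: bump_cvgS.
  by rewrite indicE mem_set.
have lim1 (g : nat -> R) (w : R) z : Omega z -> g n @[n --> \oo] --> w ->
    g n * bb n z.2 @[n --> \oo] --> w.
  move=> Oz gw; have h := cvgM gw (bc z Oz); rewrite mulr1 in h; exact: h.
have h := @weak_limit _ plane R (gauss2 R) Omega mOm Omoo u ux W F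
  (fun z => l * herm l z.1) (fun z => herm' l z.1) C Lu Lux.
transitivity (\int[gauss2 R]_(z in Omega) (ux z * herm' l z.1)).
  by apply: eq_Rintegral => x _; rewrite mulrC.
rewrite -h.
- rewrite -RintegralZl//; last exact: (L2_L1M mOm Lv Lu).
  by apply: eq_Rintegral => x _; ring.
- by move=> n; rewrite -WE -FE; exact: (test_weak_x oO Lu Lux wu (tphi n)).
- by move=> n; exact: (LW n).1.
- exact: (L2Z mOm l Lv).1.
- by move=> n; exact: (LF n).1.
- exact: Ls.1.
- by move=> z Oz; apply: lim1 => //; have [_ _ _] := hC _ (Oa Oz).
- by move=> z Oz; apply: lim1 => //; have [_ _ + _] := hC _ (Oa Oz).
- by move=> n z Oz; apply: bM; have [_ + _ _] := hC _ (Oa Oz); apply.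
- by move=> n z Oz; apply: bM; have [+ _ _ _] := hC _ (Oa Oz); apply.
Qed.

(** The eigenfunction does not depend on y. *)
Lemma herm_odd_eigenvalue2 : odd_neumann_eigenvalue2 Omega l.
Proof.
exists (fun z => herm l z.1), (fun z => herm' l z.1), (fun=> 0); split; last first.
  by apply: aeW => z _; rewrite hermN.
split.
- split.
  + exact: fst_L2 (smooth1_continuous shm).
  + exact: fst_L2 (smooth1_continuous shm').
  + exact: L2_cst.
  + by rewrite -dherm; exact: fst_weak_partial_x.
  + exact: fst_weak_partial_y.
- apply: (@not_ae_eq0 _ _ plane _ _ (rect 0 a (- b) b)).
  + by apply: gauss2_rect_neq0 => //; rewrite gtrN.
  + exact: measurable_rect.
  + rewrite OmegaE => z [/=]; rewrite !in_itv/= => /andP[x0 x1] zb; split => //=.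
    by rewrite in_itv/= x1 andbT (lt_trans _ x0)// oppr_lt0.
  + by move=> z [/=]; rewrite in_itv/= => xa _; rewrite gt_eqF// (herm_gt0 l0 s_gt0).
- move=> u ux uy [Lu Lux _ wu _]; rewrite -(rectangle_weak_equation Lu Lux wu).
  by apply: eq_Rintegral => z _; rewrite mul0r addr0.
Qed.

End ground_state_eigenvalue.

(** * Comparison of the eigenvalues *)

(** Omega contains the segment from (x, y) to its mirror image (- x, y). *)
Lemma convex_symmetric_hull (R : realType) (Omega : set (R * R)) (x x' y : R) :
  bounded_convex_domain Omega -> y_axis_symmetric Omega ->
  Omega (x, y) -> `|x'| <= `|x| -> Omega (x', y).
Proof.
move=> [_ _ _ _ cO] sO Oxy xx; have [x0|x0] := eqVneq x 0.
  by move: xx; rewrite x0 normr0 normr_le0 => /eqP ->; rewrite -x0.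
pose t : R := (1 + x' / x) / 2.
have /andP[q1 q2] : -1 <= x' / x <= 1.
  by rewrite -ler_norml normf_div ler_pdivrMr ?normr_gt0// mul1r.
have t0 : 0 <= t by rewrite divr_ge0//; lra.
have t1 : t <= 1 by rewrite ler_pdivrMr//; lra.
have := cO (x, y) (- x, y) (Itv01 t0 t1).
rewrite !inE => /(_ Oxy (sO _ _ Oxy)).
by congr Omega; congr pair; rewrite /= /GRing.scale/= /t /unstable.onem; field.
Qed.

Section rayleigh.
Context d (T : measurableType d) (R : realType).
Variables (m : {measure set T -> \bar R}) (D : set T).
Hypothesis mD : measurable D.

Lemma L2_norm_gt0 (u : T -> R) : L2_on m D u ->
  ~ {ae m, forall z, D z -> u z = 0} -> 0 < \int[m]_(z in D) (u z ^+ 2).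
Proof.
move=> [mu u2] un0; rewrite lt0r Rintegral_ge0 ?andbT; last by move=> z _; exact: sqr_ge0.
apply/eqP => u0; apply: un0.
have I0 : (\int[m]_(z in D) (u z ^+ 2)%:E = 0)%E.
  by rewrite -[LHS]fineK ?integrable_fin_num//; congr EFin.
have mu2 : measurable_fun D (fun z => (u z ^+ 2)%:E) by exact: measurable_int u2.
have := (ae_eq_integral_abs m mD mu2).1.
under eq_integral do rewrite gee0_abs ?lee_fin ?sqr_ge0//.
move=> /(_ I0); apply: (@filterS _ _ (ae_filter_ringOfSetsType m)) => z h Dz.
by have [/eqP] := h Dz; rewrite sqrf_eq0 => /eqP.
Qed.

End rayleigh.

Section spectral_bounds.
Variables (R : realType) (a l : R).
Hypothesis l0 : 0 < l.
Hypothesis s_gt0 : forall x, - a < x < a -> 0 < herm' l x.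
Notation line := (measurableTypeR R).
Notation plane := (measurableTypeR R * measurableTypeR R)%type.

(** The Rayleigh quotient of an eigenfunction is its eigenvalue. *)
Lemma odd_eigenvalue2_ge (Omega : set (R * R)) (nu : R) : open Omega ->
  (forall x x' y : R, Omega (x, y) -> `|x'| <= `|x| -> Omega (x', y)) ->
  (forall z, Omega z -> - a < z.1 < a) ->
  odd_neumann_eigenvalue2 Omega nu -> l <= nu.
Proof.
move=> oO hull Oa [u [ux [uy [[hu u0 eq] ou]]]].
have [Lu Lux Luy wx wy] := hu; have mOm := mO oO.
have := eq u ux uy hu.
have := odd_poincare oO hull l0 s_gt0 Oa Lu Lux wx ou.
have I0 := L2_norm_gt0 mOm Lu u0.
have -> : \int[gauss2 R]_(z in Omega) (u z * u z) = \int[gauss2 R]_(z in Omega) (u z ^+ 2).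
  by apply: eq_Rintegral => z _; rewrite expr2.
move=> h1 h2; rewrite -(ler_pM2r I0) -h2 (le_trans h1)//.
apply: le_Rintegral => //.
- exact: Lux.2.
- by have := L1D mOm Lux.2 Luy.2; rewrite /L1; under eq_fun do rewrite !expr2.
- by move=> z _; rewrite expr2 lerDl -expr2 sqr_ge0.
Qed.

Let D : set line := `]- a, a[%classic.
Let mD : measurable D. Proof. exact: measurable_itv. Qed.
Let Doo : (gauss1 R D < +oo)%E. Proof. exact: gauss1_lty. Qed.

(** Testing the weak equation with the constant 1 gives nu times the mean of the
    eigenfunction equal to 0, so [mean_zero_poincare] applies. *)
Lemma eigenvalue1_ge (nu : R) : nu <> 0 ->
  neumann_eigenvalue1 (`]- a, a[%classic : set R) nu -> l <= nu.
Proof.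
move=> nu0 [v [v' [hv v0 eq]]]; have [Lv Lv' wv] := hv.
have h1 : H1_1 (`]- a, a[%classic : set R) (fun=> 1) (fun=> 0).
  split; [exact: L2_cst|exact: L2_cst|].
  have := @smooth1_weak_deriv R (fun=> 1) `]- a, a[%classic (@smooth1_cst R 1).
  by rewrite (_ : derive1 (fun _ : R => 1 : R) = fun=> 0)//; apply/funext => x; rewrite derive1_cst.
have mean0 : \int[gauss1 R]_(x in D) v x = 0.
  have := eq _ _ h1; under eq_Rintegral do rewrite mulr0.
  under [X in _ = _ * X -> _]eq_Rintegral do rewrite mulr1.
  rewrite Rintegral_cst// mul0r => /esym/eqP; rewrite mulf_eq0 => /orP[/eqP//|/eqP//].
have := mean_zero_poincare l0 s_gt0 Lv Lv' wv mean0.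
have I0 := L2_norm_gt0 mD Lv v0; have := eq _ _ hv.
under eq_Rintegral do rewrite -expr2.
under [X in _ = _ * X -> _]eq_Rintegral do rewrite -expr2.
by move=> ->; rewrite ler_pM2r.
Qed.

End spectral_bounds.

Theorem theorem1p1 (R : realType) (Omega : set (R * R)) (a : R) (p q : R -> R)
    (dom_Omega : bounded_convex_domain Omega)
    (sym_Omega : y_axis_symmetric Omega)
    (a_gt0 : 0 < a)
    (p_concave : concave_on [set x : R | - a < x < a] p)
    (q_concave : concave_on [set x : R | - a < x < a] (fun x => - q x))
    (p_even : even_on [set x : R | - a < x < a] p)
    (q_even : even_on [set x : R | - a < x < a] (fun x => - q x))
    (OmegaE : Omega = [set z : R * R | - a < z.1 < a /\ q z.1 < z.2 < p z.1]) :
  (mu1 (- a)%:E a%:E <= mu1_odd Omega)%E /\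
  (forall b : R, 0 < b ->
     Omega = [set z : R * R | - a < z.1 < a /\ - b < z.2 < b] ->
     mu1_odd Omega = mu1 (- a)%:E a%:E).
Proof.
have [l [l0 s_gt0 sa sNa]] := exists_ground_state a_gt0.
have oO : open Omega by case: dom_Omega.
have Oa z : Omega z -> - a < z.1 < a by rewrite OmegaE => -[].
have itvE : [set x : R | ((- a)%:E < x%:E < a%:E)%E] = `]- a, a[%classic.
  by apply/seteqP; split => x; rewrite /= !lte_fin in_itv.
have mu1_le : (mu1 (- a)%:E a%:E <= l%:E)%E.
  apply: ereal_inf_lbound; exists l => //; split; last exact/eqP/lt0r_neq0.
  by rewrite itvE; exact: herm_eigenvalue1.
have le_mu1_odd : (l%:E <= mu1_odd Omega)%E.
  apply: le_ereal_inf_tmp => _ [nu nuE <-]; rewrite lee_fin.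
  apply: (odd_eigenvalue2_ge l0 s_gt0 oO _ Oa nuE) => x x' y.
  exact: convex_symmetric_hull.
split; first exact: le_trans mu1_le le_mu1_odd.
move=> b b0 rectE; apply/eqP; rewrite eq_le (le_trans mu1_le le_mu1_odd) andbT.
apply: (@le_trans _ _ l%:E).
  apply: ereal_inf_lbound; exists l => //.
  apply: (herm_odd_eigenvalue2 a_gt0 l0 s_gt0 sa sNa b0 oO).
  rewrite rectE; apply/seteqP; split => z; rewrite /rect /= !in_itv/=.
    by move=> [].
  by move=> [].
apply: le_ereal_inf_tmp => _ [nu [nuE nu0] <-]; rewrite lee_fin.
by apply: (eigenvalue1_ge l0 s_gt0 nu0); rewrite -itvE.
Qed.
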